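(* There is an absolute constant $C>0$ such that the following holds. Let $\varepsilon>0$ be sufficiently small and let $T\ge C\log n/\varepsilon^2$. For an unweighted undirected multigraph $G$ on a fixed set of $n$ vertices, dynamically updated by edge insertions and deletions, one can maintain, in $O(\log n/\varepsilon^2)$ amortized time and $O(\log^2 n\,\log T/\varepsilon^4)$ worst-case time per edge insertion or deletion, an orientation of $G$ and (implicitly) the vertices of a subgraph of $G$ such that, whenever $\mathrm{OPT}_{LP}\le T$, the maximum in-degree of the orientation is at most $(1+\varepsilon)\mathrm{OPT}_{LP}+O(\log n/\varepsilon)$ and the density of the subgraph is at least $(1-\varepsilon)\mathrm{OPT}_{LP}-O(\log n/\varepsilon)$.
   Context: An orientation directs each edge (each parallel copy separately) towards one endpoint; the in-degree of a vertex is the number of edges directed into it. The density of $S\ne\emptyset$ is $|E(S)|/|S|$, with $E(S)$ the multiset of edges having both endpoints in $S$. $\mathrm{OPT}_{LP}$ is the current maximum density over nonempty vertex sets (equivalently the minimum over fractional orientations of the maximum fractional in-degree). Maintaining vertices of a subgraph implicitly means maintaining a representation from which they can be listed in $O(1)$ time per vertex. *)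

(* Defs.v *)
From mathcomp Require Import all_boot all_order all_algebra.
From mathcomp Require Import reals exp.

Set Implicit Arguments.
Unset Strict Implicit.
Unset Printing Implicit Defensive.

Import Order.TTheory GRing.Theory Num.Theory.
Local Open Scope ring_scope.

(** * Word RAM

    A word RAM with [2 ^ w] words of memory, each of [w] bits, programmed in a
    while language.  A program mentions finitely many registers, and registers
    cannot be addressed indirectly.  Time is the number of operations executed,
    counting every node of every evaluated expression. *)

Inductive binop := OpAdd | OpSub | OpMul | OpDiv | OpLt | OpEq.

Inductive expr :=
| Const of nat
| Reg of nat
| Deref of expr
| Bin of binop & expr & expr.

Inductive cmd :=
| Assign of nat & expr
| Store of expr & expr
| Output of expr
| Skip
| Seq of cmd & cmd
| If of expr & cmd & cmd
| While of expr & cmd.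

Definition memory := nat -> nat.

Record state := State { regs : nat -> nat; ram : memory; outs : seq nat }.

(* Subtraction saturates at 0, [x / 0] is 0, and comparisons yield 0 or 1. *)
Definition eval_binop (o : binop) (x y : nat) : nat :=
  match o with
  | OpAdd => (x + y)%N
  | OpSub => (x - y)%N
  | OpMul => (x * y)%N
  | OpDiv => (x %/ y)%N
  | OpLt => nat_of_bool (x < y)%N
  | OpEq => nat_of_bool (x == y)%N
  end.

(* Every result is truncated to [w] bits. *)
Fixpoint eval (w : nat) (s : state) (e : expr) : nat :=
  match e with
  | Const c => (c %% 2 ^ w)%N
  | Reg i => regs s i
  | Deref a => ram s (eval w s a)
  | Bin o e1 e2 => (eval_binop o (eval w s e1) (eval w s e2) %% 2 ^ w)%N
  end.

Fixpoint expr_cost (e : expr) : nat :=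
  match e with
  | Const _ | Reg _ => 1%N
  | Deref a => (expr_cost a).+1
  | Bin _ e1 e2 => (expr_cost e1 + expr_cost e2).+1
  end.

Definition upd (f : nat -> nat) (i x : nat) : nat -> nat :=
  fun j => if j == i then x else f j.

Inductive exec (w : nat) : cmd -> state -> nat -> state -> Prop :=
| ExecAssign i e s :
    exec w (Assign i e) s (expr_cost e).+1
      (State (upd (regs s) i (eval w s e)) (ram s) (outs s))
| ExecStore a e s :
    exec w (Store a e) s (expr_cost a + expr_cost e).+1
      (State (regs s) (upd (ram s) (eval w s a) (eval w s e)) (outs s))
| ExecOutput e s :
    exec w (Output e) s (expr_cost e).+1
      (State (regs s) (ram s) (rcons (outs s) (eval w s e)))
| ExecSkip s : exec w Skip s 1 s
| ExecSeq c1 c2 s1 s2 s3 t1 t2 :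
    exec w c1 s1 t1 s2 -> exec w c2 s2 t2 s3 ->
    exec w (Seq c1 c2) s1 (t1 + t2) s3
| ExecIf b c1 c2 s1 s2 t :
    exec w (if eval w s1 b != 0%N then c1 else c2) s1 t s2 ->
    exec w (If b c1 c2) s1 ((expr_cost b).+1 + t) s2
| ExecWhileEnd b c s :
    eval w s b = 0%N -> exec w (While b c) s (expr_cost b).+1 s
| ExecWhileStep b c s1 s2 s3 t1 t2 :
    eval w s1 b <> 0%N -> exec w c s1 t1 s2 ->
    exec w (While b c) s2 t2 s3 ->
    exec w (While b c) s1 ((expr_cost b).+1 + t1 + t2) s3.

(* Only the memory survives from one call to the next: a call starts with the
   arguments in the first registers, 0 in the others, and no output. *)
Definition call_state (args : seq nat) (M : memory) : state :=
  State (nth 0%N args) M [::].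

Definition call (w : nat) (c : cmd) (args : seq nat) (M : memory) (t : nat)
    (M' : memory) : Prop :=
  exists2 s, exec w c (call_state args M) t s & ram s = M'.

(* A query leaves the memory as it found it. *)
Definition query (w : nat) (c : cmd) (args : seq nat) (M : memory) (t : nat)
    (o : seq nat) : Prop :=
  exists s, [/\ exec w c (call_state args M) t s, ram s = M & outs s = o].

(** * Dynamic multigraphs *)

(* The edges, each with the name that distinguishes it from its parallel
   copies. *)
Definition multigraph (n : nat) := seq (nat * ('I_n * 'I_n)).

Inductive update (n : nat) :=
| Insert of 'I_n & 'I_n
| Delete of nat.
Arguments Delete {n}.

(* [evolves us G]: the sequence of updates [us] is legal and turns the edgeless
   graph into [G].  An edge is named by the position in [us] of the update that
   inserts it. *)
Inductive evolves (n : nat) : seq (update n) -> multigraph n -> Prop :=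
| EvolvesNil : evolves [::] [::]
| EvolvesInsert us G u v :
    evolves us G -> u != v ->
    evolves (rcons us (Insert u v)) ((size us, (u, v)) :: G)
| EvolvesDelete us G e :
    evolves us G -> e \in [seq x.1 | x <- G] ->
    evolves (rcons us (Delete e)) [seq x <- G | x.1 != e].

Definition num_edges_in (n : nat) (G : multigraph n) (S : {set 'I_n}) : nat :=
  count (fun x => (x.2.1 \in S) && (x.2.2 \in S)) G.

Definition density (R : realType) (n : nat) (G : multigraph n)
    (S : {set 'I_n}) : R :=
  (num_edges_in G S)%:R / #|S|%:R.

Definition opt_lp (R : realType) (n : nat) (G : multigraph n) : R :=
  \big[Num.max/0]_(S : {set 'I_n} | S != set0) density R G S.

(* [head e] is the endpoint towards which the edge named [e] is directed. *)
Definition is_orientation (n : nat) (G : multigraph n) (head : nat -> 'I_n) :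
    Prop :=
  forall x, x \in G -> head x.1 = x.2.1 \/ head x.1 = x.2.2.

Definition indegree (n : nat) (G : multigraph n) (head : nat -> 'I_n)
    (v : 'I_n) : nat :=
  count (fun x => head x.1 == v) G.

Definition max_indegree (n : nat) (G : multigraph n) (head : nat -> 'I_n) :
    nat :=
  \max_(v < n) indegree G head v.

(** * Dynamic algorithms *)

Record algorithm := Algorithm {
  insert_cmd : cmd;
  delete_cmd : cmd;
  head_cmd : cmd;
  list_cmd : cmd
}.

(* [params] are the parameters of the problem, passed to every call.  The
   [e]-th update is an insertion of the edge named [e]. *)
Definition update_call (w : nat) (A : algorithm) (params : seq nat) (n : nat)
    (e : nat) (u : update n) : memory -> nat -> memory -> Prop :=
  match u with
  | Insert x y =>
      call w (insert_cmd A) (params ++ [:: e; nat_of_ord x; nat_of_ord y])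
  | Delete e' => call w (delete_cmd A) (params ++ [:: e'])
  end.

(* [runs w A params us ts M]: started on zeroed memory and without any
   preprocessing, [A] handles the updates [us] in times [ts] and ends with
   memory [M]. *)
Inductive runs (w : nat) (A : algorithm) (params : seq nat) (n : nat) :
    seq (update n) -> seq nat -> memory -> Prop :=
| RunsNil : runs w A params [::] [::] (fun _ => 0%N)
| RunsRcons us ts M u t M' :
    runs w A params us ts M ->
    update_call w A params (size us) u M t M' ->
    runs w A params (rcons us u) (rcons ts t) M'.

(* The orientation is held explicitly: the head of an edge is read in time at
   most [k]. *)
Definition holds_orientation (k w : nat) (A : algorithm) (params : seq nat)
    (M : memory) (n : nat) (G : multigraph n) (head : nat -> 'I_n) : Prop :=
  is_orientation G head /\
  forall x, x \in G -> exists2 t, (t <= k)%N &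
    query w (head_cmd A) (params ++ [:: x.1]) M t [:: nat_of_ord (head x.1)].

(* The vertex set is held implicitly: it is listed, without repetition, in time
   at most [k] per vertex. *)
Definition holds_vertices (k w : nat) (A : algorithm) (params : seq nat)
    (M : memory) (n : nat) (S : {set 'I_n}) : Prop :=
  S != set0 /\
  exists t o, [/\ (t <= k * #|S|)%N, query w (list_cmd A) params M t o &
    perm_eq o [seq nat_of_ord v | v in S]].

(* Real parameters reach the machine rounded to integers. *)
Definition ceil_nat (R : realType) (x : R) : nat := `|Num.ceil x|%N.

(* Main.v *)
Require Import Defs.
From mathcomp Require Import all_boot all_order all_algebra.
From mathcomp Require Import zify ring lra.
From mathcomp Require Import boolp reals exp.

(* Every vertex has a level, and its in-degree is kept near the threshold of this
   level; the thresholds grow by the factor [1 + 1 / D] and the summand 4 from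
   one level to the next, where [D] is of order [log n / eps ^ 2].  Every edge has
   a label, the level of its head or the next level; it is redirected when the
   label would otherwise exceed the level of its tail by more than 2.  A vertex
   moves its incoming edges from the one label to the other at the rate of [2 * D]
   per unit of in-degree, so that no edge remains to be relabelled when the level
   changes.  An update thus follows a path along which the levels are monotone
   and spends [O(D)] at each of its vertices, which is the worst-case bound.

   For the amortized bound, let [Phi] be the sum over the vertices of a convex
   function of the in-degree whose increments are the levels.  Redirecting an
   edge decreases [Phi].  An update changes [Phi] by the level of the head of the
   edge, and it changes the minimum of [Phi] over all orientations by the level
   of that vertex in an optimal orientation.  The two levels differ by [O(D)],
   since otherwise the sets of the vertices that are high in one orientation and
   low in the other would double in size [log n] times.  Hence the excess of
   [Phi] over its minimum grows by [O(D)] in an update.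

   The subgraph is found by adding the levels from the top, two at a time, until
   the set of vertices grows by a factor less than [1 + 1 / (8 * E)], where [E]
   is [1 / eps] rounded up; this takes [O(log n / eps)] steps.  All the edges
   into the last set but one are inside the last set, whose density is therefore
   close to the threshold of its level, hence to the largest in-degree. *)

(** * Programs without truncation *)

(** Relabelling an edge leaves [Phi] unchanged, so [Phi] alone cannot pay for it. The potential
    [pot] therefore adds to [Phi] the relabellings owed at each vertex, which are O(D) per vertex.
    Every iteration of a repair loop except the last lowers both such a potential and a second
    measure, bounded by the levels left on the path; the first gives the amortized bound and the
    second the worst-case bound. The time bounds must hold even when the optimum exceeds [T]. Hence
    the levels are capped: the threshold of a level never exceeds [4 * Tc], which leaves O(D log T)
    levels. There is no preprocessing, so the zeroed memory must already represent the edgeless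
    graph: all vertices have level 0, vertices of level 0 lie in no bag, and the threshold of a
    level is stored when a vertex rises to it. The program is verified by loop-free blocks over
    unbounded integers. Each loop invariant restores one bound [X] on all values, so a fixed power
    of [X] bounds everything computed inside an iteration. *)

Fixpoint evalN (s : state) (e : expr) : nat :=
  match e with
  | Const c => c
  | Reg i => regs s i
  | Deref a => ram s (evalN s a)
  | Bin o a b => eval_binop o (evalN s a) (evalN s b)
  end.

(** The value on [While] is a placeholder: [defs] rejects loops, and [while_exec] deals with
    them. *)
Fixpoint runN (c : cmd) (s : state) : state :=
  match c with
  | Assign i e => State (upd (regs s) i (evalN s e)) (ram s) (outs s)
  | Store a e => State (regs s) (upd (ram s) (evalN s a) (evalN s e)) (outs s)
  | Output e => State (regs s) (ram s) (rcons (outs s) (evalN s e))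
  | Skip => s
  | Seq c1 c2 => runN c2 (runN c1 s)
  | If b c1 c2 => if evalN s b != 0 then runN c1 s else runN c2 s
  | While _ _ => s
  end.

Fixpoint cost_max (c : cmd) : nat :=
  match c with
  | Assign _ e => (expr_cost e).+1
  | Store a e => (expr_cost a + expr_cost e).+1
  | Output e => (expr_cost e).+1
  | Skip => 1
  | Seq c1 c2 => cost_max c1 + cost_max c2
  | If b c1 c2 => (expr_cost b).+1 + (cost_max c1 + cost_max c2)
  | While _ _ => 0
  end.

Fixpoint expr_ok (D : seq nat) (e : expr) : bool :=
  match e with
  | Const c => c <= 64
  | Reg i => i \in D
  | Deref a => expr_ok D a
  | Bin _ a b => expr_ok D a && expr_ok D b
  end.

(* [defs D c]: the registers holding a known value after the loop-free command
   [c], when those of [D] do before; [None] if [c] reads another register. *)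
Fixpoint defs (D : seq nat) (c : cmd) : option (seq nat) :=
  match c with
  | Assign i e => if expr_ok D e then Some (i :: D) else None
  | Store a e => if expr_ok D a && expr_ok D e then Some D else None
  | Output e => if expr_ok D e then Some D else None
  | Skip => Some D
  | Seq c1 c2 => if defs D c1 is Some D1 then defs D1 c2 else None
  | If b c1 c2 =>
      if expr_ok D b then
        match defs D c1, defs D c2 with
        | Some D1, Some D2 => Some [seq i <- D1 | i \in D2]
        | _, _ => None
        end
      else None
  | While _ _ => None
  end.

Definition bounded (D : seq nat) (X : nat) (s : state) : Prop :=
  (forall i, i \in D -> regs s i <= X) /\ (forall m, ram s m <= X).

Lemma leq_expS X a b : 64 <= X -> a <= b -> X ^ a <= X ^ b.
Proof. by move=> hX; rewrite leq_exp2l //; lia. Qed.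

Lemma bounded_leq D X Y s : X <= Y -> bounded D X s -> bounded D Y s.
Proof. by move=> h [h1 h2]; split=> i => [/h1|]; [|have := h2 i]; lia. Qed.

(** Exponents add: the sum and the product of values at most [X ^ a1] and [X ^ a2] are at most
    [X ^ (a1 + a2)], and a value read from memory is at most [X] again. The exponent depends on the
    expression alone, so that it can be fixed before the word size. *)
Lemma evalN_bound e : exists2 a, 0 < a & forall X D s w,
  64 <= X -> bounded D X s -> expr_ok D e ->
  evalN s e <= X ^ a /\ (X ^ a < 2 ^ w -> eval w s e = evalN s e).
Proof.
elim: e => [c|i|e [a a0 IH]|o e1 [a1 a10 IH1] e2 [a2 a20 IH2]].
- exists 1 => // X D s w hX hb /= hc; rewrite expn1; split; first lia.
  by move=> hw; rewrite modn_small //; lia.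
- by exists 1 => // X D s w hX [hb _] /= /hb; rewrite expn1; split.
- exists a => // X D s w hX hb /= /(IH _ _ _ w hX hb)[h1 h2]; split.
    by have := hb.2 (evalN s e); have := leq_expS X 1 a hX a0; lia.
  by move=> hw; rewrite h2.
exists (a1 + a2); first lia.
move=> X D s w hX hb /= /andP[/(IH1 _ _ _ w hX hb)[h1 k1]].
move=> /(IH2 _ _ _ w hX hb)[h2 k2].
have p1 : X <= X ^ a1 by have := leq_expS X 1 a1 hX a10; lia.
have p2 : X <= X ^ a2 by have := leq_expS X 1 a2 hX a20; lia.
have hv : eval_binop o (evalN s e1) (evalN s e2) <= X ^ (a1 + a2).
  rewrite expnD; case: o => /=; [nia | nia | nia | | |].
  - by have := leq_div (evalN s e1) (evalN s e2); nia.
  - by case: (_ < _); nia.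
  - by case: (_ == _); nia.
split=> // hw; rewrite k1 ?k2 ?modn_small //; first lia.
- by have := leq_expS X a2 (a1 + a2) hX (leq_addl _ _); lia.
- by have := leq_expS X a1 (a1 + a2) hX (leq_addr _ _); lia.
Qed.

(* A loop-free command run on a machine with long enough words computes what it
   computes with unbounded words: its values are bounded by a fixed power of
   the values that it starts from. *)
Lemma runN_exec c : exists2 a, 0 < a & forall X D D' s w,
  64 <= X -> bounded D X s -> defs D c = Some D' -> X ^ a < 2 ^ w ->
  bounded D' (X ^ a) (runN c s) /\
  exists2 t, t <= cost_max c & exec w c s t (runN c s).
Proof.
elim: c => [i e|b e|e||c1 [a1 a10 IH1] c2 [a2 a20 IH2]
    |b c1 [a1 a10 IH1] c2 [a2 a20 IH2]|b c _].
- have [a a0 H] := evalN_bound e; exists a => // X D D' s w hX hb /=.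
  case: ifP => // he [<-] hw; have [h1 h2] := H _ _ _ w hX hb he.
  have p : X <= X ^ a by have := leq_expS X 1 a hX a0; lia.
  split; last by eexists; [|rewrite -h2 //; apply: ExecAssign]; [].
  split=> [j|m] /=; last by have := hb.2 m; lia.
  by rewrite inE /upd; case: eqP => //= _ /hb.1; lia.
- have [a a0 H] := evalN_bound b; have [a' a0' H'] := evalN_bound e.
  exists (a + a'); first lia.
  move=> X D D' s w hX hb /=; case: ifP => // /andP[hb1 he] [<-] hw.
  have [h1 h2] := H _ _ _ w hX hb hb1; have [h1' h2'] := H' _ _ _ w hX hb he.
  have p := leq_expS X a (a + a') hX (leq_addr _ _).
  have p' := leq_expS X a' (a + a') hX (leq_addl _ _).
  have pX : X <= X ^ a by have := leq_expS X 1 a hX a0; lia.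
  split; last by eexists; [|rewrite -h2 ?(leq_ltn_trans p) // -h2'
    ?(leq_ltn_trans p') //; apply: ExecStore]; [].
  split=> [j /hb.1|m] /=; first lia.
  by rewrite /upd; case: eqP => _; [lia | have := hb.2 m; lia].
- have [a a0 H] := evalN_bound e; exists a => // X D D' s w hX hb /=.
  case: ifP => // he [<-] hw; have [h1 h2] := H _ _ _ w hX hb he.
  have p : X <= X ^ a by have := leq_expS X 1 a hX a0; lia.
  split; last by eexists; [|rewrite -h2 //; apply: ExecOutput]; [].
  by apply: bounded_leq hb.
- exists 1 => // X D D' s w hX hb /= [<-] _; rewrite expn1; split=> //.
  by exists 1 => //; apply: ExecSkip.
(* The second command starts from values bounded by [X ^ a1], so the exponents multiply. *)
- exists (a1 * a2); first nia.
  move=> X D D' s w hX hb /=; case E: (defs D c1) => [D1|//] hD hw.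
  have p1 : X ^ a1 <= X ^ (a1 * a2) by apply: leq_expS; nia.
  have [|hb1 [t1 ht1 e1]] := IH1 _ _ _ _ w hX hb E; first lia.
  have pX : 64 <= X ^ a1 by have := leq_expS X 1 a1 hX a10; lia.
  have [|hb2 [t2 ht2 e2]] := IH2 _ _ _ _ w pX hb1 hD; first by rewrite -expnM.
  rewrite expnM; split=> //; exists (t1 + t2); first lia.
  exact: ExecSeq e1 e2.
- have [a a0 H] := evalN_bound b; exists (a + a1 + a2); first lia.
  move=> X D D' s w hX hb /=; case: ifP => // hb0.
  case E1: (defs D c1) => [D1|//]; case E2: (defs D c2) => [D2|//] [<-] hw.
  have q1 : X ^ a <= X ^ (a + a1 + a2) by apply: leq_expS; lia.
  have q2 : X ^ a1 <= X ^ (a + a1 + a2) by apply: leq_expS; lia.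
  have q3 : X ^ a2 <= X ^ (a + a1 + a2) by apply: leq_expS; lia.
  have [_ /(_ _)-/(_ ltac:(lia)) hv] := H _ _ _ w hX hb hb0.
  case: ifP => hc.
    have [|hb1 [t1 ht1 e1]] := IH1 _ _ _ _ w hX hb E1; first lia.
    split; first by split=> [i|m]; [rewrite mem_filter => /andP[_ /hb1.1]
      | have := hb1.2 m]; lia.
    exists ((expr_cost b).+1 + t1); first lia.
    by apply: ExecIf; rewrite hv hc.
  have [|hb1 [t1 ht1 e1]] := IH2 _ _ _ _ w hX hb E2; first lia.
  split; first by split=> [i|m]; [rewrite mem_filter => /andP[/hb1.1]
    | have := hb1.2 m]; lia.
  exists ((expr_cost b).+1 + t1); first lia.
  by apply: ExecIf; rewrite hv hc.
- by exists 1.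
Qed.

(** The invariant is indexed by the number of iterations done: a bound on the index yields
    termination, and a potential weighed against the index inside the invariant bounds the time. *)
Lemma while_exec (I : nat -> state -> Prop) (J kb w : nat) b c s :
  (forall j s, I j s -> j <= J) ->
  (forall j s, I j s -> eval w s b <> 0 ->
     exists t s', [/\ exec w c s t s', t <= kb & I j.+1 s']) ->
  I 0 s ->
  exists j t s', [/\ exec w (While b c) s t s', I j s', eval w s' b = 0 &
     t <= j.+1 * (kb + (expr_cost b).+1)].
Proof.
move=> hJ hI h0.
suff H k j s0 : J - j <= k -> I j s0 -> exists j' t s', [/\
    exec w (While b c) s0 t s', I j' s', eval w s' b = 0, j <= j' &
    t <= (j' - j).+1 * (kb + (expr_cost b).+1)].
  have [j' [t [s' [h1 h2 h3 _ h4]]]] := H _ _ _ (leqnn _) h0.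
  by exists j', t, s'; split=> //; rewrite subn0 in h4.
elim: k j s0 => [|k IH] j s0 hk hj.
  case E: (eval w s0 b == 0).
    move/eqP: E => E; exists j, (expr_cost b).+1, s0.
    by split=> //; [apply: ExecWhileEnd | rewrite subnn; lia].
  have [t [s1 [_ _ /hJ]]] := hI _ _ hj (elimF eqP E).
  by have := hJ _ _ hj; lia.
case E: (eval w s0 b == 0).
  move/eqP: E => E; exists j, (expr_cost b).+1, s0.
  by split=> //; [apply: ExecWhileEnd | rewrite subnn; lia].
have [t [s1 [h1 h2 h3]]] := hI _ _ hj (elimF eqP E).
have [|j' [t' [s' [e1 e2 e3 e4 e5]]]] := IH j.+1 s1 _ h3; first lia.
exists j', ((expr_cost b).+1 + t + t'), s'; split=> //; last 2 first.
- lia.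
- have -> : (j' - j).+1 = ((j' - j.+1).+1).+1 by lia.
  by rewrite mulSn; lia.
exact: ExecWhileStep (elimF eqP E) h1 e1.
Qed.

(** * Bags in memory *)

(* The memory is viewed as 16 interleaved arrays, each of them infinite. *)
Definition aget (M : memory) (i x : nat) : nat := M (x * 16 + i).
Definition aset (M : memory) (i x v : nat) : memory := upd M (x * 16 + i) v.

Lemma aget_aset M i x v j y : i < 16 -> j < 16 ->
  aget (aset M i x v) j y = if (j == i) && (y == x) then v else aget M j y.
Proof.
move=> hi hj; rewrite /aget /aset /upd.
have -> // : (y * 16 + j == x * 16 + i) = (j == i) && (y == x).
by apply/eqP/andP => [h|[/eqP-> /eqP->] //]; split; apply/eqP; lia.
Qed.

(* The three arrays from [f] on hold bags, numbered below [NB]: the number of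
   elements of each bag, its elements, and the position of each element in its
   bag.  [B x] is the bag that contains [x]. *)
Definition bags (f NB : nat) (M : memory) (B : nat -> option nat) : Prop :=
  (forall x b, B x = Some b -> [/\ b < NB, aget M f.+2 x < aget M f b &
     aget M f.+1 (aget M f.+2 x * NB + b) = x]) /\
  (forall b p, b < NB -> p < aget M f b ->
     B (aget M f.+1 (p * NB + b)) = Some b /\
     aget M f.+2 (aget M f.+1 (p * NB + b)) = p).

Definition bag_add (f NB : nat) (M : memory) (b x : nat) : memory :=
  let M1 := aset M f.+1 (aget M f b * NB + b) x in
  let M2 := aset M1 f.+2 x (aget M1 f b) in
  aset M2 f b (aget M2 f b + 1).

(* The last element takes the place of the one removed. *)
Definition bag_del (f NB : nat) (M : memory) (b x : nat) : memory :=
  let M1 := aset M f.+2 (aget M f.+1 ((aget M f b - 1) * NB + b))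
    (aget M f.+2 x) in
  let M2 := aset M1 f.+1 (aget M1 f.+2 x * NB + b)
    (aget M1 f.+1 ((aget M1 f b - 1) * NB + b)) in
  aset M2 f b (aget M2 f b - 1).

Lemma bags_ext f NB M M' B B' : B =1 B' ->
  (forall j x, f <= j <= f.+2 -> aget M j x = aget M' j x) ->
  bags f NB M B -> bags f NB M' B'.
Proof.
move=> hB hM [h1 h2]; split=> [x b|b p].
  by rewrite -hB => /h1; rewrite !hM //; lia.
by rewrite -!hB -!hM; [apply: h2 | lia..].
Qed.

(** The slots of the bags are interleaved modulo [NB], so that every bag can grow without
    allocation. *)
Lemma eq_slot NB p b p' b' : b < NB -> b' < NB ->
  (p * NB + b == p' * NB + b') = (p == p') && (b == b').
Proof.
move=> hb hb'; apply/eqP/andP => [h|[/eqP-> /eqP->] //].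
have e : p = p'.
  have : (p * NB + b) %/ NB = (p' * NB + b') %/ NB by rewrite h.
  by rewrite !divnMDl ?divn_small ?addn0 //; lia.
by subst p'; rewrite eqxx; split=> //; apply/eqP; lia.
Qed.

Lemma bags_add f NB M B b x : f.+2 < 16 -> bags f NB M B -> B x = None ->
  b < NB -> bags f NB (bag_add f NB M b x)
    (fun y => if y == x then Some b else B y).
Proof.
move=> hf [h1 h2] hx hb.
have e0 : bag_add f NB M b x = aset (aset (aset M f.+1 (aget M f b * NB + b) x)
    f.+2 x (aget M f b)) f b (aget M f b + 1).
  by rewrite /bag_add !aget_aset; do ?[lia];
    repeat case: ifP => ?; by [|exfalso; lia].
have g0 c : aget (bag_add f NB M b x) f c =
    if c == b then aget M f b + 1 else aget M f c.
  rewrite e0 !aget_aset; do ?[lia]; rewrite eqxx /=; case: eqP => // _.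
  by rewrite !ifN //; lia.
have g1 y : aget (bag_add f NB M b x) f.+1 y =
    if y == aget M f b * NB + b then x else aget M f.+1 y.
  rewrite e0 !aget_aset; do ?[lia]; rewrite eqxx.
  by do 2 (rewrite ifN; last by lia).
have g2 y : aget (bag_add f NB M b x) f.+2 y =
    if y == x then aget M f b else aget M f.+2 y.
  rewrite e0 !aget_aset; do ?[lia]; rewrite eqxx /= ifN; last by lia.
  by case: eqP => //= _; rewrite ifN //; lia.
split=> [y c|c p hc]; rewrite ?g0 ?g1 ?g2.
  case: (y =P x) => [->|hy] hc.
    by case: hc => <-; rewrite !eqxx; split=> //; lia.
  have [k1 k2 k3] := h1 _ _ hc; rewrite eq_slot // k3; split=> //.
    by case: eqP => [e|_]; [subst c; lia | lia].
  by case: ifP => // /andP[/eqP ? /eqP ?]; subst; lia.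
rewrite eq_slot //; case: (c =P b) => [->|hcb] hp; rewrite ?andbT ?andbF.
  case: (p =P aget M f b) => [->|hpc]; first by rewrite !eqxx.
  have [||k1 k2] := h2 b p; [by [] | lia |].
  by case: eqP => [e|]; [rewrite e hx in k1 | ].
have [k1 k2] := h2 c p hc hp.
by case: eqP => [e|]; [rewrite e hx in k1 | ].
Qed.

Lemma bags_del f NB M B b x : f.+2 < 16 -> bags f NB M B -> B x = Some b ->
  bags f NB (bag_del f NB M b x) (fun y => if y == x then None else B y).
Proof.
move=> hf [h1 h2] hx; have [hb hp hs] := h1 _ _ hx.
set y := aget M f.+1 ((aget M f b - 1) * NB + b).
set p := aget M f.+2 x in hp hs *; set c := aget M f b in hp y *.
have [|hy1 hy2] := h2 b (c - 1) hb; first by rewrite -/c; lia.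
rewrite -/y in hy1 hy2.
have e0 : bag_del f NB M b x =
    aset (aset (aset M f.+2 y p) f.+1 (p * NB + b) y) f b (c - 1).
  rewrite /bag_del -/c -/y -/p !aget_aset; do ?[lia].
  have -> : (f == f.+1) = false by lia.
  have -> : (f == f.+2) = false by lia.
  have -> : (f.+1 == f.+2) = false by lia.
  rewrite !eqxx /= -/c -/y -/p; by case: eqP.
have g0 d : aget (bag_del f NB M b x) f d =
    if d == b then c - 1 else aget M f d.
  rewrite e0 !aget_aset; do ?[lia]; rewrite eqxx /=; case: eqP => // _.
  by rewrite !ifN //; lia.
have g1 z : aget (bag_del f NB M b x) f.+1 z =
    if z == p * NB + b then y else aget M f.+1 z.
  rewrite e0 !aget_aset; do ?[lia]; rewrite eqxx.
  by rewrite ifN; [case: eqP => //= _; rewrite ifN //; lia | lia].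
have g2 z : aget (bag_del f NB M b x) f.+2 z =
    if z == y then p else aget M f.+2 z.
  rewrite e0 !aget_aset; do ?[lia]; rewrite eqxx.
  by do 2 (rewrite ifN; last by lia).
(* Among the remaining elements only [y], the last one of the bag, has moved; it took the position
   [p] of [x]. *)
have uy z d : B z = Some d -> z <> x -> [/\ d < NB,
    (if z == y then p else aget M f.+2 z) < (if d == b then c - 1 else aget M f d)
    & (if (if z == y then p else aget M f.+2 z) * NB + d == p * NB + b then y
       else aget M f.+1 ((if z == y then p else aget M f.+2 z) * NB + d)) = z].
  move=> hz hzx; have [k1 k2 k3] := h1 _ _ hz; split=> //.
    case: (z =P y) => [e|hzy].
      rewrite e hy1 in hz; case: hz => <-; rewrite eqxx.
      have : p <> c - 1 by move=> e'; apply: hzx; rewrite e -hs e'.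
      by lia.
    case: (d =P b) => // e; subst d.
    have : aget M f.+2 z <> c - 1.
      by move=> e'; apply: hzy; rewrite -k3 e'.
    by move: k2; rewrite -/c; lia.
  rewrite eq_slot //; case: (z =P y) => [e|hzy].
    by move: hz; rewrite e hy1 => -[->]; rewrite !eqxx.
  case: ifP => // /andP[/eqP e1 /eqP e2]; subst d.
  by move: k3; rewrite e1 hs => e; case: hzx.
split=> [z d|d q hd]; rewrite ?g0 ?g1 ?g2.
  by case: (z =P x) => // hzx hz; apply: uy.
rewrite eq_slot //.
case: (d =P b) => [->|hdb]; rewrite ?andbT ?andbF => hq.
  case: (q =P p) => [eqp|hqp].
    rewrite eqp eqxx hy1 in hq *; case: (y =P x) => // e.
    by move: hy2; rewrite e -/p; lia.
  have [|k1 k2] := h2 b q hb; first by rewrite -/c; lia.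
  case: eqP => [e|hne]; first by move: k2; rewrite e -/p; lia.
  by case: eqP => [e|//]; move: k2; rewrite e hy2; lia.
have [k1 k2] := h2 d q hd hq.
case: eqP => [e|hne]; first by move: k1; rewrite e hx => -[]; congruence.
by case: eqP => [e|//]; move: k1; rewrite e hy1 => -[]; congruence.
Qed.

Lemma bag_add_aget f NB M b x j y : f.+2 < 16 -> j < 16 -> ~~ (f <= j <= f.+2) ->
  aget (bag_add f NB M b x) j y = aget M j y.
Proof.
move=> hf hj h; rewrite /bag_add.
by do 3 (rewrite aget_aset; [rewrite ifN; last by lia | lia | lia]).
Qed.

Lemma bag_del_aget f NB M b x j y : f.+2 < 16 -> j < 16 -> ~~ (f <= j <= f.+2) ->
  aget (bag_del f NB M b x) j y = aget M j y.
Proof.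
move=> hf hj h; rewrite /bag_del.
by do 3 (rewrite aget_aset; [rewrite ifN; last by lia | lia | lia]).
Qed.

Definition bag_elems (f NB : nat) (M : memory) (b : nat) : seq nat :=
  [seq aget M f.+1 (p * NB + b) | p <- iota 0 (aget M f b)].

Lemma bag_elems_uniq f NB M B b : bags f NB M B -> b < NB ->
  uniq (bag_elems f NB M b).
Proof.
move=> [_ h] hb; rewrite map_inj_in_uniq ?iota_uniq // => p q.
rewrite !mem_iota /= !add0n => hp hq e.
by rewrite -(h b p hb hp).2 e (h b q hb hq).2.
Qed.

Lemma mem_bag_elems f NB M B b x : bags f NB M B -> b < NB ->
  (x \in bag_elems f NB M b) = (B x == Some b).
Proof.
move=> [h1 h2] hb; apply/mapP/eqP => [[p]|/h1[_ hp hs]].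
  by rewrite mem_iota add0n => hp ->; have [] := h2 b p hb hp.
by exists (aget M f.+2 x); rewrite ?mem_iota.
Qed.

Lemma bag_card f NB M B b (s : seq nat) : bags f NB M B -> b < NB -> uniq s ->
  (forall x, B x = Some b -> x \in s) ->
  aget M f b = count (fun x => B x == Some b) s.
Proof.
move=> hB hb us hs; rewrite -size_filter -[LHS](size_iota 0).
rewrite -(size_map (fun p => aget M f.+1 (p * NB + b))) -/(bag_elems f NB M b).
apply/perm_size/uniq_perm; rewrite ?filter_uniq ?(bag_elems_uniq _ _ _ _ _ hB) //.
move=> x; rewrite (mem_bag_elems _ _ _ _ _ _ hB hb) mem_filter.
by case: eqP => // /hs ->.
Qed.

(** * Thresholds *)

(** The summand 4 absorbs the truncation of the division and the in-degrees that are off by one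
    while an update is in progress; it also lets the thresholds leave 0. *)
Fixpoint thr (D i : nat) : nat :=
  if i is j.+1 then thr D j + thr D j %/ D + 4 else 0.

Lemma thrS D i : thr D i.+1 = thr D i + thr D i %/ D + 4.
Proof. by []. Qed.

Arguments thr : simpl never.

Lemma thr_add D i k : thr D i + 4 * k <= thr D (i + k).
Proof.
elim: k => [|k IH]; first by rewrite addn0; lia.
by rewrite (addnS i) thrS; move: (_ %/ _) => z; lia.
Qed.

Lemma thr_le D i j : i <= j -> thr D i + 4 * (j - i) <= thr D j.
Proof. by move=> h; have := thr_add D i (j - i); rewrite subnKC. Qed.

Lemma thr_ge D i : 4 * i <= thr D i.
Proof. exact: (thr_add D 0 i). Qed.

Lemma thr_mono D : {mono thr D : i j / i <= j}.
Proof.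
move=> i j; case: (leqP i j) => h; first by have := thr_le D _ _ h; lia.
by apply/negbTE; have := thr_le D _ _ (ltnW h); lia.
Qed.

Lemma thr_pred D l : thr D l.-1 <= thr D l.
Proof. by rewrite thr_mono; lia. Qed.

(** Each of the [D] steps adds at least [thr D i %/ D + 4], and the 4 outweighs the truncation. *)
Lemma thr_double D i : 0 < D -> 2 * thr D i <= thr D (i + D).
Proof.
move=> D0; suff H k : thr D i + k * (thr D i %/ D + 4) <= thr D (i + k).
  have := H D; have := divn_eq (thr D i) D; have := ltn_pmod (thr D i) D0.
  by nia.
elim: k => [|k IH]; first by rewrite addn0; lia.
rewrite (addnS i) thrS; have : thr D i %/ D <= thr D (i + k) %/ D.
  by apply: leq_div2r; have := thr_add D i k; lia.
by lia.
Qed.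

(** The estimate $(1 + 1/D)^t \le D / (D - t)$ with its denominators cleared; for [t >= D] the
    truncated difference makes it trivial. *)
Lemma thr_growth D i t : 0 < D ->
  thr D (i + t) * (D - t) <= D * (thr D i + 4 * t).
Proof.
move=> D0; elim: t => [|t IH]; first by rewrite addn0 subn0; lia.
case: (leqP D t) => h; first by rewrite (_ : D - t.+1 = 0) ?muln0 //; lia.
rewrite (addnS i) thrS; have := leq_trunc_div (thr D (i + t)) D.
move: IH; set x := thr D (i + t); set y := x %/ D; set z := thr D i.
have -> : D - t = (D - t.+1).+1 by lia.
have : D - t.+1 <= D by lia.
move: (D - t.+1) => k hk h1 h2.
have : y * k <= y * D by rewrite leq_mul2l hk orbT.
by nia.
Qed.

(** The range of the index misses no candidate because [thr D i >= 4 * i]. *)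
Definition flev (D cap x : nat) : nat :=
  \max_(i < cap.+1 | thr D i <= minn x cap) i.

Lemma flev_max D cap x i : thr D i <= x -> thr D i <= cap -> i <= flev D cap x.
Proof.
move=> h1 h2; have hi : i < cap.+1 by have := thr_ge D i; lia.
apply: (@leq_bigmax_cond _ _ (fun i : 'I_cap.+1 => i : nat) (Ordinal hi)) => /=.
by lia.
Qed.

Lemma thr_flev D cap x : thr D (flev D cap x) <= minn x cap.
Proof.
have [|i hi] := @eq_bigmax_cond 'I_cap.+1 [pred i : 'I_cap.+1 | thr D i <= minn x cap]
  (fun i => i : nat).
  by apply/card_gt0P; exists ord0; rewrite inE.
by rewrite /flev => ->; rewrite inE in hi.
Qed.

Lemma flev_leq D cap x i : thr D i <= cap ->
  (i <= flev D cap x) = (thr D i <= x).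
Proof.
move=> hc; apply/idP/idP => h; last exact: flev_max.
by have := thr_flev D cap x; rewrite -(thr_mono D) in h; lia.
Qed.

Lemma flev_cap D cap x : thr D (flev D cap x) <= cap.
Proof. by have := thr_flev D cap x; lia. Qed.

Lemma flev_lt D cap x : thr D (flev D cap x).+1 <= cap ->
  x < thr D (flev D cap x).+1.
Proof. by move=> h; rewrite ltnNge -(flev_leq _ cap) // ltnn. Qed.

Lemma flevS D cap x : flev D cap x.+1 <= (flev D cap x).+1.
Proof.
rewrite leqNgt; apply/negP => h.
have h1 := flev_cap D cap x.+1; have h2 := thr_flev D cap x.+1.
have h3 := thr_le D _ _ h.
have : (flev D cap x).+1 <= flev D cap x.
  by apply: flev_max; have := thr_le D _ _ (leqnSn (flev D cap x).+1); lia.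
by lia.
Qed.

(** The convex function whose sum over the vertices is [Phi], given by its increments. *)
Definition fsum (D cap x : nat) : nat := \sum_(i < x) flev D cap i.

Lemma fsumS D cap x : fsum D cap x.+1 = fsum D cap x + flev D cap x.
Proof. by rewrite /fsum big_ord_recr. Qed.

(** * The local invariant at a vertex *)

Section Local.
Variables D cap : nat.
Hypothesis D2 : 1 < D.
Notation b := (thr D).
Notation r := (2 * D).

(* [l] is the level of a vertex, [d] its in-degree and [q] the number of
   incoming edges with label [l.+1] (the others have label [l]). *)
Definition vok (l d q : nat) : Prop :=
  [/\ b l.-1 <= d, q <= r * (d - b l.-1), b l <= cap &
      b l.+1 <= cap -> r * (d - b l.+1) <= q].

(* A vertex that just gained an incoming edge. *)
Definition uok (l d q : nat) : Prop :=
  [/\ b l.-1 < d, q <= r * (d - b l.-1), b l <= cap &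
      b l.+1 <= cap -> r * (d.-1 - b l.+1) <= q].

(* A vertex that just lost an incoming edge. *)
Definition dok (l d q : nat) : Prop :=
  [/\ b l.-1 <= d.+1, q <= r * (d.+1 - b l.-1), b l <= cap &
      b l.+1 <= cap -> r * (d - b l.+1) <= q].

Definition due (l d q : nat) : bool :=
  (b l.+1 <= cap) && (q < r * (d - b l.+1)).

Lemma vok_uok l d q : vok l d q -> uok l d.+1 q.
Proof. by case=> h1 h2 h3 h4; split=> //; nia. Qed.

Lemma uok_vok l d q : uok l d q -> ~~ due l d q -> vok l d q.
Proof.
by case=> h1 h2 h3 h4; rewrite negb_and => h; split=> //; lia.
Qed.

Lemma uok_relabel l d q : uok l d q -> due l d q -> uok l d q.+1.
Proof.
case=> h1 h2 h3 h4 /andP[h5 h6]; split=> // [|/h4]; last by lia.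
by have := thr_pred D l; rewrite thrS in h6; nia.
Qed.

Lemma uok_flip l d q : uok l d q -> due l d q -> vok l d.-1 q.
Proof.
case=> h1 h2 h3 h4 /andP[h5 h6]; have h7 := thr_pred D l.
have h8 := thr_le D _ _ (leqnSn l).
by split=> //; [lia | nia].
Qed.

(** This is what the rate [2 * D] is for. Only [d] edges can be relabelled, so an excess [z = d - x]
    over the threshold [x] satisfies [2 * D * z <= x + z]; hence [z] stays within the step to the
    next threshold. *)
Lemma excess z x : (2 * D).-1 * z <= x -> z <= x %/ D.
Proof. by move=> h; rewrite leq_divRL; nia. Qed.

Lemma uok_rise l d : uok l d d -> due l d d -> vok l.+1 d 0.
Proof.
case=> h1 h2 h3 h4 /andP[h5 h6]; have h7 := thr_pred D l.
have h8 : b l.+1 < d by lia.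
split=> //; first by rewrite /=; have := thr_le D _ _ (leqnSn l); lia.
move=> _; suff : d <= b l.+2 by lia.
rewrite (thrS D l.+1); set x := b l.+1 in h4 h5 h8 *.
(* The lower bound on [q] in [uok] is one unit of in-degree behind; the 2 that this costs is covered
   by the summand 4 of [thr]. *)
have : d - x - 2 <= x %/ D.
  apply: excess; have := h4 h5.
  by rewrite (_ : d.-1 - x = d - x - 1); [nia | lia].
by lia.
Qed.

Lemma vok_dok l d q q' : vok l d.+1 q -> q' <= q <= q'.+1 -> dok l d q'.
Proof.
case=> h1 h2 h3 h4 h; split=> //; first by lia.
move=> h5; have := h4 h5; case: (leqP (b l.+1) d) => hd; last by lia.
by rewrite subSn //; nia.
Qed.

Lemma dok_vok l d q : dok l d q -> b l.-1 <= d -> q <= r * (d - b l.-1) ->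
  vok l d q.
Proof. by case=> *; split. Qed.

Lemma dok_relabel l d q : dok l d q.+1 -> r * (d - b l.-1) < q.+1 -> dok l d q.
Proof.
case=> h1 h2 h3 h4 h; split=> //; first by lia.
move=> /h4 h5; have := thr_pred D l; have := thr_le D _ _ (leqnSn l); nia.
Qed.

Lemma dok_low l d q : dok l d q -> d < b l.-1 -> q = 0 /\ d.+1 = b l.-1.
Proof. by case=> h1 h2 h3 h4 h; split; nia. Qed.

Lemma dok_flip l d q : dok l d q -> d < b l.-1 -> vok l d.+1 0.
Proof.
case=> h1 h2 h3 h4 h; split=> // _.
by have := thr_pred D l; have := thr_le D _ _ (leqnSn l); nia.
Qed.

(** At the lower level all [d] edges count as hot. This is allowed because [d] is only 1 below
    [b l.-1], so its distance from the threshold before that one, times [2 * D], is at least [d]. *)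
Lemma dok_fall l d q : dok l d q -> d < b l.-1 -> vok l.-1 d d.
Proof.
move=> hk h; have [_ e] := dok_low l d q hk h; case: hk => h1 h2 h3 h4.
case: l h e {h1 h2 h4} h3 => [|[|l]] //=; rewrite (thrS D l) => h e h3.
have := divn_eq (b l) D; have := ltn_pmod (b l) (ltnW D2).
rewrite (thrS D l.+1) (thrS D l) in h3.
by move=> h5 h6; split=> /=; rewrite ?(thrS D l.+1) ?(thrS D l); nia.
Qed.

Lemma vok_ub l d q : vok l d q -> q <= d -> b l.+1 <= cap -> d <= b l.+2.
Proof.
case=> h1 h2 h3 h4 hq h5; rewrite (thrS D l.+1).
have : d - b l.+1 <= b l.+1 %/ D by apply: excess; have := h4 h5; nia.
by lia.
Qed.

(** The increments of [Phi] are values of [flev], not levels. The gap of 2 is the reason why an edge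
    is redirected upon a gain only to a vertex at least 2 levels lower: [Phi] then decreases for
    certain. *)
Lemma vok_flev l d q : vok l d q -> q <= d ->
  l <= (flev D cap d).+1 /\ flev D cap d <= l.+2.
Proof.
move=> h hq; have [h1 h2 h3 h4] := h; split.
  case: l h1 h3 {h h2 h4} => //= l h1 h3.
  by rewrite ltnS flev_max //; have := thr_pred D l.+1; rewrite /=; lia.
rewrite leqNgt; apply/negP => h5; have h6 := flev_cap D cap d.
have h7 := thr_le D _ _ h5.
have h8 := thr_le D _ _ (leqnSn l.+2); have h9 := thr_le D _ _ (leqnSn l.+1).
have := vok_ub l d q h hq; have := thr_flev D cap d; lia.
Qed.

Lemma vok_lev l d q : vok l d q -> l <= flev D cap cap.
Proof. by case=> _ _ h _; apply: flev_max. Qed.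

End Local.

(** * The levels of the vertices and the labels of the edges *)

Record conf (n : nat) := Conf {
  hd : nat -> 'I_n;
  tl : nat -> 'I_n;
  lab : nat -> nat;
  lev : 'I_n -> nat
}.
Arguments hd {n}. Arguments tl {n}. Arguments lab {n}. Arguments lev {n}.
Arguments Conf {n}.

Definition fupd (T : eqType) (S : Type) (f : T -> S) (x : T) (v : S) : T -> S :=
  fun y => if y == x then v else f y.
Arguments fupd {T S}.

Definition set_edge {n} (s : conf n) (e : nat) (h t : 'I_n) (l : nat) : conf n :=
  Conf (fupd (hd s) e h) (fupd (tl s) e t) (fupd (lab s) e l) (lev s).

Definition set_lev {n} (s : conf n) (v : 'I_n) (l : nat) : conf n :=
  Conf (hd s) (tl s) (lab s) (fupd (lev s) v l).

Definition indeg {n} (E : seq nat) (s : conf n) (v : 'I_n) : nat :=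
  count (fun e => hd s e == v) E.

Definition hot {n} (E : seq nat) (s : conf n) (v : 'I_n) : nat :=
  count (fun e => (hd s e == v) && (lab s e == (lev s v).+1)) E.

(** The first and the last clause bound the level of the head by that of the tail plus 2, the
    property used by the comparison with the optimum and by the dense subgraph. *)
Definition eok {n} (s : conf n) (e : nat) : Prop :=
  [/\ lev s (hd s e) <= lab s e, lab s e <= (lev s (hd s e)).+1 &
      lab s e <= (lev s (tl s e)).+2].

Lemma count_change (E : seq nat) (P Q : pred nat) (e : nat) : uniq E -> e \in E ->
  (forall x, x != e -> P x = Q x) -> count P E + Q e = count Q E + P e.
Proof.
move=> uE eE h; have hp := perm_to_rem eE.
rewrite !(permP hp) /= (@eq_in_count _ P Q (rem e E)).
  by rewrite addnC [RHS]addnAC addnA.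
by move=> x; rewrite mem_rem_uniq // inE => /andP[/h].
Qed.

Lemma hot_leq n E (s : conf n) v : hot E s v <= indeg E s v.
Proof. by apply: sub_count => e /andP[]. Qed.

Lemma indeg_set_edge n E (s : conf n) e h t l v : uniq E -> e \in E ->
  indeg E (set_edge s e h t l) v + (hd s e == v) = indeg E s v + (h == v).
Proof.
move=> uE eE; rewrite (@count_change E _ (fun x => hd s x == v)) //=.
  by rewrite /fupd eqxx.
by move=> x /negbTE; rewrite /fupd => ->.
Qed.

Lemma hot_set_edge n E (s : conf n) e h t l v : uniq E -> e \in E ->
  hot E (set_edge s e h t l) v +
    ((hd s e == v) && (lab s e == (lev s v).+1)) =
  hot E s v + ((h == v) && (l == (lev s v).+1)).
Proof.
move=> uE eE.
rewrite (@count_change E _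
  (fun x => (hd s x == v) && (lab s x == (lev s v).+1))) //=.
  by rewrite /fupd eqxx.
by move=> x /negbTE; rewrite /fupd => ->.
Qed.

Lemma indeg_cons n E (s : conf n) e h t l v : e \notin E ->
  indeg (e :: E) (set_edge s e h t l) v = indeg E s v + (h == v).
Proof.
move=> eE; rewrite /indeg /= {1}/fupd eqxx addnC; congr (_ + _).
apply: eq_in_count => x hx; rewrite /fupd; case: (x =P e) => // e0.
by rewrite -e0 hx in eE.
Qed.

Lemma hot_cons n E (s : conf n) e h t l v : e \notin E ->
  hot (e :: E) (set_edge s e h t l) v =
  hot E s v + ((h == v) && (l == (lev s v).+1)).
Proof.
move=> eE; rewrite /hot /= {1 2}/fupd eqxx addnC; congr (_ + _).
apply: eq_in_count => x hx; rewrite /fupd; case: (x =P e) => // e0.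
by rewrite -e0 hx in eE.
Qed.

Lemma indeg_rem n E (s : conf n) e v : e \in E ->
  indeg (rem e E) s v + (hd s e == v) = indeg E s v.
Proof. by move=> eE; rewrite /indeg (permP (perm_to_rem eE)) /= addnC. Qed.

Lemma hot_rem n E (s : conf n) e v : e \in E ->
  hot (rem e E) s v + ((hd s e == v) && (lab s e == (lev s v).+1)) = hot E s v.
Proof. by move=> eE; rewrite /hot (permP (perm_to_rem eE)) /= addnC. Qed.

Lemma sum_fsum_inc n D cap (i i' : 'I_n -> nat) a :
  (forall v, i' v = i v + (v == a)) ->
  \sum_v fsum D cap (i' v) = \sum_v fsum D cap (i v) + flev D cap (i a).
Proof.
move=> h; rewrite (bigD1 a) //= [in RHS](bigD1 a) //= h eqxx addn1 fsumS.
rewrite (eq_bigr (fun v => fsum D cap (i v))); first by lia.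
by move=> v /negbTE hv; rewrite h hv addn0.
Qed.

Section Global.
Variables n D cap : nat.
Hypothesis D2 : 1 < D.
Notation b := (thr D).
Notation r := (2 * D).
Notation f := (flev D cap).
Notation F := (fsum D cap).
Implicit Types (E : seq nat) (s : conf n) (v cur : 'I_n).

Definition vertex_ok E s v := vok D cap (lev s v) (indeg E s v) (hot E s v).

Definition steady E s : Prop :=
  (forall e, e \in E -> eok s e) /\ (forall v, vertex_ok E s v).

Definition inv_up E s cur : Prop :=
  [/\ forall e, e \in E -> eok s e, forall v, v != cur -> vertex_ok E s v &
      uok D cap (lev s cur) (indeg E s cur) (hot E s cur)].

Definition inv_down E s cur : Prop :=
  [/\ forall e, e \in E -> eok s e, forall v, v != cur -> vertex_ok E s v &
      dok D cap (lev s cur) (indeg E s cur) (hot E s cur)].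

(* The number of relabellings due when the in-degree next increases. *)
Definition slack (l d q : nat) : nat :=
  if b l.+1 <= cap then r * (d.+1 - b l.+1) - q else 0.

Lemma vok_slack l d q : vok D cap l d q -> slack l d q <= r.
Proof.
case=> h1 h2 h3 h4; rewrite /slack; case: ifP => // /h4 h5.
by case: (leqP (b l.+1) d) => h; [rewrite subSn // mulnS | ]; nia.
Qed.

Definition phi E s : nat := \sum_v F (indeg E s v).

Definition pot E s : nat :=
  phi E s + \sum_v slack (lev s v) (indeg E s v) (hot E s v).

(** The edge just gained by [cur] is discounted, so that the slack of [cur] is the number of
    relabellings due now. *)
Definition pot_up E s cur : nat :=
  phi E s + \sum_v slack (lev s v) (indeg E s v - (v == cur)) (hot E s v).

(** The slack of [cur] may grow while labels are moved back; it is left out and added at the end,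
    when it is at most [2 * D]. *)
Definition pot_down E s cur : nat :=
  phi E s + \sum_(v | v != cur) slack (lev s v) (indeg E s v) (hot E s v).

(** A flip lowers the level of the current vertex and may bring in [2 * D] new relabellings, which
    the charge of [(2 * D).+1] per level pays for. The same charge, on the levels remaining upwards,
    is used in [wc_down]. *)
Definition wc_up E s cur : nat :=
  lev s cur * r.+1 + slack (lev s cur) (indeg E s cur).-1 (hot E s cur).

Definition wc_down E s cur : nat :=
  (f cap - lev s cur) * r.+1 +
  (hot E s cur - r * (indeg E s cur - b (lev s cur).-1)).

Lemma eq_pot_slack E E' s s' (d d' : 'I_n -> nat) :
  (forall v, [/\ lev s' v = lev s v, d' v = d v & hot E' s' v = hot E s v]) ->
  \sum_v slack (lev s' v) (d' v) (hot E' s' v) =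
  \sum_v slack (lev s v) (d v) (hot E s v).
Proof. by move=> h; apply: eq_bigr => v _; have [-> -> ->] := h v. Qed.

Lemma phi_flip E s e t t' l : uniq E -> e \in E -> hd s e != t ->
  phi E (set_edge s e t t' l) + f (indeg E s (hd s e)).-1 =
  phi E s + f (indeg E s t).
Proof.
move=> uE eE ht; pose m v := indeg E s v - (v == hd s e).
have d0 : 0 < indeg E s (hd s e).
  by rewrite -has_count; apply/hasP; exists e.
have h1 v : indeg E s v = m v + (v == hd s e).
  by rewrite /m; case: eqP => [->|_]; lia.
have h2 v : indeg E (set_edge s e t t' l) v = m v + (v == t).
  have := indeg_set_edge n E s e t t' l v uE eE.
  by rewrite h1 (eq_sym t) (eq_sym (hd s e)); lia.
rewrite /phi (sum_fsum_inc _ _ _ _ _ _ h1) (sum_fsum_inc _ _ _ _ _ _ h2).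
by rewrite {2 4}/m eqxx eq_sym (negbTE ht) subn0 subn1; lia.
Qed.

(** * Repair steps after an insertion *)

Lemma up_relabel E s cur e : uniq E -> inv_up E s cur -> e \in E ->
  hd s e = cur -> lab s e = lev s cur ->
  due D cap (lev s cur) (indeg E s cur) (hot E s cur) ->
  lev s cur < (lev s (tl s e)).+2 ->
  let s' := set_edge s e cur (tl s e) (lev s cur).+1 in
  [/\ inv_up E s' cur, pot_up E s' cur < pot_up E s cur &
      wc_up E s' cur < wc_up E s cur].
Proof.
move=> uE [he hv hc] eE ecur elab hdue hu s'.
have d' v : indeg E s' v = indeg E s v.
  by have := indeg_set_edge n E s e cur (tl s e) (lev s cur).+1 v uE eE;
    rewrite ecur -/s'; lia.
have q' v : hot E s' v = hot E s v + (v == cur).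
  have := hot_set_edge n E s e cur (tl s e) (lev s cur).+1 v uE eE.
  rewrite -/s' ecur elab (eq_sym v); case: eqP => [<-|_] /=; last by lia.
  by rewrite eqxx; lia.
have /andP[c1 c2] := hdue.
have hs : slack (lev s cur) (indeg E s cur).-1 (hot E s cur).+1 <
    slack (lev s cur) (indeg E s cur).-1 (hot E s cur).
  rewrite /slack c1; case: hc => c3 _ _ _; rewrite prednK; last by lia.
  by lia.
split.
- split=> [x hx|v hvc|].
  + rewrite /eok /= /fupd; case: (x =P e) => [_|_]; last exact: he.
    by split=> //; lia.
  + by rewrite /vertex_ok d' q' (negbTE hvc) addn0; apply: hv.
  + by rewrite d' q' eqxx addn1; apply: uok_relabel.
- rewrite /pot_up /phi (eq_bigr (fun v => F (indeg E s v))); last first.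
    by move=> v _; rewrite d'.
  rewrite ltn_add2l (bigD1 cur) //= [X in _ < X](bigD1 cur) //= d' q' eqxx.
  rewrite addn1 subn1 (eq_bigr (fun v => slack (lev s v)
    (indeg E s v - (v == cur)) (hot E s v))); first by rewrite ltn_add2r.
  by move=> v /negbTE hvc; rewrite d' q' hvc addn0.
- by rewrite /wc_up d' q' eqxx addn1 /=; lia.
Qed.

Lemma up_flip E s cur e : uniq E -> inv_up E s cur -> e \in E ->
  hd s e = cur -> lab s e = lev s cur ->
  due D cap (lev s cur) (indeg E s cur) (hot E s cur) ->
  (lev s (tl s e)).+2 <= lev s cur ->
  let s' := set_edge s e (tl s e) cur (lev s (tl s e)) in
  [/\ inv_up E s' (tl s e), pot_up E s' (tl s e) < pot_up E s cur &
      wc_up E s' (tl s e) < wc_up E s cur].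
Proof.
move=> uE [he hv hc] eE ecur elab hdue hu s'; set u := tl s e in hu s' *.
have huc : u != cur by apply/eqP => e0; rewrite e0 in hu; lia.
have hcu : (cur == u) = false by rewrite eq_sym (negbTE huc).
have d' v : indeg E s' v + (v == cur) = indeg E s v + (v == u).
  have := indeg_set_edge n E s e u cur (lev s u) v uE eE.
  by rewrite ecur -/s' (eq_sym u) (eq_sym cur).
have q' v : hot E s' v = hot E s v.
  have := hot_set_edge n E s e u cur (lev s u) v uE eE.
  rewrite -/s' ecur elab; case: (cur =P v) => [<-|_].
    by rewrite (negbTE huc) /=; lia.
  by case: (u =P v) => [<-|_] /=; lia.
have /andP[c1 c2] := hdue.
have d0 : 0 < indeg E s cur by case: hc; lia.
have hvu := hv _ huc.
split.
- split=> [x hx|v hvu'|].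
  + rewrite /eok /= /fupd; case: (x =P e) => [_|_]; last exact: he.
    by split=> //; lia.
  + rewrite /vertex_ok q'; case: (v =P cur) => [->|/eqP hvc].
      have := d' cur; rewrite eqxx hcu => hd'.
      rewrite (_ : indeg E s' cur = (indeg E s cur).-1); last by lia.
      exact: uok_flip.
    have := d' v; rewrite (negbTE hvc) (negbTE hvu') !addn0 => ->.
    exact: hv.
  + have := d' u; rewrite eqxx (negbTE huc) addn0 addn1 q' => ->.
    exact: vok_uok.
(* No slack changes: [cur] returns to the in-degree it had without its extra edge, and the extra
   edge of the new current vertex is discounted. *)
- rewrite /pot_up (eq_pot_slack E E s s'
    (fun v => indeg E s v - (v == cur))); last first.
    move=> v; split=> //; have := d' v; case: (v =P cur) => [->|_].
      by rewrite hcu addn0 subn0 addn1 => <-; rewrite subn1.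
    by rewrite addn0 subn0 => ->; rewrite addnK.
  rewrite ltn_add2r; have := phi_flip E s e u cur (lev s u) uE eE.
  rewrite ecur -/s' eq_sym => /(_ huc).
  (* The edge adds at most [lev s u + 2 <= lev s cur] to [Phi] at [u] and gives back at least
     [lev s cur + 1] at [cur]. *)
  have [_ h1] := vok_flev D cap D2 _ _ _ hvu (hot_leq _ _ _ _).
  have h2 : (lev s cur).+1 <= f (indeg E s cur).-1.
    by apply: flev_max => //; lia.
  by lia.
- rewrite /wc_up q' /=.
  have := d' u; rewrite eqxx (negbTE huc) addn0 addn1 => ->.
  have := vok_slack _ _ _ hvu; rewrite /= => h.
  by nia.
Qed.

Lemma pot_up_done E s cur : inv_up E s cur ->
  ~~ due D cap (lev s cur) (indeg E s cur) (hot E s cur) ->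
  steady E s /\ pot E s <= pot_up E s cur + r.
Proof.
move=> [he hv hc] hd; have hI : steady E s.
  split=> // v; case: (v =P cur) => [->|/eqP /hv //].
  exact: uok_vok.
split=> //; rewrite /pot /pot_up -addnA leq_add2l (bigD1 cur) //=.
rewrite [X in _ <= X + _](bigD1 cur) //=; have := vok_slack _ _ _ (hI.2 cur).
rewrite (eq_bigr (fun v => slack (lev s v)
  (indeg E s v - (v == cur)) (hot E s v))).
  by move=> h; rewrite addnAC leq_add2r (leq_trans h) // leq_addl.
by move=> v /negbTE ->; rewrite subn0.
Qed.

Lemma up_rise E s cur : inv_up E s cur ->
  due D cap (lev s cur) (indeg E s cur) (hot E s cur) ->
  (forall e, e \in E -> hd s e = cur -> lab s e != lev s cur) ->
  let s' := set_lev s cur (lev s cur).+1 in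
  steady E s' /\ pot E s' <= pot_up E s cur + r.
Proof.
move=> [he hv hc] hdue hl s'.
have hin e : e \in E -> hd s e = cur -> lab s e = (lev s cur).+1.
  by move=> eE ec; have := hl e eE ec; have [] := he e eE; rewrite ec; lia.
have hq : hot E s cur = indeg E s cur.
  apply: eq_in_count => e eE; case: eqP => //= /hin -> //.
  by rewrite eqxx.
have q0 : hot E s' cur = 0.
  apply/eqP; rewrite -leqn0 leqNgt -has_count; apply/hasPn => e eE /=.
  case: eqP => //= /hin -> //; rewrite /fupd eqxx; lia.
have l' v : v != cur -> lev s' v = lev s v.
  by rewrite /= /fupd => /negbTE ->.
have q' v : v != cur -> hot E s' v = hot E s v.
  by move=> /l' h; rewrite /hot h.
have hI : steady E s'.
  split=> [e eE|v].
    have [h1 h2 h3] := he e eE; rewrite /eok /= /fupd; split.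
    - by case: eqP => // ec; rewrite hin.
    - by case: eqP => // ec; rewrite hin.
    - by case: eqP => // ec; rewrite -ec; lia.
  rewrite /vertex_ok; case: (v =P cur) => [->|/eqP hvc].
    rewrite q0 [lev s' cur]/= /fupd eqxx.
    by apply: uok_rise => //; rewrite hq in hc hdue.
  by rewrite l' // q' //; apply: hv.
split=> //; rewrite /pot /pot_up /phi -addnA leq_add2l (bigD1 cur) //=.
rewrite [X in _ <= X + _](bigD1 cur) //=; have := vok_slack _ _ _ (hI.2 cur).
rewrite (eq_bigr (fun v => slack (lev s v)
  (indeg E s v - (v == cur)) (hot E s v))).
  by move=> h; rewrite addnAC leq_add2r (leq_trans h) // leq_addl.
by move=> v hvc; rewrite (negbTE hvc) subn0 q' // -(l' v).
Qed.

Lemma insert_up E s e h t : e \notin E -> lev s h <= lev s t -> steady E s ->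
  let s' := set_edge s e h t (lev s h) in
  inv_up (e :: E) s' h /\ pot_up (e :: E) s' h = pot E s + f (indeg E s h).
Proof.
move=> eE hle [he hv] s'.
have d' v : indeg (e :: E) s' v = indeg E s v + (v == h).
  by rewrite /s' indeg_cons // eq_sym.
have q' v : hot (e :: E) s' v = hot E s v.
  rewrite /s' hot_cons //; case: (h =P v) => [<-|_] /=; last by lia.
  by rewrite (_ : (_ == _) = false) ?addn0 //; lia.
split.
  split=> [x|v hvh|].
  - rewrite inE /eok /= /fupd; case: eqP => [_ _|_ /=]; last exact: he.
    by split=> //; lia.
  - by rewrite /vertex_ok d' q' (negbTE hvh) addn0; apply: hv.
  - by rewrite d' q' eqxx addn1; apply/vok_uok/hv.
rewrite /pot_up (eq_pot_slack E _ s s' (indeg E s)); last first.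
  by move=> v; split=> //; rewrite d' addnK.
by rewrite /phi (sum_fsum_inc _ _ _ _ _ _ d') /pot /phi; lia.
Qed.

(** * Repair steps after a deletion *)

Lemma delete_down E s e : e \in E -> steady E s ->
  inv_down (rem e E) s (hd s e) /\
  pot_down (rem e E) s (hd s e) + f (indeg E s (hd s e)).-1 <= pot E s.
Proof.
move=> eE [he hv]; have d' v := indeg_rem n E s e v eE.
have q' v := hot_rem n E s e v eE.
have hd' := d' (hd s e); rewrite eqxx addn1 in hd'.
split.
  split=> [x /mem_rem /he //|v|].
    rewrite eq_sym /vertex_ok => /negbTE h; have := d' v; have := q' v.
    by rewrite h !addn0 => -> ->; apply: hv.
  apply: (@vok_dok D cap D2 _ _ (hot E s (hd s e))); first by rewrite hd'; apply: hv.
  by rewrite -(q' (hd s e)) eqxx /=; lia.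
rewrite /pot_down /pot -hd' /= addnAC leq_add //.
  rewrite /phi (@sum_fsum_inc n D cap (indeg (rem e E) s) (indeg E s) (hd s e)) //.
  by move=> v; rewrite -(d' v) eq_sym.
rewrite [X in _ <= X](bigD1 (hd s e)) //= (eq_bigr (fun v =>
  slack (lev s v) (indeg E s v) (hot E s v))); first by rewrite leq_addl.
move=> v; rewrite eq_sym => /negbTE h; have := d' v; have := q' v.
by rewrite h !addn0 => -> ->.
Qed.

Lemma down_done E s cur : inv_down E s cur ->
  hot E s cur <= r * (indeg E s cur - b (lev s cur).-1) ->
  b (lev s cur).-1 <= indeg E s cur ->
  steady E s /\ pot E s <= pot_down E s cur + r.
Proof.
move=> [he hv hc] h1 h2; have hI : steady E s.
  split=> // v; case: (v =P cur) => [->|/eqP /hv //].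
  exact: dok_vok.
split=> //; rewrite /pot /pot_down -addnA leq_add2l (bigD1 cur) //=.
by rewrite addnC leq_add2l; apply/vok_slack/hI.2.
Qed.

Lemma down_relabel E s cur e : uniq E -> inv_down E s cur -> e \in E ->
  hd s e = cur -> lab s e = (lev s cur).+1 ->
  r * (indeg E s cur - b (lev s cur).-1) < hot E s cur ->
  let s' := set_edge s e cur (tl s e) (lev s cur) in
  [/\ inv_down E s' cur, pot_down E s' cur = pot_down E s cur,
      indeg E s' cur = indeg E s cur, (hot E s' cur).+1 = hot E s cur &
      wc_down E s' cur < wc_down E s cur].
Proof.
move=> uE [he hv hc] eE ecur elab hdue s'.
have d' v : indeg E s' v = indeg E s v.
  by have := indeg_set_edge n E s e cur (tl s e) (lev s cur) v uE eE;
    rewrite ecur -/s'; lia.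
have q' v : hot E s' v + (v == cur) = hot E s v.
  have := hot_set_edge n E s e cur (tl s e) (lev s cur) v uE eE.
  rewrite -/s' ecur elab (eq_sym v); case: eqP => [<-|_] /=; last by lia.
  by rewrite eqxx; lia.
have qc := q' cur; rewrite eqxx addn1 in qc.
have qv v : v != cur -> hot E s' v = hot E s v.
  by move=> /negbTE h; have := q' v; rewrite h addn0.
have [_ _ h3] := he e eE.
split=> //.
- split=> [x hx|v hvc|].
  + rewrite /eok /= /fupd; case: (x =P e) => [_|_]; last exact: he.
    by split=> //; lia.
  + by rewrite /vertex_ok d' qv //; apply: hv.
  + by rewrite d'; apply: dok_relabel; rewrite // qc.
- rewrite /pot_down /phi; congr (_ + _).
    by apply: eq_bigr => v _; rewrite d'.
  by apply: eq_bigr => v /qv ->; rewrite d'.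
- by rewrite /wc_down d' /=; lia.
Qed.

Lemma down_flip E s cur e : uniq E -> inv_down E s cur -> e \in E ->
  tl s e = cur -> lab s e = (lev s cur).+2 ->
  indeg E s cur < b (lev s cur).-1 ->
  let s' := set_edge s e cur (hd s e) (lev s cur) in
  [/\ inv_down E s' (hd s e), pot_down E s' (hd s e) < pot_down E s cur,
      hot E s' (hd s e) <= r + r * (indeg E s' (hd s e) - b (lev s (hd s e)).-1)
      & wc_down E s' (hd s e) < wc_down E s cur].
Proof.
move=> uE [he hv hc] eE ecur elab hdue s'; set x := hd s e in s' *.
have [h1 h2 h3] := he e eE; rewrite -/x elab in h1 h2.
have hxc : x != cur by apply/eqP => e0; rewrite e0 in h2; lia.
have hcx : (cur == x) = false by rewrite eq_sym (negbTE hxc).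
have d' v : indeg E s' v + (v == x) = indeg E s v + (v == cur).
  have := indeg_set_edge n E s e cur x (lev s cur) v uE eE.
  by rewrite -/x -/s' (eq_sym x) (eq_sym cur).
have q' v : v != x -> hot E s' v = hot E s v.
  have := hot_set_edge n E s e cur x (lev s cur) v uE eE.
  rewrite -/s' -/x elab (eq_sym v) => + /negbTE hvx; rewrite hvx /=.
  by case: (cur =P v) => [<-|_] /=; lia.
have qx : hot E s x = hot E s' x + ((lev s cur).+2 == (lev s x).+1).
  have := hot_set_edge n E s e cur x (lev s cur) x uE eE.
  by rewrite -/s' -/x elab eqxx hcx /=; lia.
have [qc dc] := dok_low D cap D2 _ _ _ hc hdue.
have hvx := hv _ hxc.
have dx := d' x; rewrite eqxx (negbTE hxc) addn1 addn0 in dx.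
have dcu := d' cur; rewrite eqxx hcx addn1 addn0 in dcu.
have hdx : dok D cap (lev s x) (indeg E s' x) (hot E s' x).
  apply: (@vok_dok D cap D2 _ _ (hot E s x)); first by rewrite dx.
  by rewrite qx; lia.
have hcur : vok D cap (lev s cur) (indeg E s' cur) (hot E s' cur).
  rewrite dcu q' ?hcx // qc; exact: dok_flip hc hdue.
have hI : inv_down E s' x.
  split=> [y hy|v hvx'|]; last by [].
    rewrite /eok /= /fupd; case: (y =P e) => [_|_]; last exact: he.
    by split=> //; lia.
  rewrite /vertex_ok; case: (v =P cur) => [->//|/eqP hvc].
  have := d' v; rewrite (negbTE hvc) (negbTE hvx') !addn0 => ->.
  by rewrite q' //; apply: hv.
(* The in-degree of [cur] is back at [b (lev s cur).-1], so [cur] reenters the sum of the slacks at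
   no cost. *)
have sc : slack (lev s cur) (indeg E s' cur) (hot E s' cur) = 0.
  rewrite /slack dcu; case: ifP => // _.
  have := thr_le D _ _ (leqnSn (lev s cur)); have := thr_pred D (lev s cur).
  by move: (hot _ _ _) => z; nia.
split=> //.
(* The old head has level at least [(lev s cur).+1], hence in-degree at least [b (lev s cur)], while
   [cur] is below [b (lev s cur).-1]: the edge moves to a smaller increment. *)
- have hphi : phi E s' < phi E s.
    have := phi_flip E s e cur x (lev s cur) uE eE hxc; rewrite -/s' -/x.
    have [_ _ k3 _] := hc.
    have := flev_leq D cap (indeg E s cur) _ (leq_trans (thr_pred _ _) k3).
    rewrite [RHS]leqNgt hdue /= => k4.
    have k5 : (lev s cur).-1 <= f (indeg E s x).-1.
      apply: flev_max; last exact: leq_trans (thr_pred _ _) k3.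
      have l0 : 0 < lev s cur by case: (lev s cur) hdue.
      have := thr_le D (lev s cur).-1 (lev s x).-1.
      by case: hvx => k6 _ _ _ => /(_ ltac:(lia)); lia.
    by lia.
  rewrite /pot_down -addSn leq_add //.
  rewrite big_mkcond [X in _ <= X]big_mkcond /=; apply: leq_sum => v _.
  case: (v =P cur) => [->|/eqP hvc]; first by rewrite hcx /= sc.
  case: (v =P x) => //= /eqP hvx'.
  have := d' v; rewrite (negbTE hvc) (negbTE hvx') !addn0 => ->.
  by rewrite q'.
- by case: hdx => _ k2 _ _; nia.
- rewrite /wc_down /=.
  have k3 := vok_lev D cap _ _ _ hvx; have : hot E s' x <= r + r *
     (indeg E s' x - b (lev s x).-1) by case: hdx => _ k2 _ _; nia.
  have : f cap - lev s cur = (f cap - (lev s cur).+1).+1 by lia.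
  have : f cap - lev s x <= f cap - (lev s cur).+1 by lia.
  by move: (f cap - _) (f cap - _) => y z; nia.
Qed.

(** The outgoing edges with label [(lev s cur).+2] are the only ones whose label would be too large
    for the lower level of the tail. *)
Lemma down_fall E s cur : inv_down E s cur ->
  indeg E s cur < b (lev s cur).-1 ->
  (forall e, e \in E -> tl s e = cur -> lab s e != (lev s cur).+2) ->
  let s' := set_lev s cur (lev s cur).-1 in
  steady E s' /\ pot E s' <= pot_down E s cur + r.
Proof.
move=> [he hv hc] hdue hl s'; have [q0 _] := dok_low D cap D2 _ _ _ hc hdue.
have l0 : 0 < lev s cur by case: (lev s cur) hdue.
have hin e : e \in E -> hd s e = cur -> lab s e = lev s cur.
  move=> eE ec; have [h1 h2 _] := he e eE; rewrite ec in h1 h2.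
  apply/eqP; rewrite eqn_leq h1 andbT leqNgt; apply/negP => h3.
  have : 0 < hot E s cur; last by rewrite q0.
  by rewrite -has_count; apply/hasP; exists e => //; rewrite ec eqxx /=; lia.
have q' : hot E s' cur = indeg E s cur.
  apply: eq_in_count => e eE /=; case: eqP => //= /hin -> //.
  by rewrite /fupd eqxx prednK // eqxx.
have l' v : v != cur -> lev s' v = lev s v.
  by rewrite /= /fupd => /negbTE ->.
have qv v : v != cur -> hot E s' v = hot E s v.
  by move=> /l' h; rewrite /hot h.
have hI : steady E s'.
  split=> [e eE|v].
    have [h1 h2 h3] := he e eE; rewrite /eok /= /fupd; split.
    - by case: eqP => // ec; rewrite hin //; lia.
    - by case: eqP => // ec; rewrite hin //; lia.
    - by case: eqP => // ec; have := hl e eE ec; rewrite ec in h3; lia.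
  rewrite /vertex_ok; case: (v =P cur) => [->|/eqP hvc].
    rewrite q' [lev s' cur]/= /fupd eqxx.
    exact: dok_fall hc hdue.
  by rewrite l' // qv //; apply: hv.
split=> //; rewrite /pot /pot_down /phi -addnA leq_add2l (bigD1 cur) //=.
have := vok_slack _ _ _ (hI.2 cur).
rewrite (eq_bigr (fun v => slack (lev s v) (indeg E s v) (hot E s v))).
  by move=> h; rewrite addnC leq_add2l.
by move=> v hvc; rewrite qv // -(l' v).
Qed.

End Global.

(** * Comparison with an optimal orientation *)

Lemma sum_count_head n (E : seq nat) (h : nat -> 'I_n) (A : {set 'I_n}) :
  \sum_(v in A) count (fun e => h e == v) E = count (fun e => h e \in A) E.
Proof.
elim: E => [|e E IH] /=; first by rewrite big1.
rewrite big_split /= IH; congr (_ + _).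
case: (boolP (h e \in A)) => hA.
  rewrite (bigD1 (h e)) //= eqxx big1 // => v /andP[_ /negbTE].
  by rewrite eq_sym => ->.
by rewrite big1 // => v vA; case: eqP => // e0; rewrite e0 vA in hA.
Qed.

Lemma count_sub_uniq (T : eqType) (E1 E2 : seq T) (P Q : pred T) :
  uniq E1 -> {subset E1 <= E2} -> (forall e, e \in E1 -> P e -> Q e) ->
  count P E1 <= count Q E2.
Proof.
move=> u1 s12 h; rewrite -!size_filter; apply: uniq_leq_size.
  by rewrite filter_uniq.
by move=> e; rewrite !mem_filter => /andP[hP he]; rewrite h //= s12.
Qed.

(* Two orientations in which levels control the in-degrees and rise by at most
   2 along an edge agree on the level of a vertex up to an additive error:
   otherwise, starting from a vertex that is high in the first and low in the
   second, the sets of vertices high in the first and low in the second double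
   in size with each relaxation of the two bounds. *)
Lemma compare_levels (n D cap J : nat) (E1 E2 : seq nat)
    (h1 t1 h2 : nat -> 'I_n) (l1 l2 : 'I_n -> nat) :
  0 < D -> n < 2 ^ J -> uniq E1 -> {subset E1 <= E2} ->
  (forall e, e \in E1 -> l1 (h1 e) <= (l1 (t1 e)).+2) ->
  (forall e, e \in E1 -> h2 e = h1 e \/
     h2 e = t1 e /\ l2 (t1 e) <= (l2 (h1 e)).+2) ->
  (forall v, thr D (l1 v).-1 <= count (fun e => h1 e == v) E1 /\
     thr D (l1 v) <= cap) ->
  (forall v, thr D (l2 v).+1 <= cap ->
     count (fun e => h2 e == v) E2 <= thr D (l2 v).+2) ->
  forall v, l1 v < l2 v + (4 * J + D + 6).
Proof.
move=> D0 hJ u1 s12 hl1 hh lo up v; rewrite ltnNge; apply/negP => hv.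
pose Y j := [set x | (l1 v - 2 * j <= l1 x) && (l2 x <= l2 v + 2 * j)].
suff H j : j <= J -> 2 ^ j <= #|Y j|.
  by have := leq_trans (H J (leqnn _)) (max_card _); rewrite card_ord leqNgt hJ.
elim: j => [_|j IH hj].
  rewrite expn0 card_gt0; apply/set0Pn; exists v; rewrite inE; lia.
have {}IH := IH (ltnW hj).
set p := thr D (l1 v - 2 * j).-1; set q := thr D (l2 v + 2 * j + 4).
have q0 : 0 < q by have := thr_ge D (l2 v + 2 * j + 4); rewrite -/q; lia.
(* The two bounds move together by 4 in each of the [J] rounds; the remaining [D] levels between
   them are worth a factor 2. This gives the form [4 * J + D + 6]. *)
have pq : 2 * q <= p.
  apply: leq_trans (thr_double D _ D0) _.
  by rewrite /p thr_mono; lia.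
have hp : #|Y j| * p <= count (fun e => h1 e \in Y j) E1.
  rewrite -sum_count_head -sum_nat_const; apply: leq_sum => x.
  rewrite inE => /andP[hx _]; apply: leq_trans (lo x).1.
  by rewrite thr_mono; lia.
have hq : count (fun e => h2 e \in Y j.+1) E2 <= #|Y j.+1| * q.
  rewrite -sum_count_head -sum_nat_const; apply: leq_sum => x.
  rewrite inE => /andP[_ hx].
  (* The cap does not interfere, since [l2 x] is below [l1 v], whose threshold is at most [cap]. *)
  have hc : thr D (l2 x).+1 <= cap.
    by apply: leq_trans (lo v).2; rewrite thr_mono; lia.
  by apply: leq_trans (up x hc) _; rewrite thr_mono; lia.
have hpq : count (fun e => h1 e \in Y j) E1 <= count (fun e => h2 e \in Y j.+1) E2.
  apply: count_sub_uniq => // e he; rewrite !inE => /andP[k1 k2].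
  by have := hl1 e he; case: (hh e he) => [->|[-> k3]]; lia.
by rewrite expnS; nia.
Qed.

(** * Orientations of minimum cost *)

Section Optimum.
Variables n D cap : nat.
Notation f := (flev D cap).
Implicit Types (G : multigraph n) (h : nat -> 'I_n).

Definition names G : seq nat := [seq x.1 | x <- G].

Definition cost G h : nat := \sum_v fsum D cap (indegree G h v).

Definition optimal G h : Prop :=
  is_orientation G h /\ forall h', is_orientation G h' -> cost G h <= cost G h'.

Definition simple_names G : Prop :=
  uniq (names G) /\ (forall x, x \in G -> x.2.1 != x.2.2).

Lemma indegree_names G h v :
  indegree G h v = count (fun e => h e == v) (names G).
Proof. by rewrite /names count_map. Qed.

(** Descent on the cost, because orientations are functions on all of [nat] and do not form a finite
    type. *)
Lemma optimal_exists G h : is_orientation G h -> exists h', optimal G h'.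
Proof.
have [k] := ubnP (cost G h); elim: k h => // k IH h hk ho.
have [[h' [ho' hlt]]|hn] :=
    EM (exists h', is_orientation G h' /\ cost G h' < cost G h).
  by apply: (IH h') => //; lia.
exists h; split=> // h' ho'; rewrite leqNgt; apply/negP => hlt.
by apply: hn; exists h'.
Qed.

Lemma name_inj G x y : simple_names G -> x \in G -> y \in G -> x.1 = y.1 ->
  x = y.
Proof.
case; elim: G => //= z G IH /andP[hz uG] hs.
have {}IH : x \in G -> y \in G -> x.1 = y.1 -> x = y.
  by apply: IH => // w hw; apply: hs; rewrite inE hw orbT.
rewrite !inE => /predU1P[->|xG] /predU1P[->|yG] e //; last exact: IH.
  by rewrite e map_f in hz.
by rewrite -e map_f in hz.
Qed.

Lemma indegree_cons G h x v : indegree (x :: G) h v = (h x.1 == v) + indegree G h v.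
Proof. by []. Qed.

Lemma cost_cons G h x : cost (x :: G) h = cost G h + f (indegree G h (h x.1)).
Proof.
apply: sum_fsum_inc => v; rewrite indegree_cons addnC.
by rewrite eq_sym.
Qed.

Lemma eq_cost G h h' : {in names G, h =1 h'} -> cost G h = cost G h'.
Proof.
move=> hh; apply: eq_bigr => v _; congr fsum; rewrite !indegree_names.
by apply: eq_in_count => e /hh ->.
Qed.

Lemma cost_perm G G' h : perm_eq G G' -> cost G h = cost G' h.
Proof.
by move=> hp; apply: eq_bigr => v _; congr fsum; apply/permP.
Qed.

(** Redirecting [x] to [v] cannot pay off, so the increment given back at the head is at most the
    one added at [v]. The successor comes from [flevS], as the increment given back is that of the
    in-degree without [x]. *)
Lemma optimal_local G h x v : simple_names G -> optimal G h -> x \in G ->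
  x.2.1 = v \/ x.2.2 = v ->
  f (indegree G h (h x.1)) <= (f (indegree G h v)).+1.
Proof.
move=> sG [ho hopt] xG hv; case: (h x.1 =P v) => [->|hne]; first by lia.
have hp := perm_to_rem xG; set G1 := rem x G in hp.
have xG1 : x.1 \notin names G1.
  have [uG _] := sG; rewrite /names in uG.
  by rewrite (perm_uniq (perm_map _ hp)) /= in uG; case/andP: uG.
pose h' := fupd h x.1 v.
have ho' : is_orientation G h'.
  move=> y yG; rewrite /h' /fupd; case: eqP => [e|_]; last exact: ho.
  by rewrite (name_inj _ _ _ sG yG xG e); case: hv => ->; [left | right].
have e1 : {in names G1, h' =1 h}.
  by move=> e he; rewrite /h' /fupd; case: eqP => // e0; rewrite -e0 he in xG1.
have := hopt _ ho'; rewrite !(cost_perm _ _ _ hp) !cost_cons (eq_cost _ _ _ e1).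
rewrite leq_add2l [h' x.1]/h' /fupd eqxx.
have d1 w : indegree G h w = (h x.1 == w) + indegree G1 h w.
  by rewrite -indegree_cons; apply/permP.
rewrite (_ : indegree G1 h' v = indegree G h v); last first.
  rewrite d1 (_ : (_ == _) = false) ?add0n; last by apply/eqP.
  by rewrite !indegree_names; apply: eq_in_count => e /e1 ->.
rewrite (d1 (h x.1)) eqxx; move=> h1; apply: leq_trans (flevS _ _ _) _.
by rewrite ltnS.
Qed.

Lemma optimal_insert G x h0 h1 : optimal G h0 -> optimal (x :: G) h1 ->
  cost G h0 + f (indegree (x :: G) h1 (h1 x.1)).-1 <= cost (x :: G) h1.
Proof.
move=> [ho hopt] [ho1 _]; rewrite cost_cons indegree_cons eqxx leq_add2r.
by apply: hopt => y yG; apply: ho1; rewrite inE yG orbT.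
Qed.

Lemma optimal_delete G x h0 h1 v : simple_names G -> x \in G ->
  optimal G h0 -> optimal (rem x G) h1 -> x.2.1 = v \/ x.2.2 = v ->
  cost G h0 <= cost (rem x G) h1 + f (indegree (rem x G) h1 v).
Proof.
move=> sG xG [ho hopt] [ho1 _] hv; have hp := perm_to_rem xG.
set G1 := rem x G in hp ho1 *.
have xG1 : x.1 \notin names G1.
  have [uG _] := sG; rewrite /names in uG.
  by rewrite (perm_uniq (perm_map _ hp)) /= in uG; case/andP: uG.
pose h' := fupd h1 x.1 v.
have e1 : {in names G1, h' =1 h1}.
  by move=> e he; rewrite /h' /fupd; case: eqP => // e0; rewrite -e0 he in xG1.
have ho' : is_orientation G h'.
  move=> y yG; rewrite /h' /fupd; case: eqP => [e|hne].
    by rewrite (name_inj _ _ _ sG yG xG e); case: hv => ->; [left | right].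
  apply: ho1; move: yG; rewrite (perm_mem hp) inE; case: eqP => [e|] //=.
  by rewrite e in hne.
apply: leq_trans (hopt _ ho') _.
rewrite (cost_perm _ _ _ hp) cost_cons (eq_cost _ _ _ e1) leq_add2l.
rewrite [h' x.1]/h' /fupd eqxx !indegree_names.
by rewrite (@eq_in_count _ _ (fun e => h1 e == v)) // => e /e1 <-.
Qed.

Definition oriented G (s : conf n) : Prop :=
  forall x, x \in G -> (hd s x.1 = x.2.1 /\ tl s x.1 = x.2.2) \/
                       (hd s x.1 = x.2.2 /\ tl s x.1 = x.2.1).

Lemma oriented_orientation G s : oriented G s -> is_orientation G (hd s).
Proof. by move=> h x /h[[-> _]|[-> _]]; [left | right]. Qed.

Hypothesis D2 : 1 < D.
Variable J : nat.
Hypothesis hJ : n < 2 ^ J.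

Lemma optimal_bounds G h v :
  thr D (f (indegree G h v)).-1 <= indegree G h v /\
  thr D (f (indegree G h v)) <= cap.
Proof.
have := thr_flev D cap (indegree G h v).
by have := thr_pred D (f (indegree G h v)); lia.
Qed.

(** The optimum may direct the new edge to either endpoint; as the algorithm takes the endpoint of
    lower level, the last hypothesis holds in both cases. The 9 is 6 from [compare_levels], 2 from
    [vok_flev] and 1 from [flevS]. *)
Lemma insert_price G s x h1 (u : 'I_n) : simple_names (x :: G) -> oriented G s ->
  steady n D cap (names G) s -> optimal (x :: G) h1 -> lev s u <= lev s (h1 x.1) ->
  f (indeg (names G) s u) <=
  f (indegree (x :: G) h1 (h1 x.1)).-1 + (4 * J + D + 9).
Proof.
move=> sG os [he hv] hopt hle; set a := h1 x.1 in hle *.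
have sub : {subset G <= x :: G} by move=> y yG; rewrite inE yG orbT.
have H := @compare_levels n D cap J (names G) (names (x :: G)) (hd s) (tl s) h1
  (lev s) (fun v => f (indegree (x :: G) h1 v)) (ltnW D2) hJ.
have := H _ _ _ _ _ _ a; rewrite {H} => H.
have [_ k1] := vok_flev D cap D2 _ _ _ (hv u) (hot_leq _ _ _ _).
have k2 := flevS D cap (indegree (x :: G) h1 a).-1.
have k3 : 0 < indegree (x :: G) h1 a by rewrite indegree_cons eqxx.
rewrite prednK // in k2.
suff : lev s a < f (indegree (x :: G) h1 a) + (4 * J + D + 6) by lia.
apply: H.
- by case: sG => /andP[].
- by move=> e; rewrite inE => ->; rewrite orbT.
- by move=> e eG; have [q1 q2 q3] := he e eG; lia.
- move=> e /mapP[y yG ->]; have [ho _] := hopt.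
  have loc w : y.2.1 = w \/ y.2.2 = w ->
      f (indegree (x :: G) h1 (h1 y.1)) <= (f (indegree (x :: G) h1 w)).+1.
    by apply: optimal_local => //; apply: sub.
  by case: (os y yG) => -[-> ->]; case: (ho y (sub y yG)) => e1;
    rewrite -e1; auto; right; split=> //; apply: leqW; apply: loc; auto.
- move=> v; have [q1 q2 q3 q4] := hv v; split=> //.
- move=> v hc; rewrite -indegree_names; have := flev_lt _ _ _ hc.
  by have := thr_le D _ _ (leqnSn (f (indegree (x :: G) h1 v)).+1); lia.
Qed.

(** The roles in [compare_levels] are exchanged: the optimum is the first orientation, which
    therefore needs tails of its own. *)
Lemma delete_price G s x h1 : simple_names G -> oriented G s ->
  steady n D cap (names G) s -> x \in G -> optimal (rem x G) h1 ->
  f (indegree (rem x G) h1 (hd s x.1)) <=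
  f (indeg (names G) s (hd s x.1)).-1 + (4 * J + D + 9).
Proof.
move=> sG os [he hv] xG hopt; set a := hd s x.1.
have sub : {subset rem x G <= G} by move=> y /mem_rem.
have sG1 : simple_names (rem x G).
  case: sG => uG hn; split=> [|y /sub]; last exact: hn.
  by apply: subseq_uniq uG; apply/map_subseq/rem_subseq.
have H := @compare_levels n D cap J (names (rem x G)) (names G) h1
  (fun e => if h1 e == hd s e then tl s e else hd s e) (hd s)
  (fun v => f (indegree (rem x G) h1 v)) (lev s) (ltnW D2) hJ.
have := H _ _ _ _ _ _ a; rewrite {H} => H.
have [k1 _] := vok_flev D cap D2 _ _ _ (hv a) (hot_leq _ _ _ _).
have k2 := flevS D cap (indeg (names G) s a).-1.
have k3 : 0 < indeg (names G) s a.
  by rewrite -has_count; apply/hasP; exists x.1; rewrite ?map_f.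
rewrite prednK // in k2.
suff : f (indegree (rem x G) h1 a) < lev s a + (4 * J + D + 6) by lia.
apply: H.
- by case: sG1.
- by move=> e /mapP[y /sub yG ->]; apply: map_f.
- move=> e /mapP[y yG ->]; have [ho _] := hopt.
  have loc w : y.2.1 = w \/ y.2.2 = w ->
      f (indegree (rem x G) h1 (h1 y.1)) <= (f (indegree (rem x G) h1 w)).+1.
    exact: optimal_local.
  apply: leqW; apply: loc.
  by case: (os y (sub y yG)) => -[-> ->]; case: ifP; auto.
- move=> e /mapP[y yG ->]; have [ho _] := hopt.
  have [q1 q2 q3] := he y.1 (map_f _ (sub _ yG)).
  case: (h1 y.1 =P hd s y.1) => [->|hne]; first by left.
  have e1 : h1 y.1 = tl s y.1.
    by move: hne; case: (os y (sub y yG)) => -[-> ->]; case: (ho y yG) => ->.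
  right; split=> //=; rewrite e1; exact: leq_trans q1 q3.
- by move=> v; rewrite -indegree_names; apply: optimal_bounds.
- move=> v hc; exact: vok_ub (hv v) (hot_leq _ _ _ _) hc.
Qed.

End Optimum.

(** * The data structure in memory *)

Definition low (X : nat) (M : memory) : Prop := forall a, M a <= X.

Lemma low_aget X M i x : low X M -> aget M i x <= X.
Proof. by move=> h; apply: h. Qed.

Lemma low_aset X M i x v : low X M -> v <= X -> low X (aset M i x v).
Proof. by move=> h hv a; rewrite /aset /upd; case: eqP. Qed.

Lemma low_add X f NB M b x : f.+2 < 16 -> low X M -> x <= X ->
  aget M f b < X -> low X (bag_add f NB M b x).
Proof.
move=> hf hM hx hb; rewrite /bag_add.
have h1 : low X (aset M f.+1 (aget M f b * NB + b) x) by apply: low_aset.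
apply: low_aset; first by apply: low_aset => //; apply: low_aget.
rewrite !aget_aset; do ?[lia]; do 2 (rewrite ifN; last by lia).
by rewrite addn1.
Qed.

Lemma low_del X f NB M b x : low X M -> low X (bag_del f NB M b x).
Proof.
move=> hM; rewrite /bag_del.
have h1 y z : low X (aset M f.+2 y (aget M f.+2 z)).
  by apply: low_aset => //; apply: low_aget.
have h2 y z y' z' : low X (aset (aset M f.+2 y (aget M f.+2 z)) f.+1 y'
    (aget (aset M f.+2 y (aget M f.+2 z)) f.+1 z')).
  by apply: low_aset => //; apply: low_aget.
apply: low_aset => //; apply: leq_trans (leq_subr _ _) _.
exact: low_aget.
Qed.

Lemma bag_size f NB M B b (s : seq nat) : bags f NB M B -> b < NB -> uniq s ->
  (forall x, B x = Some b -> x \in s) -> aget M f b <= size s.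
Proof.
by move=> hB hb us hs; rewrite (bag_card _ _ _ _ _ _ hB hb us hs) count_size.
Qed.

(* Arrays 0 to 2 hold the bags of the edges with a given head and label, arrays
   3 to 5 those of the edges with a given tail and label, and arrays 6 to 8
   those of the vertices of a given positive level.  Arrays 9 to 12 hold the
   heads, tails, labels and levels, array 13 the thresholds of the levels up to
   the largest one in use, and array 14 this largest level. *)
Section Representation.
Variables n D Ls : nat.
Notation NB := (n * Ls).
Implicit Types (M : memory) (E : seq nat) (s : conf n) (v h t : 'I_n).

Definition in_bag E s (e : nat) : option nat :=
  if e \in E then Some (hd s e * Ls + lab s e) else None.

Definition out_bag E s (e : nat) : option nat :=
  if e \in E then Some (tl s e * Ls + lab s e) else None.

(** Level 0 has no bag, since there is no time to enter all the vertices into one at the start. *)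
Definition level_bag s (x : nat) : option nat :=
  if insub x is Some v then if lev s v != 0 then Some (lev s v) else None
  else None.

Definition edges_at M E s : Prop :=
  [/\ bags 0 NB M (in_bag E s), bags 3 NB M (out_bag E s) &
      forall e, e \in E -> [/\ aget M 9 e = hd s e, aget M 10 e = tl s e &
        aget M 11 e = lab s e]].

Definition levels_at M s : Prop :=
  bags 6 NB M (level_bag s) /\ (forall v, aget M 12 v = lev s v).

(** Thresholds beyond the largest level are not kept; [rise_cmd] stores the one of the level
    reached. The entry of level 0 is right in zeroed memory, as [thr D 0 = 0]. *)
Definition top_at M s : Prop :=
  [/\ forall i, i <= aget M 14 0 -> aget M 13 i = thr D i,
      forall v, lev s v <= aget M 14 0 &
      aget M 14 0 = 0 \/ exists v, lev s v = aget M 14 0].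

Definition rep M E s : Prop :=
  [/\ edges_at M E s, levels_at M s & top_at M s].

Definition detach M (e : nat) : memory :=
  let M1 := bag_del 0 NB M (aget M 9 e * Ls + aget M 11 e) e in
  bag_del 3 NB M1 (aget M1 10 e * Ls + aget M1 11 e) e.

Definition attach M (e h t l : nat) : memory :=
  let M1 := aset (aset (aset M 9 e h) 10 e t) 11 e l in
  let M2 := bag_add 0 NB M1 (h * Ls + l) e in
  bag_add 3 NB M2 (t * Ls + l) e.

Definition move_level M (v l : nat) : memory :=
  let M1 := if aget M 12 v != 0 then bag_del 6 NB M (aget M 12 v) v else M in
  let M2 := aset M1 12 v l in
  if l != 0 then bag_add 6 NB M2 l v else M2.

Lemma bag_lt (v l : nat) : v < n -> l < Ls -> v * Ls + l < NB.
Proof.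
move=> hv hl; apply: (@leq_trans (v.+1 * Ls)); first lia.
by rewrite leq_mul2r hv orbT.
Qed.

Lemma rep_eq M E E' s : E =i E' -> rep M E s -> rep M E' s.
Proof.
move=> hE [[h1 h2 h3] h4 h5]; split=> //; split.
- by apply: bags_ext h1 => // e; rewrite /in_bag hE.
- by apply: bags_ext h2 => // e; rewrite /out_bag hE.
- by move=> e; rewrite -hE; apply: h3.
Qed.

Lemma levels_top_ext M M' s : (forall j x, 6 <= j < 15 -> j != 9 -> j != 10 ->
    j != 11 -> aget M' j x = aget M j x) ->
  levels_at M s -> top_at M s -> levels_at M' s /\ top_at M' s.
Proof.
move=> h [h1 h2] [h3 h4 h5]; split.
  split; last by move=> v; rewrite h.
  by apply: bags_ext h1 => // j x hj; rewrite h //; lia.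
by split; rewrite ?(h 14) // => i hi; rewrite h //; apply: h3.
Qed.

Lemma rep_detach M E s e : uniq E -> e \in E -> rep M E s ->
  rep (detach M e) (rem e E) s.
Proof.
move=> uE eE [[h1 h2 h3] h4 h5].
have [e1 e2 e3] := h3 e eE.
set M1 := bag_del 0 NB M (aget M 9 e * Ls + aget M 11 e) e.
have k j x : 3 <= j < 16 -> aget M1 j x = aget M j x.
  by move=> hj; rewrite bag_del_aget //; lia.
have k' j x : 6 <= j < 16 -> aget (detach M e) j x = aget M j x.
  by move=> hj; rewrite bag_del_aget ?k //; lia.
have B1 : bags 0 NB M1 (in_bag (rem e E) s).
  have := bags_del 0 NB M _ (aget M 9 e * Ls + aget M 11 e) e isT h1.
  rewrite /in_bag eE e1 e3 => /(_ erefl); apply: bags_ext => //.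
    by move=> x; rewrite mem_rem_uniq // !inE; case: eqP.
  by move=> j x _; rewrite /M1 e1 e3.
have B2 : bags 3 NB M1 (out_bag E s).
  by apply: bags_ext h2 => // j x hj; rewrite k //; lia.
have [] := levels_top_ext M (detach M e) s _ h4 h5.
  by move=> j x hj _ _ _; rewrite k' //; lia.
move=> L1 L2; split=> //; split.
- by apply: bags_ext B1 => // j x hj; apply/esym/bag_del_aget; lia.
- have := bags_del 3 NB M1 _ (aget M1 10 e * Ls + aget M1 11 e) e isT B2.
  rewrite /out_bag eE !k // e2 e3 => /(_ erefl); apply: bags_ext => //.
    by move=> x; rewrite mem_rem_uniq // !inE; case: eqP.
  by move=> j x _; rewrite /detach -/M1 !k // e2 e3.
- by move=> x /mem_rem /h3; rewrite !k'.
Qed.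

Lemma rep_attach M E s e h t l : e \notin E -> l < Ls -> rep M E s ->
  rep (attach M e h t l) (e :: E) (set_edge s e h t l).
Proof.
move=> eE hl [[h1 h2 h3] h4 h5].
set M1 := aset (aset (aset M 9 e h) 10 e t) 11 e l.
set M2 := bag_add 0 NB M1 (h * Ls + l) e.
have hne x : x \in E -> (x == e) = false.
  by move=> hx; apply/eqP => e0; rewrite -e0 hx in eE.
have k j x : j < 16 -> aget M1 j x =
    if (j == 11) && (x == e) then l else if (j == 10) && (x == e) then t : nat
    else if (j == 9) && (x == e) then h : nat else aget M j x.
  by move=> hj; rewrite /M1 !aget_aset.
have k2 j x : 3 <= j < 16 -> aget M2 j x = aget M1 j x.
  by move=> hj; rewrite bag_add_aget //; lia.
have k3 j x : 6 <= j < 16 -> aget (attach M e h t l) j x = aget M1 j x.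
  by move=> hj; rewrite bag_add_aget ?k2 //; lia.
have [] := levels_top_ext M (attach M e h t l) s _ h4 h5.
  move=> j x hj j1 j2 j3; rewrite k3 ?k; try lia.
  by rewrite (negbTE j1) (negbTE j2) (negbTE j3).
move=> [L1 L2] [L3 L4 L5].
have in0 (g : nat -> 'I_n) : (if e \in E then Some (g e * Ls + lab s e) else None) = None.
  by rewrite (negbTE eE).
split=> //; split.
- have B : bags 0 NB M1 (in_bag E s).
    by apply: bags_ext h1 => // j x hj; rewrite k; [|lia]; do 3 (rewrite ifN; last lia).
  have := bags_add 0 NB M1 _ (h * Ls + l) e isT B (in0 _) (bag_lt _ _ (ltn_ord h) hl).
  apply: bags_ext => [x|j x hj]; last by apply/esym/bag_add_aget; lia.
  by rewrite /in_bag inE /= /fupd; case: eqP.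
- have B : bags 3 NB M2 (out_bag E s).
    apply: bags_ext h2 => // j x hj; rewrite k2 ?k; [|lia..].
    by do 3 (rewrite ifN; last lia).
  have := bags_add 3 NB M2 _ (t * Ls + l) e isT B (in0 _) (bag_lt _ _ (ltn_ord t) hl).
  apply: bags_ext => [x|j x hj] //.
  by rewrite /out_bag inE /= /fupd; case: eqP.
- move=> x; rewrite inE /= /fupd !k3 // !k //=.
  by case: eqP => //= _ /h3.
Qed.

Lemma low_detach X M e : low X M -> low X (detach M e).
Proof. by move=> h; do 2!apply: low_del. Qed.

Lemma low_attach X M E s e h t l : e \notin E -> uniq E -> l < Ls ->
  rep M E s -> low X M -> e <= X -> n <= X -> l <= X -> size E < X ->
  low X (attach M e h t l).
Proof.
move=> eE uE hl [[h1 h2 h3] _ _] hM he hn hlX hE.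
set M1 := aset (aset (aset M 9 e h) 10 e t) 11 e l.
have hM1 : low X M1.
  do 3 (apply: low_aset; last by [have := ltn_ord h; have := ltn_ord t; lia]).
  by [].
have k j x : j < 9 -> aget M1 j x = aget M j x.
  move=> hj; rewrite /M1 !aget_aset; do ?[lia].
  by do 3 (rewrite ifN; last lia).
have b1 := bag_lt _ _ (ltn_ord h) hl; have b2 := bag_lt _ _ (ltn_ord t) hl.
apply: low_add => //; first apply: low_add => //.
- rewrite k //; apply: leq_ltn_trans hE; apply: bag_size h1 b1 uE _.
  by move=> x; rewrite /in_bag; case: ifP.
- rewrite bag_add_aget // k //; apply: leq_ltn_trans hE.
  by apply: bag_size h2 b2 uE _ => x; rewrite /out_bag; case: ifP.
Qed.

Lemma rep_move M E s v l : l < NB -> rep M E s ->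
  let M' := move_level M v l in
  [/\ edges_at M' E (set_lev s v l), levels_at M' (set_lev s v l) &
      forall j x, 13 <= j < 16 -> aget M' j x = aget M j x].
Proof.
move=> hl [[h1 h2 h3] [h4 h5] _] M'; set s' := set_lev s v l.
set M1 := if aget M 12 v != 0 then bag_del 6 NB M (aget M 12 v) v else M.
have k1 j x : j < 16 -> ~~ (6 <= j <= 8) -> aget M1 j x = aget M j x.
  by move=> hj hj'; rewrite /M1; case: ifP => // _; rewrite bag_del_aget.
set M2 := aset M1 12 v l.
have k2 j x : j < 16 -> ~~ (6 <= j <= 8) -> aget M2 j x =
    if (j == 12) && (x == v) then l else aget M j x.
  by move=> hj hj'; rewrite aget_aset // k1.
have k j x : j < 16 -> ~~ (6 <= j <= 8) -> aget M' j x =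
    if (j == 12) && (x == v) then l else aget M j x.
  move=> hj hj'; rewrite -k2 // /M' /move_level -/M1 -/M2; case: ifP => // _.
  by rewrite bag_add_aget.
have B1 : bags 6 NB M1 (fun x => if x == v then None else level_bag s x).
  have hv : level_bag s v = if lev s v != 0 then Some (lev s v) else None.
    by rewrite /level_bag valK.
  rewrite /M1 h5; case: ifP hv => [h0 hv|h0 hv]; first exact: bags_del.
  by apply: bags_ext h4 => // x; case: eqP => // ->.
have B2 : bags 6 NB M2 (fun x => if x == v then None else level_bag s x).
  by apply: bags_ext B1 => // j x hj; rewrite aget_aset ?ifN //; lia.
have hs' x : level_bag s' x =
    if x == v then if l != 0 then Some l else None else level_bag s x.
  rewrite /level_bag; case: insubP => [u hu ux|hx].
    by rewrite /s' /set_lev /fupd /= -ux (val_eqE u v); case: (u =P v).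
  by case: eqP => // e0; rewrite e0 ltn_ord in hx.
split; last by move=> j x hj; rewrite k ?ifN //; lia.
  split; [| |by move=> e /h3; rewrite !k].
    by apply: bags_ext h1 => // j x hj; rewrite k ?ifN //; lia.
  by apply: bags_ext h2 => // j x hj; rewrite k ?ifN //; lia.
split; last first.
  by move=> u; rewrite k //= /fupd (val_eqE u v) h5; case: (u =P v).
rewrite /M' /move_level -/M1 -/M2; case: ifP => hl0.
  have := bags_add 6 NB M2 _ l v isT B2; rewrite eqxx => /(_ erefl hl).
  by apply: bags_ext => // x; rewrite hs' hl0; case: eqP.
by apply: bags_ext B2 => // x; rewrite hs' hl0; case: eqP.
Qed.

Lemma low_move X M E s v l : l < NB -> rep M E s -> low X M -> n < X ->
  l <= X -> low X (move_level M v l).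
Proof.
move=> hl [_ [h4 h5] _] hM hn hlX.
rewrite /move_level.
set M1 := if aget M 12 v != 0 then bag_del 6 NB M (aget M 12 v) v else M.
have hM1 : low X M1 by rewrite /M1; case: ifP => // _; apply: low_del.
have hM2 : low X (aset M1 12 v l) by apply: low_aset.
case: ifP => // _; apply: low_add => //.
  by have := ltn_ord v; lia.
rewrite aget_aset ?ifN //.
have h6 : aget M 6 l <= n.
  rewrite -(size_iota 0 n); apply: bag_size h4 hl (iota_uniq _ _) _ => x.
  by rewrite /level_bag mem_iota; case: insubP => // u ->.
apply: leq_ltn_trans hn; rewrite /M1; case: ifP => // h0.
rewrite /bag_del; rewrite aget_aset //=; case: eqP => [e|_].
  by apply: leq_trans (leq_subr _ _) _; rewrite !aget_aset //= -e.
by rewrite !aget_aset.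
Qed.

End Representation.

(** * The program *)

Definition arr (i : nat) (x : expr) : expr :=
  Deref (Bin OpAdd (Bin OpMul x (Const 16)) (Const i)).

Definition put (i : nat) (x v : expr) : cmd :=
  Store (Bin OpAdd (Bin OpMul x (Const 16)) (Const i)) v.

Declare Scope cmd_scope.
Delimit Scope cmd_scope with cmd.
Notation "c1 ;; c2" := (Seq c1 c2) (at level 61, right associativity) : cmd_scope.
Notation "i <~ e" := (Assign i e) (at level 60) : cmd_scope.
Notation "$ i" := (Reg i) (at level 1, i at level 0) : cmd_scope.
Notation "# i" := (Const i) (at level 1, i at level 0) : cmd_scope.
Notation "a +' b" := (Bin OpAdd a b) (at level 50, left associativity) : cmd_scope.
Notation "a -' b" := (Bin OpSub a b) (at level 50, left associativity) : cmd_scope.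
Notation "a *' b" := (Bin OpMul a b) (at level 40, left associativity) : cmd_scope.
Notation "a /' b" := (Bin OpDiv a b) (at level 40, left associativity) : cmd_scope.
Notation "a <' b" := (Bin OpLt a b) (at level 55) : cmd_scope.
Local Open Scope cmd_scope.

(* Registers 0 to 2 hold the parameters of the problem, 3 to 5 the arguments,
   8 to 12 the quantities [D], [2 * D], [Ls], [n * Ls] and [cap], 13 the current
   vertex and 14 whether to go on. *)
Definition slot_at (f : nat) (p b : expr) : expr := arr f.+1 (p *' $11 +' b).

Definition bag_add_cmd (f b x : nat) : cmd :=
  put f.+1 (arr f ($b) *' $11 +' $b) ($x) ;;
  put f.+2 ($x) (arr f ($b)) ;;
  put f ($b) (arr f ($b) +' #1).

Definition bag_del_cmd (f b x : nat) : cmd :=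
  put f.+2 (slot_at f (arr f ($b) -' #1) ($b)) (arr f.+2 ($x)) ;;
  put f.+1 (arr f.+2 ($x) *' $11 +' $b)
    (slot_at f (arr f ($b) -' #1) ($b)) ;;
  put f ($b) (arr f ($b) -' #1).

Definition detach_cmd : cmd :=
  23 <~ arr 9 ($19) *' $10 +' arr 11 ($19) ;;
  bag_del_cmd 0 23 19 ;;
  23 <~ arr 10 ($19) *' $10 +' arr 11 ($19) ;;
  bag_del_cmd 3 23 19.

Definition attach_cmd : cmd :=
  put 9 ($19) ($24) ;;
  put 10 ($19) ($25) ;;
  put 11 ($19) ($15) ;;
  23 <~ $24 *' $10 +' $15 ;;
  bag_add_cmd 0 23 19 ;;
  23 <~ $25 *' $10 +' $15 ;;
  bag_add_cmd 3 23 19.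

Definition move_level_cmd : cmd :=
  23 <~ arr 12 ($13) ;;
  If ($23) (bag_del_cmd 6 23 13) Skip ;;
  put 12 ($13) ($15) ;;
  If ($15) (bag_add_cmd 6 15 13) Skip.

Definition up_flip_cmd : cmd :=
  24 <~ $20 ;; 25 <~ $13 ;; 15 <~ arr 12 ($20) ;; attach_cmd ;; 13 <~ $20.

Definition up_relabel_cmd : cmd :=
  24 <~ $13 ;; 25 <~ $20 ;; 15 <~ $15 +' #1 ;; attach_cmd.

Definition rise_cmd : cmd :=
  15 <~ $15 +' #1 ;;
  move_level_cmd ;;
  put 13 ($15) ($16) ;;
  If (arr 14 (#0) <' $15) (put 14 (#0) ($15)) Skip ;;
  14 <~ #0.

Definition look_cmd : cmd :=
  17 <~ $13 *' $10 +' $15 ;;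
  18 <~ $17 +' #1 ;;
  21 <~ arr 0 ($18) ;;
  22 <~ arr 0 ($17) +' $21.

(** The product is a conjunction and tests [due]. Comparisons are strict, so [b <= cap] reads
    [b < cap + 1], and [lev u + 2 <= l] reads [lev u + 2 < l + 1]. *)
Definition up_body : cmd :=
  15 <~ arr 12 ($13) ;;
  16 <~ arr 13 ($15) +' arr 13 ($15) /' $8 +' #4 ;;
  look_cmd ;;
  If (($16 <' $12 +' #1) *' ($21 <' $9 *' ($22 -' $16)))
    (If (arr 0 ($17))
      (19 <~ arr 1 ($17) ;;
       20 <~ arr 10 ($19) ;;
       detach_cmd ;;
       If (arr 12 ($20) +' #2 <' $15 +' #1) up_flip_cmd up_relabel_cmd)
      rise_cmd)
    (14 <~ #0).

Definition down_relabel_cmd : cmd :=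
  19 <~ arr 1 ($18) ;;
  24 <~ $13 ;;
  25 <~ arr 10 ($19) ;;
  detach_cmd ;;
  attach_cmd.

Definition down_flip_cmd : cmd :=
  19 <~ arr 4 ($18) ;;
  20 <~ arr 9 ($19) ;;
  24 <~ $13 ;;
  25 <~ $20 ;;
  detach_cmd ;;
  attach_cmd ;;
  13 <~ $20.

Definition fall_cmd : cmd :=
  15 <~ $15 -' #1 ;;
  move_level_cmd ;;
  If (arr 6 (arr 14 (#0))) Skip (put 14 (#0) (arr 14 (#0) -' #1)) ;;
  14 <~ #0.

(** Subtraction saturates like [l.-1]. At levels 0 and 1 the lower threshold is 0, so a vertex falls
    only from level 2 or above and lands on a level that has a bag. *)
Definition down_body : cmd :=
  15 <~ arr 12 ($13) ;;
  16 <~ arr 13 ($15 -' #1) ;;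
  look_cmd ;;
  If ($9 *' ($22 -' $16) <' $21) down_relabel_cmd
    (If ($22 <' $16)
      (18 <~ $18 +' #1 ;; If (arr 3 ($18)) down_flip_cmd fall_cmd)
      (14 <~ #0)).

Definition double_cmd : cmd := 6 <~ $6 +' $6 ;; 7 <~ $7 +' #1.

(** The factor 200 of [scale] is written as a product because [expr_ok] admits constants up to 64
    only. *)
Definition constants_cmd : cmd :=
  8 <~ #50 *' #4 *' $7 *' $1 *' $1 ;;
  9 <~ $8 +' $8 ;;
  10 <~ $2 +' #8 ;;
  11 <~ $0 *' $10 ;;
  12 <~ #4 *' $2 ;;
  14 <~ #1.

(* The loop leaves in register 7 a number [J] with [n < 2 ^ J]. *)
Definition scale_cmd : cmd :=
  (6 <~ #1 ;; 7 <~ #1) ;; While ($6 <' $0) double_cmd ;; constants_cmd.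

Definition insert_edge_cmd : cmd :=
  19 <~ $3 ;;
  If (arr 12 ($4) <' arr 12 ($5))
    (24 <~ $4 ;; 25 <~ $5) (24 <~ $5 ;; 25 <~ $4) ;;
  15 <~ arr 12 ($24) ;;
  attach_cmd ;;
  13 <~ $24.

Definition delete_edge_cmd : cmd :=
  19 <~ $3 ;; detach_cmd ;; 13 <~ arr 9 ($19).

(* The vertices are listed by decreasing level, two levels at a time: register 4
   holds the level, 5 the position in its bag, 6 and 7 the numbers of vertices
   listed so far and before the last two levels, and 8 the parity of the
   number of levels listed. *)
Definition list_body : cmd :=
  If ($4)
    (If ($5 <' arr 6 ($4))
      (Output (slot_at 6 ($5) ($4)) ;; 5 <~ $5 +' #1 ;; 6 <~ $6 +' #1)
      (5 <~ #0 ;;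
       If ($8)
         (If (($6 -' $7) *' (#8 *' $1) <' $7 +' #1)
            (14 <~ #0)
            (4 <~ $4 -' #1 ;; 7 <~ $6 ;; 8 <~ #0))
         (4 <~ $4 -' #1 ;; 8 <~ #1)))
    (If ($5 <' $0)
      (If (arr 12 ($5)) Skip (Output ($5)) ;; 5 <~ $5 +' #1)
      (14 <~ #0)).

Definition list_init_cmd : cmd :=
  11 <~ $0 *' ($2 +' #8) ;; 4 <~ arr 14 (#0) ;; 8 <~ #1 ;; 14 <~ #1.

Definition list_program : cmd := list_init_cmd ;; While ($14) list_body.

Definition program : algorithm := Algorithm
  (scale_cmd ;; insert_edge_cmd ;; While ($14) up_body)
  (scale_cmd ;; delete_edge_cmd ;; While ($14) down_body)
  (Output (arr 9 ($3)))
  list_program.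

(** * Its loop-free parts *)

Arguments evalN : simpl never.
Arguments runN : simpl never.

Lemma evalN_reg s i : evalN s ($i) = regs s i.
Proof. by []. Qed.

Lemma evalN_const s c : evalN s (#c) = c.
Proof. by []. Qed.

Lemma evalN_bin s o a b :
  evalN s (Bin o a b) = eval_binop o (evalN s a) (evalN s b).
Proof. by []. Qed.

Lemma evalN_arr s i x : evalN s (arr i x) = aget (ram s) i (evalN s x).
Proof. by []. Qed.

Lemma evalN_slot s f p b : evalN s (slot_at f p b) =
  aget (ram s) f.+1 (evalN s p * regs s 11 + evalN s b).
Proof. by []. Qed.

Definition evalE := (evalN_slot, evalN_arr, evalN_reg, evalN_const, evalN_bin).

Definition wp (c : cmd) (s : state) (Q : state -> Prop) : Prop := Q (runN c s).

Section Wp.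
Variables (s : state) (Q : state -> Prop).

Lemma wp_seq c1 c2 : wp c1 s (fun s' => wp c2 s' Q) -> wp (c1 ;; c2) s Q.
Proof. by []. Qed.

(** The value is a fresh variable with an equation, so that the terms describing the state do not
    grow along the program. *)
Lemma wp_assign i e :
  (forall v, v = evalN s e -> Q (State (upd (regs s) i v) (ram s) (outs s))) ->
  wp (i <~ e) s Q.
Proof. by move=> h; apply: h. Qed.

Lemma wp_put i x v :
  (forall M, M = aset (ram s) i (evalN s x) (evalN s v) ->
     Q (State (regs s) M (outs s))) -> wp (put i x v) s Q.
Proof. by move=> h; apply: h. Qed.

Lemma wp_skip : Q s -> wp Skip s Q.
Proof. by []. Qed.

Lemma wp_if b c1 c2 : (evalN s b <> 0 -> wp c1 s Q) ->
  (evalN s b = 0 -> wp c2 s Q) -> wp (If b c1 c2) s Q.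
Proof.
move=> h1 h2; rewrite /wp /runN -/runN; case: ifPn => [/eqP|]; first exact: h1.
by rewrite negbK => /eqP; apply: h2.
Qed.

Lemma wp_bag_add f b x :
  (forall M, M = bag_add f (regs s 11) (ram s) (regs s b) (regs s x) ->
     Q (State (regs s) M (outs s))) -> wp (bag_add_cmd f b x) s Q.
Proof. by move=> h; apply: h. Qed.

Lemma wp_bag_del f b x :
  (forall M, M = bag_del f (regs s 11) (ram s) (regs s b) (regs s x) ->
     Q (State (regs s) M (outs s))) -> wp (bag_del_cmd f b x) s Q.
Proof. by move=> h; apply: h. Qed.

End Wp.

Ltac assign v h := apply: wp_seq; apply: wp_assign => v h; rewrite !evalE /= in h;
  rewrite /upd /= in h; rewrite /=.
Ltac assign_last v h := apply: wp_assign => v h; rewrite !evalE /= in h;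
  rewrite /upd /= in h; rewrite /=.
Ltac store M h := apply: wp_seq; apply: wp_put => M h; rewrite !evalE /= in h;
  rewrite /upd /= in h; rewrite /=.

Ltac branch h := apply: wp_if => h; rewrite !evalE /= in h; rewrite /upd /= in h.

Section Blocks.
Variables (s : state) (Q : state -> Prop) (n Ls : nat).
Hypotheses (r10 : regs s 10 = Ls) (r11 : regs s 11 = n * Ls).

Lemma wp_detach e : regs s 19 = e -> (forall x y,
   Q (State (upd (upd (regs s) 23 x) 23 y) (detach n Ls (ram s) e) (outs s))) ->
  wp detach_cmd s Q.
Proof.
move=> <- h; rewrite /detach_cmd; assign x hx.
apply: wp_seq; apply: wp_bag_del => M hM; rewrite /upd /= in hM; rewrite /=.
assign y hy; apply: wp_bag_del => M' hM'; rewrite /upd /= in hM'; rewrite /=.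
rewrite (_ : M' = detach n Ls (ram s) (regs s 19)); first exact: h.
by rewrite /detach hM' -r11 -r10 hy hM hx.
Qed.

Lemma wp_attach e h t l : regs s 19 = e -> regs s 24 = h -> regs s 25 = t ->
  regs s 15 = l -> (forall x y,
   Q (State (upd (upd (regs s) 23 x) 23 y) (attach n Ls (ram s) e h t l)
     (outs s))) -> wp attach_cmd s Q.
Proof.
move=> <- <- <- <- H; rewrite /attach_cmd.
store M1 h1; store M2 h2; store M3 h3; assign x hx.
apply: wp_seq; apply: wp_bag_add => M hM; rewrite /upd /= in hM; rewrite /=.
assign y hy; apply: wp_bag_add => M' hM'; rewrite /upd /= in hM'; rewrite /=.
rewrite (_ : M' = attach n Ls (ram s) (regs s 19) (regs s 24) (regs s 25)
  (regs s 15)); first exact: H.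
by rewrite /attach hM' -r11 -r10 hy hM hx h3 h2 h1.
Qed.

Lemma wp_move_level v l : regs s 13 = v -> regs s 15 = l -> (forall x,
   Q (State (upd (regs s) 23 x) (move_level n Ls (ram s) v l) (outs s))) ->
  wp move_level_cmd s Q.
Proof.
move=> <- <- h; rewrite /move_level_cmd; assign x hx; apply: wp_seq.
set M1 := if x != 0 then bag_del 6 (n * Ls) (ram s) x (regs s 13) else ram s.
suff H : wp (put 12 ($13) ($15) ;; If ($15) (bag_add_cmd 6 15 13) Skip)
    (State (upd (regs s) 23 x) M1 (outs s)) Q.
  branch h0.
    apply: wp_bag_del => M hM; rewrite /upd /= in hM; rewrite /=.
    by rewrite hM r11; move: H; rewrite /M1; case: eqP.
  by apply: wp_skip; move: H; rewrite /M1; case: eqP.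
store M2 h2.
have e : move_level n Ls (ram s) (regs s 13) (regs s 15) =
    if regs s 15 != 0 then bag_add 6 (n * Ls) M2 (regs s 15) (regs s 13) else M2.
  by rewrite /move_level -hx -/M1 -h2.
rewrite e in h; branch h0.
  apply: wp_bag_add => M hM; rewrite /upd /= in hM; rewrite /=.
  by have := h x; rewrite hM r11; case: eqP.
by apply: wp_skip; have := h x; case: eqP.
Qed.

End Blocks.

Definition swapped {n} (s s' : conf n) : Prop :=
  forall e, (hd s' e = hd s e /\ tl s' e = tl s e) \/
            (hd s' e = tl s e /\ tl s' e = hd s e).

Lemma swapped_refl n (s : conf n) : swapped s s.
Proof. by move=> e; left. Qed.

Lemma swapped_trans n (s s' s'' : conf n) :
  swapped s s' -> swapped s' s'' -> swapped s s''.
Proof.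
by move=> h h' e; case: (h e) => -[h1 h2]; case: (h' e) => -[-> ->];
  rewrite h1 h2; auto.
Qed.

Lemma swapped_set n (s : conf n) e h t l :
  (h = hd s e /\ t = tl s e) \/ (h = tl s e /\ t = hd s e) ->
  swapped s (set_edge s e h t l).
Proof.
by move=> ht x; rewrite /= /fupd; case: eqP => [->|_]; [| left].
Qed.

Lemma count_split (F : seq nat) (a b c : pred nat) :
  (forall e, e \in F -> a e + b e = c e) -> count a F + count b F = count c F.
Proof.
elim: F => //= e F IH h; rewrite -IH => [|x hx]; last first.
  by apply: h; rewrite inE hx orbT.
by rewrite -h ?mem_head // addnACA.
Qed.

(** * One iteration of each repair loop *)

Section Body.
Variables n E Tc D X : nat.
Hypothesis D2 : 1 < D.
Notation Ls := (Tc + 8).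
Notation cap := (4 * Tc).
Notation NB := (n * Ls).
Implicit Types (M : memory) (F : seq nat) (s : conf n) (v cur : 'I_n).

Definition scaled (st : state) : Prop :=
  [/\ regs st 0 = n, regs st 1 = E & regs st 2 = Tc] /\
  [/\ regs st 8 = D, regs st 9 = 2 * D, regs st 10 = Ls, regs st 11 = NB &
      regs st 12 = cap].

Lemma in_count M F s v l : rep n D Ls M F s -> uniq F ->
  (forall e, e \in F -> lab s e < Ls) -> l < Ls ->
  aget M 0 (v * Ls + l) = count (fun e => (hd s e == v) && (lab s e == l)) F.
Proof.
move=> [[h1 _ _] _ _] uF hF hl.
rewrite (bag_card _ _ _ _ _ F h1 (bag_lt _ _ _ _ (ltn_ord v) hl) uF).
  apply: eq_in_count => e eF; rewrite /in_bag eF.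
  by rewrite -(val_eqE (hd s e) v) -(eq_slot Ls) ?hF.
by move=> x; rewrite /in_bag; case: ifP.
Qed.

Lemma in_pick M F s v l : rep n D Ls M F s -> l < Ls ->
  (forall e, e \in F -> lab s e < Ls) ->
  0 < aget M 0 (v * Ls + l) ->
  let e := aget M 1 (v * Ls + l) in
  [/\ e \in F, hd s e = v & lab s e = l].
Proof.
move=> [[[_ h1] _ _] _ _] hl hF h0.
have [] := h1 _ 0 (bag_lt _ _ _ _ (ltn_ord v) hl) h0.
rewrite mul0n add0n /in_bag; case: ifP => // eF [/eqP].
rewrite eq_slot ?hF // => /andP[/eqP/val_inj h2 /eqP h3] _.
by split.
Qed.

Lemma out_pick M F s v l : rep n D Ls M F s -> l < Ls ->
  (forall e, e \in F -> lab s e < Ls) ->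
  0 < aget M 3 (v * Ls + l) ->
  let e := aget M 4 (v * Ls + l) in
  [/\ e \in F, tl s e = v & lab s e = l].
Proof.
move=> [[_ [_ h1] _] _ _] hl hF h0.
have [] := h1 _ 0 (bag_lt _ _ _ _ (ltn_ord v) hl) h0.
rewrite mul0n add0n /out_bag; case: ifP => // eF [/eqP].
rewrite eq_slot ?hF // => /andP[/eqP/val_inj h2 /eqP h3] _.
by split.
Qed.

Lemma out_empty M F s v l : rep n D Ls M F s -> l < Ls ->
  aget M 3 (v * Ls + l) = 0 ->
  forall e, e \in F -> tl s e = v -> lab s e != l.
Proof.
move=> [[_ [h1 _] _] _ _] hl h0 e eF ev; apply/eqP => el.
have := h1 e (v * Ls + l); rewrite /out_bag eF ev el h0 => /(_ erefl)[].
by [].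
Qed.

Lemma edge_rep M F s e : rep n D Ls M F s -> e \in F ->
  [/\ aget M 9 e = hd s e, aget M 10 e = tl s e & aget M 11 e = lab s e].
Proof. by case=> [[_ _ h] _ _]; apply: h. Qed.

Lemma lev_rep M F s v : rep n D Ls M F s -> aget M 12 v = lev s v.
Proof. by case=> [_ [_ h] _]; apply: h. Qed.

Lemma rep_change M F s e (h t : 'I_n) l : uniq F -> e \in F -> l < Ls ->
  rep n D Ls M F s ->
  rep n D Ls (attach n Ls (detach n Ls M e) e h t l) F (set_edge s e h t l).
Proof.
move=> uF eF hl hr.
apply: (@rep_eq _ _ _ _ (e :: rem e F)).
  by move=> x; rewrite (perm_mem (perm_to_rem eF)).
by apply: rep_attach => //; [rewrite mem_rem_uniqF | apply: rep_detach].
Qed.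

Lemma low_change M F s e (h t : 'I_n) l : uniq F -> e \in F -> l < Ls ->
  rep n D Ls M F s -> low X M -> e <= X -> n <= X -> Ls <= X -> size F <= X ->
  low X (attach n Ls (detach n Ls M e) e h t l).
Proof.
move=> uF eF hl hr hM he hn hX hF.
have F0 : 0 < size F by case: (F) eF.
have := low_attach n D Ls X (detach n Ls M e) (rem e F) s e h t l.
rewrite mem_rem_uniqF // rem_uniq // size_rem // => H; apply: H => //.
- exact: rep_detach.
- exact: low_detach.
- by lia.
- by rewrite prednK.
Qed.

(** The cap [4 * Tc] and [thr D l >= 4 * l] bound the levels by [Tc]. With the width [Tc + 8], the
    labels in use and the label [l + 2] looked up by [down_body] stay inside the block of bags of
    their vertex. *)
Lemma lab_lt F s : (forall e, e \in F -> eok s e) ->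
  (forall v, thr D (lev s v) <= cap) ->
  (forall v, lev s v <= Tc) /\ (forall e, e \in F -> lab s e < Ls).
Proof.
move=> he hv; have hl v : lev s v <= Tc.
  by have := hv v; have := thr_ge D (lev s v); lia.
by split=> // e /he[_ h _]; have := hl (hd s e); lia.
Qed.

Lemma up_lev F s cur : inv_up n D cap F s cur ->
  forall v, thr D (lev s v) <= cap.
Proof.
move=> [_ hv [_ _ hc _]] v; case: (v =P cur) => [->//|/eqP/hv].
by case.
Qed.

Lemma down_lev F s cur : inv_down n D cap F s cur ->
  forall v, thr D (lev s v) <= cap.
Proof.
move=> [_ hv [_ _ hc _]] v; case: (v =P cur) => [->//|/eqP/hv].
by case.
Qed.

Lemma look_counts M F s v : rep n D Ls M F s -> uniq F ->
  (forall e, e \in F -> eok s e) -> (forall e, e \in F -> lab s e < Ls) ->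
  lev s v <= Tc ->
  aget M 0 (v * Ls + lev s v + 1) = hot F s v /\
  aget M 0 (v * Ls + lev s v) + hot F s v = indeg F s v.
Proof.
move=> hr uF he hF hl; have hl1 : (lev s v).+1 < Ls by lia.
rewrite -addnA addn1 !(in_count M F s) //; last by lia.
split=> //; apply: count_split => e eF.
have [h1 h2 _] := he e eF; case: eqP => //= ev; rewrite ev in h1 h2.
by case: eqP => [->|h3]; case: eqP => [h4|h4] //=; lia.
Qed.

Lemma rep_rise M F s v : (lev s v).+1 < NB -> rep n D Ls M F s ->
  let l := (lev s v).+1 in
  let M1 := aset (move_level n Ls M v l) 13 l (thr D l) in
  rep n D Ls (if aget M1 14 0 < l then aset M1 14 0 l else M1) F (set_lev s v l).
Proof.
move=> hl hr l M1; have [h1 h2 h3] := rep_move n D Ls M F s v l hl hr.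
have [_ _ [t1 t2 t3]] := hr; set M2 := if _ then _ else _.
have k j x : j < 13 -> aget (move_level n Ls M v l) j x = aget M2 j x.
  move=> hj; rewrite /M2 /M1.
  by case: ifP => _; do ?(rewrite aget_aset; [rewrite ifN; last lia | lia | lia]).
have h14 : aget M1 14 0 = aget M 14 0 by rewrite aget_aset //= h3.
have top : aget M2 14 0 = maxn (aget M 14 0) l.
  rewrite /M2 h14; case: ifP => h; last by rewrite h14; lia.
  by rewrite aget_aset //=; lia.
have k13 i : aget M2 13 i = if i == l then thr D l else aget M 13 i.
  rewrite /M2; case: ifP => _; last by rewrite aget_aset //= h3.
  by rewrite aget_aset //= aget_aset //= h3.
split.
- case: h1 => b1 b2 b3; split.
  + by apply: bags_ext b1 => // j x hj; apply: k; lia.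
  + by apply: bags_ext b2 => // j x hj; apply: k; lia.
  + by move=> e eF; rewrite -!k //; apply: b3.
- case: h2 => b1 b2; split; last by move=> u; rewrite -k.
  by apply: bags_ext b1 => // j x hj; apply: k; lia.
have hv := t2 v; split=> [i|u|].
- by rewrite top k13; case: eqP => [->//|hi] h; apply: t1; lia.
- by rewrite top /= /fupd; case: eqP => _; have := t2 u; lia.
rewrite top; case: (leqP (aget M 14 0) (lev s v)) => h.
  by right; exists v; rewrite /= /fupd eqxx; lia.
case: t3 => [|[u hu]]; first by lia.
by right; exists u; rewrite /= /fupd; case: eqP => [e|_]; [subst u|]; lia.
Qed.

Lemma rep_fall M F s v : 1 < lev s v -> (lev s v) < NB -> Tc + 8 <= NB ->
  (forall u, lev s u <= Tc) -> rep n D Ls M F s ->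
  let l := (lev s v).-1 in
  let M1 := move_level n Ls M v l in
  let top := aget M1 14 0 in
  rep n D Ls (if aget M1 6 top == 0 then aset M1 14 0 (top - 1) else M1) F
    (set_lev s v l).
Proof.
move=> hv1 hl hNB hT hr l M1 top.
have hl' : l < NB by rewrite /l; lia.
have [h1 h2 h3] := rep_move n D Ls M F s v l hl' hr.
have [_ _ [t1 t2 t3]] := hr; set M2 := if _ then _ else _.
have k j x : j < 14 -> aget M2 j x = aget M1 j x.
  move=> hj; rewrite /M2; case: ifP => _ //.
  by rewrite aget_aset; [rewrite ifN; last lia | lia | lia].
have etop : top = aget M 14 0 by rewrite /top h3.
have tv := t2 v; have [u hu] : exists u, lev s u = top.
  by case: t3; rewrite etop //; lia.
have tN : top < NB by have := hT u; lia.
have top2 : aget M2 14 0 = if aget M1 6 top == 0 then top - 1 else top.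
  by rewrite /M2; case: ifP; rewrite ?aget_aset.
split.
- case: h1 => b1 b2 b3; split.
  + by apply: bags_ext b1 => // j x hj; rewrite k //; lia.
  + by apply: bags_ext b2 => // j x hj; rewrite k //; lia.
  + by move=> e eF; rewrite !k //; apply: b3.
- case: h2 => b1 b2; split; last by move=> w; rewrite k.
  by apply: bags_ext b1 => // j x hj; rewrite k //; lia.
case: h2 => [[b1 b2] b3].
have only w : aget M1 6 top = 0 -> lev (set_lev s v l) w <> top.
  move=> h0 hw; have := b1 w top; rewrite /level_bag valK hw h0.
  by rewrite (_ : (top != 0)); [move=> /(_ erefl)[] | lia].
split.
- move=> i hi; rewrite k // h3 //; apply: t1.
  by move: hi; rewrite top2 -etop; case: eqP; lia.
- move=> w; rewrite top2; have h4 : lev (set_lev s v l) w <= top.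
    by rewrite /= /fupd; have := t2 w; case: eqP => _; rewrite -etop /l; lia.
  by case: eqP => // h0; have := only w h0; lia.
(* Only [v] can have emptied the largest level, and it now lies one level below, so lowering the
   maximum by 1 is exact. *)
rewrite top2; case: eqP => h0; right.
  exists v; have := only u h0; rewrite /= /fupd eqxx; case: (u =P v) => [e _|//].
  by rewrite /l -e hu; lia.
have [|] := b2 top 0 tN; first by rewrite lt0n; apply/eqP.
rewrite /level_bag; case: insubP => // w hw _.
by case: ifP => // _ [hw'] _; exists w.
Qed.

Definition up_post F s cur (st st' : state) : Prop :=
  [/\ scaled st', low X (ram st'), outs st' = outs st &
   (regs st' 14 = 1 /\ exists s' cur', [/\ regs st' 13 = cur',
      rep n D Ls (ram st') F s', inv_up n D cap F s' cur', swapped s s' &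
      pot_up n D cap F s' cur' < pot_up n D cap F s cur /\
      wc_up n D cap F s' cur' < wc_up n D cap F s cur]) \/
   (regs st' 14 = 0 /\ exists s', [/\ rep n D Ls (ram st') F s',
      steady n D cap F s', swapped s s' &
      pot n D cap F s' <= pot_up n D cap F s cur + 2 * D])].

Lemma scaled_ext st st' : (forall i, i < 13 -> regs st' i = regs st i) ->
  scaled st -> scaled st'.
Proof. by move=> h [[h1 h2 h3] [h4 h5 h6 h7 h8]]; split; split; rewrite h. Qed.

Lemma up_body_ok F s cur st : uniq F -> (forall e, e \in F -> e <= X) ->
  size F <= X -> n < X -> Ls <= X -> cap <= X ->
  scaled st -> low X (ram st) -> rep n D Ls (ram st) F s ->
  inv_up n D cap F s cur -> regs st 13 = cur -> regs st 14 = 1 ->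
  wp up_body st (up_post F s cur st).
Proof.
move=> uF FX sF nX LX cX hs hM hr hI hcur hgo.
have hlev := up_lev _ _ _ hI; have [he hv hu] := hI.
have [hlT hlab] := lab_lt _ _ he hlev.
have [[r0 r1 r2] [r8 r9 r10 r11 r12]] := hs.
have [q1 q2] := look_counts _ _ _ cur hr uF he hlab (hlT cur).
have [_ _ [ht1 ht2 ht3]] := hr.
rewrite /up_body.
assign l hl; rewrite hcur (lev_rep _ _ _ _ hr) in hl.
assign b hb; rewrite {1 2}hl ht1 // r8 -thrS in hb.
rewrite /look_cmd; apply: wp_seq.
assign b0 hb0; rewrite hcur r10 {1}hl in hb0.
assign b1 hb1; rewrite hb0 in hb1.
assign q hq; rewrite hb1 q1 in hq.
assign_last d hdg; rewrite hb0 hq q2 in hdg.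
branch hdue; rewrite r12 r9 in hdue; last first.
  assign_last v hv0; split=> //=.
  right; split; first by rewrite /upd /= hv0.
  exists s; have [] := pot_up_done n D cap D2 F s cur hI.
    by rewrite /due -hb -hq -hdg; case: (leqP b cap) hdue => h1; nia.
  by split=> //; apply: swapped_refl.
have {}hdue : due D cap (lev s cur) (indeg F s cur) (hot F s cur).
  by rewrite /due -hb -hq -hdg; case: (leqP b cap) hdue => h1; nia.
have hl1 : lev s cur < Tc.
  by case/andP: hdue; have := thr_ge D (lev s cur).+1; lia.
have [c1 c2] := andP hdue; rewrite -hb in c1.
have LNB : Ls <= NB by have := ltn_ord cur; nia.
branch h0; rewrite hb0 in h0; last first.
  have hl' : lev s cur < Ls by lia.
  have hcold e : e \in F -> hd s e = cur -> lab s e != lev s cur.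
    move=> eF ec; have := in_count _ F s cur _ hr uF hlab hl'.
    rewrite h0 => /esym/eqP; rewrite -leqn0 leqNgt -has_count => /hasPn/(_ e eF).
    by rewrite ec eqxx.
  have [hst hpot] := up_rise n D cap D2 F s cur hI hdue hcold.
  have hm : (lev s cur).+1 < NB by lia.
  have /= hrise := rep_rise (ram st) F s cur hm hr.
  rewrite /rise_cmd; assign l' hl1'; rewrite hl addn1 in hl1'; apply: wp_seq.
  apply: (@wp_move_level _ _ n Ls _ cur l') => // x.
  store M2 hM2; apply: wp_seq; rewrite hl1' hb in hM2; rewrite -hM2 in hrise.
  have lM2 : low X M2.
    rewrite hM2; apply: low_aset; last by lia.
    by apply: (low_move n D Ls X (ram st) F s) => //; lia.
  branch htop; rewrite hl1' in htop.
    apply: wp_put => M3 hM3; rewrite !evalE /= /upd /= hl1' in hM3; rewrite /=.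
    assign_last v hv0; split=> //=.
      by rewrite hM3; apply: low_aset => //; lia.
    right; split; first by rewrite /upd /= hv0.
    exists (set_lev s cur (lev s cur).+1); split=> //; last by move=> y; left.
    by rewrite hM3; case: ifP hrise htop => // ->.
  refine (wp_skip _ _ _) => /=; assign_last v hv0; split=> //=.
  right; split; first by rewrite /upd /= hv0.
  exists (set_lev s cur (lev s cur).+1); split=> //; last by move=> y; left.
  by case: ifP hrise htop.
have h0' : 0 < aget (ram st) 0 (cur * Ls + lev s cur).
  by rewrite lt0n; apply/eqP.
have [eF ehd elab] := in_pick _ F s cur _ hr (leq_trans hl1 (leq_addr _ _)) hlab h0'.
set e := aget (ram st) 1 _ in eF ehd elab.
have [e9 e10 e11] := edge_rep _ _ _ _ hr eF.
assign e' he'; rewrite hb0 -/e in he'.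
assign u hu'; rewrite he' e10 in hu'.
apply: wp_seq; apply: (@wp_detach _ _ n Ls _ _ e) => // x y.
have hdet := rep_detach n D Ls _ _ _ _ uF eF hr.
branch hlt; rewrite hu' (lev_rep _ _ _ _ hdet) hl in hlt.
  have hlu : (lev s (tl s e)).+2 <= lev s cur by lia.
  have [hI' hp1 hp2] := up_flip n D cap D2 F s cur e uF hI eF ehd elab hdue hlu.
  rewrite /up_flip_cmd; assign h hh; assign t hht; assign l' hl'.
  rewrite hu' (lev_rep _ _ _ _ hdet) in hl'; rewrite hu' in hh.
  rewrite hcur in hht; apply: wp_seq.
  apply: (@wp_attach _ _ n Ls _ _ e (tl s e) cur l') => // x' y' /=.
  assign_last v hv0; rewrite hu' in hv0.
  rewrite hl'; split=> //=.
    by apply: (low_change _ F s) => //; [lia | apply: FX | apply: ltnW].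
  left; split; first by rewrite /upd.
  exists (set_edge s e (tl s e) cur (lev s (tl s e))), (tl s e).
  split=> //; last first.
  - by apply: swapped_set; right; rewrite ehd.
  - by apply: rep_change => //; lia.
have hlu : lev s cur < (lev s (tl s e)).+2.
  by lia.
have [hI' hp1 hp2] := up_relabel n D cap D2 F s cur e uF hI eF ehd elab hdue hlu.
rewrite /up_relabel_cmd; assign h hh; assign t hht; assign l' hl'.
rewrite hl addn1 in hl'; rewrite hu' in hht; rewrite hcur in hh.
apply: (@wp_attach _ _ n Ls _ _ e cur (tl s e) l') => // x' y' /=.
rewrite hl'; split=> //=.
  by apply: (low_change _ F s) => //; [lia | apply: FX | apply: ltnW].
left; split; first by rewrite /upd.
exists (set_edge s e cur (tl s e) (lev s cur).+1), cur.
split=> //; last first.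
- by apply: swapped_set; left; rewrite ehd.
- by apply: rep_change => //; lia.
Qed.

(* At a vertex below its lower threshold there is nothing to relabel yet, but
   the vertex that loses an edge to it may need up to [2 * D] relabellings. *)
Definition load F s cur : nat :=
  pot_down n D cap F s cur +
  if indeg F s cur < thr D (lev s cur).-1 then 2 * D
  else hot F s cur - 2 * D * (indeg F s cur - thr D (lev s cur).-1).

Lemma load_leq F s cur : inv_down n D cap F s cur ->
  load F s cur <= pot_down n D cap F s cur + 2 * D.
Proof.
move=> [_ _ [h1 h2 _ _]]; rewrite leq_add2l; case: ifP => // /negbT h.
by rewrite subSn in h2; lia.
Qed.

Definition down_post F s cur (st st' : state) : Prop :=
  [/\ scaled st', low X (ram st'), outs st' = outs st &
   (regs st' 14 = 1 /\ exists s' cur', [/\ regs st' 13 = cur',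
      rep n D Ls (ram st') F s', inv_down n D cap F s' cur', swapped s s' &
      load F s' cur' < load F s cur /\
      wc_down n D cap F s' cur' < wc_down n D cap F s cur]) \/
   (regs st' 14 = 0 /\ exists s', [/\ rep n D Ls (ram st') F s',
      steady n D cap F s', swapped s s' &
      pot n D cap F s' <= load F s cur + 2 * D])].

Lemma down_body_ok F s cur st : uniq F -> (forall e, e \in F -> e <= X) ->
  size F <= X -> n < X -> Ls <= X -> cap <= X ->
  scaled st -> low X (ram st) -> rep n D Ls (ram st) F s ->
  inv_down n D cap F s cur -> regs st 13 = cur -> regs st 14 = 1 ->
  wp down_body st (down_post F s cur st).
Proof.
move=> uF FX sF nX LX cX hs hM hr hI hcur hgo.
have hlev := down_lev _ _ _ hI; have [he hv hu] := hI.
have [hlT hlab] := lab_lt _ _ he hlev; have hlc := hlT cur.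
have [[r0 r1 r2] [r8 r9 r10 r11 r12]] := hs.
have [q1 q2] := look_counts _ _ _ cur hr uF he hlab (hlT cur).
have [_ _ [ht1 ht2 ht3]] := hr.
have LNB : Ls <= NB by have := ltn_ord cur; nia.
rewrite /down_body.
assign l hl; rewrite hcur (lev_rep _ _ _ _ hr) in hl.
assign b hb; rewrite hl subn1 ht1 in hb; last by have := ht2 cur; lia.
rewrite /look_cmd; apply: wp_seq.
assign b0 hb0; rewrite hcur r10 {1}hl in hb0.
assign b1 hb1; rewrite hb0 in hb1.
assign q hq; rewrite hb1 q1 in hq.
assign_last d hdg; rewrite hb0 hq q2 in hdg.
branch hdue; rewrite r9 hq hdg hb in hdue.
  have {}hdue : 2 * D * (indeg F s cur - thr D (lev s cur).-1) < hot F s cur.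
    by lia.
  have h0' : 0 < aget (ram st) 0 (cur * Ls + (lev s cur).+1).
    by rewrite addnS -[(_ + _).+1]addn1 q1; apply: leq_ltn_trans hdue.
  have hlt : (lev s cur).+1 < Ls by lia.
  have [eF ehd elab] := in_pick _ F s cur _ hr hlt hlab h0'.
  set e := aget (ram st) 1 _ in eF ehd elab.
  have [e9 e10 e11] := edge_rep _ _ _ _ hr eF.
  have [hI' hp1 hp2 hp3 hp4] := down_relabel n D cap D2 F s cur e uF hI eF ehd
    elab hdue.
  rewrite /down_relabel_cmd; assign e' he'; rewrite hb1 -addnA addn1 -/e in he'.
  assign h hh; rewrite hcur in hh.
  assign t hht; rewrite he' e10 in hht.
  apply: wp_seq; apply: (@wp_detach _ _ n Ls _ _ e) => // x y.
  apply: (@wp_attach _ _ n Ls _ _ e cur (tl s e) (lev s cur)) => // x' y' /=.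
  split=> //=.
    by apply: (low_change _ F s) => //; [lia | apply: FX | apply: ltnW].
  left; split; first by rewrite /upd.
  exists (set_edge s e cur (tl s e) (lev s cur)), cur; split=> //; last first.
  (* The first branch is impossible: by [dok_low], a vertex below its lower threshold has no hot
     edge left to relabel. *)
  - split=> //; rewrite /load hp1 hp2 /=; case: ifPn => h5; last by lia.
    have [] := dok_low D cap D2 _ _ _ hu h5; lia.
  - by apply: swapped_set; left; rewrite ehd.
  - by apply: rep_change => //; lia.
have {}hdue : hot F s cur <= 2 * D * (indeg F s cur - thr D (lev s cur).-1).
  by lia.
branch hlow; rewrite hdg hb in hlow; last first.
  have {}hlow : thr D (lev s cur).-1 <= indeg F s cur by lia.
  assign_last v hv0; split=> //=.
  right; split; first by rewrite /upd /= hv0.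
  exists s; have [h1 h2] := down_done n D cap D2 F s cur hI hdue hlow.
  split=> //; first exact: swapped_refl.
  by apply: leq_trans h2 _; rewrite /load; lia.
have {}hlow : indeg F s cur < thr D (lev s cur).-1 by lia.
have hlt : (lev s cur).+2 < Ls by lia.
assign b2 hb2; have {}hb2 : b2 = cur * Ls + (lev s cur).+2.
  by rewrite hb2 hb1; lia.
branch h0; rewrite hb2 in h0; last first.
  have hemp := out_empty _ F s cur _ hr hlt h0.
  have [hst hpot] := down_fall n D cap D2 F s cur hI hlow hemp.
  have l1 : 1 < lev s cur by case: (lev s cur) hlow => [|[|]].
  have hm : lev s cur < NB by lia.
  have /= hfall := rep_fall (ram st) F s cur l1 hm LNB hlT hr.
  rewrite /fall_cmd; assign l' hl'; rewrite hl subn1 in hl'; apply: wp_seq.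
  apply: (@wp_move_level _ _ n Ls _ cur l') => // x.
  rewrite -hl' in hfall.
  have lM : low X (move_level n Ls (ram st) cur l').
    by apply: (low_move n D Ls X (ram st) F s) => //; lia.
  apply: wp_seq; branch htop.
    refine (wp_skip _ _ _) => /=; assign_last v hv0; split=> //=.
    right; split; first by rewrite /upd /= hv0.
    exists (set_lev s cur (lev s cur).-1); split=> //; last 2 first.
    - by move=> y; left.
    - by apply: leq_trans hpot _; rewrite /load; lia.
    by rewrite hl' in hfall htop *; case: eqP hfall.
  apply: wp_put => M3 hM3; rewrite !evalE /= in hM3; rewrite /upd /= in hM3.
  rewrite /=; assign_last v hv0; split=> //=.
    rewrite hM3; apply: low_aset => //.
    exact: leq_trans (leq_subr _ _) (low_aget _ _ _ _ lM).
  right; split; first by rewrite /upd /= hv0.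
  exists (set_lev s cur (lev s cur).-1); split=> //; last 2 first.
  - by move=> y; left.
  - by apply: leq_trans hpot _; rewrite /load; lia.
  by rewrite hM3; rewrite hl' in hfall htop *; case: eqP hfall.
have h0' : 0 < aget (ram st) 3 (cur * Ls + (lev s cur).+2).
  by rewrite lt0n; apply/eqP.
have [eF etl elab] := out_pick _ F s cur _ hr hlt hlab h0'.
set e := aget (ram st) 4 _ in eF etl elab.
have [e9 e10 e11] := edge_rep _ _ _ _ hr eF.
have [hI' hp1 hp2 hp3] := down_flip n D cap D2 F s cur e uF hI eF etl elab hlow.
rewrite /down_flip_cmd; assign e' he'; rewrite hb2 -/e in he'.
assign u hu'; rewrite he' e9 in hu'.
assign h hh; rewrite hcur in hh.
assign t hht; rewrite hu' in hht.
apply: wp_seq; apply: (@wp_detach _ _ n Ls _ _ e) => // x y.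
apply: wp_seq.
apply: (@wp_attach _ _ n Ls _ _ e cur (hd s e) (lev s cur)) => // x' y' /=.
assign_last v hv0; rewrite hu' in hv0.
split=> //=.
  by apply: (low_change _ F s) => //; [lia | apply: FX | apply: ltnW].
left; split; first by rewrite /upd.
exists (set_edge s e cur (hd s e) (lev s cur)), (hd s e); split=> //; last first.
- split=> //; rewrite /load hlow /=; case: ifP => _; first by lia.
  by move: hp2 => /=; lia.
- by apply: swapped_set; right; rewrite etl.
- by apply: rep_change => //; lia.
Qed.
End Body.

(** * Its loops *)

(** Applied afresh in every iteration, with the same [X], so that the exponent does not grow with
    the running time. *)
Lemma wp_exec c : exists2 a, 0 < a & forall X D w s Q,
  64 <= X -> bounded D X s -> defs D c -> X ^ a < 2 ^ w -> wp c s Q ->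
  exists t s', [/\ exec w c s t s', t <= cost_max c & Q s'].
Proof.
have [a a0 h] := runN_exec c; exists a => // X D w s Q hX hb.
case E: (defs D c) => [D'|//] _ hw hQ.
by have [_ [t ht he]] := h X D D' s w hX hb E hw; exists t, (runN c s).
Qed.

(* All the quantities that the program handles are at most [X]. *)
Definition fits (n E Tc D X : nat) : Prop :=
  [/\ 64 <= X, n * (Tc + 8) <= X, 2 * D <= X, 4 * Tc + 8 <= X & n < X /\ E <= X].

Lemma scaled_bounded n E Tc D X st : fits n E Tc D X -> low X (ram st) ->
  scaled n E Tc D st -> regs st 13 <= n -> regs st 14 <= 1 ->
  bounded [:: 0; 1; 2; 8; 9; 10; 11; 12; 13; 14] X st.
Proof.
move=> [h1 h2 h3 h4 [h5 h6]] hM [[r0 r1 r2] [r8 r9 r10 r11 r12]] r13 r14.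
split=> [i|m]; last exact: hM.
rewrite !inE; do 9 (case/orP => [/eqP->|]; first lia).
by move/eqP->; lia.
Qed.

Section Loops.
Variables n E Tc D X : nat.
Notation Ls := (Tc + 8).
Notation cap := (4 * Tc).
Notation rep' := (rep n D Ls).
Notation steady' := (steady n D cap).

(** The iterations are weighed against both measures at once. The successors account for the last
    iteration, which clears register 14 and need not lower either of them. *)
Definition up_inv F (s0 : conf n) cur0 (j : nat) (st : state) : Prop :=
  [/\ scaled n E Tc D st, low X (ram st) &
   (regs st 14 = 1 /\ exists s cur, [/\ regs st 13 = nat_of_ord cur,
      rep' (ram st) F s, inv_up n D cap F s cur, swapped s0 s &
      j + pot_up n D cap F s cur <= pot_up n D cap F s0 cur0 /\
      j + wc_up n D cap F s cur <= wc_up n D cap F s0 cur0]) \/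
   (regs st 14 = 0 /\ exists s, [/\ rep' (ram st) F s, steady' F s,
      swapped s0 s, j <= (wc_up n D cap F s0 cur0).+1 &
      j + pot n D cap F s <= (pot_up n D cap F s0 cur0 + 2 * D).+1])].

Definition down_inv F (s0 : conf n) cur0 (j : nat) (st : state) : Prop :=
  [/\ scaled n E Tc D st, low X (ram st) &
   (regs st 14 = 1 /\ exists s cur, [/\ regs st 13 = nat_of_ord cur,
      rep' (ram st) F s, inv_down n D cap F s cur, swapped s0 s &
      j + load n Tc D F s cur <= load n Tc D F s0 cur0 /\
      j + wc_down n D cap F s cur <= wc_down n D cap F s0 cur0]) \/
   (regs st 14 = 0 /\ exists s, [/\ rep' (ram st) F s, steady' F s,
      swapped s0 s, j <= (wc_down n D cap F s0 cur0).+1 &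
      j + pot n D cap F s <= (load n Tc D F s0 cur0 + 2 * D).+1])].
End Loops.

Lemma run_up : exists2 a, 0 < a & forall n E Tc D X w F (s : conf n) cur st,
  1 < D -> fits n E Tc D X -> X ^ a < 2 ^ w ->
  uniq F -> (forall e, e \in F -> e <= X) -> size F <= X ->
  scaled n E Tc D st -> low X (ram st) -> rep n D (Tc + 8) (ram st) F s ->
  inv_up n D (4 * Tc) F s cur -> regs st 13 = cur -> regs st 14 = 1 ->
  exists j t st' s', [/\ exec w (While ($14) up_body) st t st',
    t <= j.+1 * (cost_max up_body + 2), j <= (wc_up n D (4 * Tc) F s cur).+1,
    j + pot n D (4 * Tc) F s' <= (pot_up n D (4 * Tc) F s cur + 2 * D).+1 &
    [/\ low X (ram st'), rep n D (Tc + 8) (ram st') F s',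
        steady n D (4 * Tc) F s' & swapped s s']].
Proof.
have [a a0 hwp] := wp_exec up_body; exists a => //.
move=> n E Tc D X w F s cur st D2 hfit hw uF FX sF hs hM hr hI hcur hgo.
have [X64 hX1 hX2 hX3 [hX4 hX5]] := hfit.
have [|j st0 [hs1 hM1 hst] h0||j [t [st' [he [hs' hM' hI'] h14 ht]]]] :=
  while_exec (up_inv n E Tc D X F s cur)
    (wc_up n D (4 * Tc) F s cur).+1 (cost_max up_body) w ($14) up_body st.
- move=> j st1 [_ _ [[_ [s1 [c1 [_ _ _ _ [_ h]]]]]|[_ [s1 [_ _ _ h _]]]]] //.
  by lia.
- case: hst h0 => [[h14 [s1 [c1 [h13 hr1 hI1 hsw [hp hp']]]]]|[/= ->] //] _.
  have [||||t [st1 [he ht hp1]]] := hwp X [:: 0; 1; 2; 8; 9; 10; 11; 12; 13; 14]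
     w st0 (up_post n E Tc D X F s1 c1 st0) X64.
  + apply: scaled_bounded hfit hM1 hs1 _ _; rewrite ?h14 ?h13 //.
    exact: ltnW.
  + by [].
  + by [].
  + by apply: up_body_ok => //; lia.
  exists t, st1; split=> //.
  have [k1 k2 k3 [[k4 [s2 [c2 [k5 k6 k7 k8 [k9 k10]]]]]|[k4 [s2 [k5 k6 k7 k8]]]]] := hp1.
    split=> //; left; split=> //; exists s2, c2; split=> //; last by lia.
    exact: swapped_trans hsw k8.
  split=> //; right; split=> //; exists s2; split=> //; try lia.
  exact: swapped_trans hsw k7.
- split=> //; left; split=> //; exists s, cur; split=> //.
  exact: swapped_refl.
case: hI' => [[h _]|[_ [s' [k1 k2 k3 k4 k5]]]]; first by rewrite /= h in h14.
by exists j, t, st', s'.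
Qed.

Lemma run_down : exists2 a, 0 < a & forall n E Tc D X w F (s : conf n) cur st,
  1 < D -> fits n E Tc D X -> X ^ a < 2 ^ w ->
  uniq F -> (forall e, e \in F -> e <= X) -> size F <= X ->
  scaled n E Tc D st -> low X (ram st) -> rep n D (Tc + 8) (ram st) F s ->
  inv_down n D (4 * Tc) F s cur -> regs st 13 = cur -> regs st 14 = 1 ->
  exists j t st' s', [/\ exec w (While ($14) down_body) st t st',
    t <= j.+1 * (cost_max down_body + 2), j <= (wc_down n D (4 * Tc) F s cur).+1,
    j + pot n D (4 * Tc) F s' <= (load n Tc D F s cur + 2 * D).+1 &
    [/\ low X (ram st'), rep n D (Tc + 8) (ram st') F s',
        steady n D (4 * Tc) F s' & swapped s s']].
Proof.
have [a a0 hwp] := wp_exec down_body; exists a => //.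
move=> n E Tc D X w F s cur st D2 hfit hw uF FX sF hs hM hr hI hcur hgo.
have [X64 hX1 hX2 hX3 [hX4 hX5]] := hfit.
have [|j st0 [hs1 hM1 hst] h0||j [t [st' [he [hs' hM' hI'] h14 ht]]]] :=
  while_exec (down_inv n E Tc D X F s cur)
    (wc_down n D (4 * Tc) F s cur).+1 (cost_max down_body) w ($14) down_body st.
- move=> j st1 [_ _ [[_ [s1 [c1 [_ _ _ _ [_ h]]]]]|[_ [s1 [_ _ _ h _]]]]] //.
  by lia.
- case: hst h0 => [[h14 [s1 [c1 [h13 hr1 hI1 hsw [hp hp']]]]]|[/= ->] //] _.
  have [||||t [st1 [he ht hp1]]] := hwp X [:: 0; 1; 2; 8; 9; 10; 11; 12; 13; 14]
     w st0 (down_post n E Tc D X F s1 c1 st0) X64.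
  + apply: scaled_bounded hfit hM1 hs1 _ _; rewrite ?h14 ?h13 //.
    exact: ltnW.
  + by [].
  + by [].
  + by apply: down_body_ok => //; lia.
  exists t, st1; split=> //.
  have [k1 k2 k3 [[k4 [s2 [c2 [k5 k6 k7 k8 [k9 k10]]]]]|[k4 [s2 [k5 k6 k7 k8]]]]] := hp1.
    split=> //; left; split=> //; exists s2, c2; split=> //; last by lia.
    exact: swapped_trans hsw k8.
  split=> //; right; split=> //; exists s2; split=> //; try lia.
  exact: swapped_trans hsw k7.
- split=> //; left; split=> //; exists s, cur; split=> //.
  exact: swapped_refl.
case: hI' => [[h _]|[_ [s' [k1 k2 k3 k4 k5]]]]; first by rewrite /= h in h14.
by exists j, t, st', s'.
Qed.

(** The successor makes [n < 2 ^ bits n] strict, as [compare_levels] requires, and keeps [scale]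
    positive for [n = 1]. *)
Definition bits (n : nat) : nat := (up_log 2 n).+1.

(** The factor 200 serves [t * (10 * E) <= D] in [result_density]: there [t <= 19 * (E * bits n)],
    so 190 is called for. *)
Definition scale (n E : nat) : nat := 50 * 4 * bits n * E * E.

Lemma bitsP n : n < 2 ^ bits n.
Proof.
have := @up_logP 2 n isT; rewrite /bits expnS; have := expn_gt0 2 (up_log 2 n).
by lia.
Qed.

Lemma bits_leq n : bits n <= n.+1.
Proof. by rewrite ltnS; apply: up_log_min => //; apply/ltnW/ltn_expl. Qed.

Lemma run_scale : exists2 a, 0 < a & exists K, forall n E Tc X w st,
  fits n E Tc (scale n E) X -> 0 < E -> X ^ a < 2 ^ w -> low X (ram st) ->
  regs st 0 = n -> regs st 1 = E -> regs st 2 = Tc ->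
  exists t st', [/\ exec w scale_cmd st t st', t <= K * bits n,
    scaled n E Tc (scale n E) st', regs st' 14 = 1 &
    [/\ ram st' = ram st, outs st' = outs st, regs st' 3 = regs st 3,
        regs st' 4 = regs st 4 & regs st' 5 = regs st 5]].
Proof.
have [a1 a10 h1] := wp_exec (6 <~ #1 ;; 7 <~ #1).
have [a2 a20 h2] := wp_exec double_cmd.
have [a3 a30 h3] := wp_exec constants_cmd.
exists (a1 + a2 + a3); first lia.
exists (cost_max (6 <~ #1 ;; 7 <~ #1) + (cost_max double_cmd + 4) * 2 +
  cost_max constants_cmd).
move=> n E Tc X w st hfit E0 hw hM r0 r1 r2.
have [X64 hX1 hX2 hX3 [hX4 hX5]] := hfit.
have le1 : X ^ a1 <= X ^ (a1 + a2 + a3) by apply: leq_expS => //; lia.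
have le2 : X ^ a2 <= X ^ (a1 + a2 + a3) by apply: leq_expS => //; lia.
have le3 : X ^ a3 <= X ^ (a1 + a2 + a3) by apply: leq_expS => //; lia.
have w2 : 2 < 2 ^ w.
  by apply: leq_ltn_trans hw; have := leq_expS X 1 (a1 + a2 + a3) X64; lia.
pose keep (st' : state) := [/\ ram st' = ram st, outs st' = outs st &
  forall i, i < 6 -> regs st' i = regs st i].
have [||||t1 [st1 [e1 c1 q1]]] := h1 X [:: 0] w st
  (fun st' => keep st' /\ regs st' 6 = 1 /\ regs st' 7 = 1) X64.
- by split=> // i; rewrite inE => /eqP->; lia.
- by [].
- by lia.
- assign x hx; assign_last y hy; split; last by rewrite /upd.
  by split=> // i hi; rewrite /= /upd; repeat (rewrite ifN; last lia).
have [|j st2 [[k1 k2 k3] k4 k5 k6] hg||j [t2 [st2 [e2 [[k1 k2 k3] k4 k5 k6] hg c2]]]] :=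
  while_exec (fun j st' => [/\ keep st', regs st' 6 = 2 ^ j,
    regs st' 7 = j.+1 & j <= up_log 2 n]) (up_log 2 n) (cost_max double_cmd) w
    ($6 <' $0) double_cmd st1.
- by move=> j st' [].
- have hj : 2 ^ j < n.
    by move: hg; rewrite /= k4 k3 // r0; case: ltnP => //; rewrite mod0n.
  have hj' : j < up_log 2 n.
    rewrite ltnNge; apply/negP => hle; have := @up_logP 2 n isT.
    by have := leq_exp2l (up_log 2 n) j (isT : 1 < 2); rewrite hle; lia.
  have [||||t2 [st3 [e2 c2 q2]]] := h2 X [:: 0; 6; 7] w st2 (fun st' =>
    keep st' /\ regs st' 6 = 2 ^ j.+1 /\ regs st' 7 = j.+2) X64.
  + split=> [i|m]; last by rewrite k1.
    rewrite !inE => /or3P[] /eqP->; [by rewrite k3 //; lia | by rewrite k4; lia |].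
    by rewrite k5; have := bits_leq n; rewrite /bits; lia.
  + by [].
  + by lia.
  + assign x hx; rewrite k4 in hx; assign_last y hy; rewrite k5 in hy.
    split; last by rewrite /upd /= hx hy expnS; lia.
    split=> // i hi; rewrite /= /upd; repeat (rewrite ifN; last lia).
    by rewrite k3.
  by exists t2, st3; case: q2 => q3 [q4 q5].
- by case: q1 => q3 [q4 q5]; split.
have ej : j = up_log 2 n.
  apply/eqP; rewrite eqn_leq k6; apply: up_log_min => //; rewrite leqNgt.
  apply/negP => hj; move: hg; rewrite /= k4 k3 // r0 hj.
  by rewrite modn_small //; lia.
have [||||t3 [st3 [e3 c3 [q3 q4 q5]]]] := h3 X [:: 0; 1; 2; 7] w st2
  (fun st' => [/\ keep st', scaled n E Tc (scale n E) st' & regs st' 14 = 1]) X64.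
- split=> [i|m]; last by rewrite k1.
  rewrite !inE => /or4P[] /eqP->; try by rewrite k3 //; lia.
  by rewrite k5; have := bits_leq n; rewrite /bits ej; lia.
- by [].
- by lia.
- rewrite /constants_cmd; assign x8 h8; rewrite k5 k3 // r1 ej in h8.
  assign x9 h9; assign x10 h10; rewrite k3 // r2 in h10.
  assign x11 h11; rewrite k3 // r0 h10 in h11.
  assign x12 h12; rewrite k3 // r2 in h12; assign_last x14 h14.
  have e8 : x8 = scale n E by rewrite h8.
  split; last by rewrite /upd.
    by split=> // i hi; rewrite /= /upd; repeat (rewrite ifN; last lia); apply: k3.
  split; split; rewrite /= /upd /= ?k3 //.
  by rewrite h9 e8; lia.
exists (t1 + (t2 + t3)), st3; case: q3 => m1 m2 m3; split=> //.
- exact: ExecSeq e1 (ExecSeq e2 e3).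
- move: c1 c2 c3; rewrite ej /bits.
  by move: (cost_max _) (cost_max _) (cost_max _) => y1 y2 y3 /=; nia.
- by rewrite !m3.
Qed.

Lemma scale_gt1 n E : 0 < E -> 1 < scale n E.
Proof. by move=> h; rewrite /scale /bits; nia. Qed.

Lemma wc_up_leq n D cap F (s : conf n) cur : 1 < D -> inv_up n D cap F s cur ->
  wc_up n D cap F s cur <= flev D cap cap * (2 * D).+1 + 2 * D.
Proof.
move=> D2 [_ _ [h1 h2 h3 h4]]; rewrite /wc_up leq_add ?leq_mul2r ?flev_max ?orbT //.
rewrite /slack; case: ifP => // /h4; rewrite prednK; last by lia.
have : indeg F s cur - thr D (lev s cur).+1 <=
    ((indeg F s cur).-1 - thr D (lev s cur).+1).+1 by lia.
by nia.
Qed.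

Lemma wc_down_leq n D cap F (s : conf n) cur : 1 < D ->
  inv_down n D cap F s cur ->
  wc_down n D cap F s cur <= flev D cap cap * (2 * D).+1 + 2 * D.
Proof.
move=> D2 [_ _ [h1 h2 h3 h4]]; rewrite /wc_down.
apply: leq_add; first by rewrite leq_mul2r leq_subr orbT.
by nia.
Qed.

(** * A single update *)

Lemma call_insert : exists2 a, 0 < a & exists K, forall n E Tc X w F
    (s : conf n) M e (u v : 'I_n), let D := scale n E in let cap := 4 * Tc in
  fits n E Tc D X -> 0 < E -> X ^ a < 2 ^ w ->
  uniq F -> e \notin F -> (forall x, x \in e :: F -> x <= X) -> size F < X ->
  low X M -> rep n D (Tc + 8) M F s -> steady n D cap F s ->
  exists j t M' s' h h', [/\
    call w (insert_cmd program) [:: n; E; Tc; e; val u; val v] M t M',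
    t <= K * (bits n + j.+1),
    ((h = u /\ h' = v) \/ (h = v /\ h' = u)) /\ lev s h <= lev s h',
    [/\ low X M', rep n D (Tc + 8) M' (e :: F) s', steady n D cap (e :: F) s' &
        swapped (set_edge s e h h' (lev s h)) s'] &
    j + pot n D cap (e :: F) s' <=
      (pot n D cap F s + flev D cap (indeg F s h) + 2 * D).+1 /\
    j <= (flev D cap cap * (2 * D).+1 + 2 * D).+1].
Proof.
have [a1 a10 [K1 h1]] := run_scale.
have [a2 a20 h2] := wp_exec insert_edge_cmd.
have [a3 a30 h3] := run_up.
exists (a1 + a2 + a3); first lia.
exists (K1 + cost_max insert_edge_cmd + (cost_max up_body + 2)).
move=> n E Tc X w F s M e u v D cap hfit E0 hw uF eF FX sF hM hr hI.
have D2 : 1 < D := scale_gt1 n E E0.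
have [X64 hX1 hX2 hX3 [hX4 hX5]] := hfit.
have le1 : X ^ a1 <= X ^ (a1 + a2 + a3) by apply: leq_expS => //; lia.
have le2 : X ^ a2 <= X ^ (a1 + a2 + a3) by apply: leq_expS => //; lia.
have le3 : X ^ a3 <= X ^ (a1 + a2 + a3) by apply: leq_expS => //; lia.
set st := call_state [:: n; E; Tc; e; val u; val v] M.
have [|t1 [st1 [e1 c1 hs1 r14 [m1 o1 r3 r4 r5]]]] :=
  h1 n E Tc X w st hfit E0 _ hM erefl erefl erefl; first by lia.
rewrite /st /= in m1 r3 r4 r5.
pose h := if lev s u < lev s v then u else v.
pose h' := if lev s u < lev s v then v else u.
have hh : (h = u /\ h' = v) \/ (h = v /\ h' = u).
  by rewrite /h /h'; case: ifP; [left | right].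
have hle : lev s h <= lev s h' by rewrite /h /h'; case: leqP => //; lia.
have hlT : lev s h <= Tc.
  have [_ _ k _] := hI.2 h; have := thr_ge D (lev s h).
  by rewrite /cap in k; lia.
have [hI' hp] := insert_up n D cap D2 F s e h h' eF hle hI.
have [[r0 r1 r2] [r8 r9 r10 r11 r12]] := hs1.
have [||||t2 [st2 [e2 c2 [q1 q2 q3 q4 q5]]]] := h2 X [:: 3; 4; 5; 8; 9; 10; 11; 12; 14]
    w st1 (fun st' => [/\ scaled n E Tc D st', regs st' 14 = 1,
      regs st' 13 = h, low X (ram st') & rep n D (Tc + 8) (ram st') (e :: F)
        (set_edge s e h h' (lev s h))]) X64.
- split=> [i|m]; last by rewrite m1; apply: hM.
  have eX : e <= X by apply: FX; rewrite mem_head.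
  have uX : val u <= X by have := ltn_ord u; rewrite /=; lia.
  have vX : val v <= X by have := ltn_ord v; rewrite /=; lia.
  rewrite !inE; do 8 (case/orP => [/eqP->|]; first by
    rewrite ?r3 ?r4 ?r5 ?r8 ?r9 ?r10 ?r11 ?r12 //; lia).
  by move/eqP->; rewrite r14; lia.
- by [].
- by lia.
- have lv (w' : 'I_n) : aget (ram st1) 12 w' = lev s w'.
    by rewrite m1 (lev_rep _ _ _ _ _ _ _ hr).
  rewrite /insert_edge_cmd; assign e0 he0; rewrite r3 in he0; apply: wp_seq.
  have H rg : (forall i, i < 15 -> rg i = regs st1 i) -> rg 19 = e ->
      rg 24 = h -> rg 25 = h' ->
    wp (15 <~ arr 12 ($24) ;; attach_cmd ;; 13 <~ $24)
      (State rg (ram st1) (outs st1)) (fun st' => [/\ scaled n E Tc D st',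
        regs st' 14 = 1, regs st' 13 = h, low X (ram st') &
        rep n D (Tc + 8) (ram st') (e :: F) (set_edge s e h h' (lev s h))]).
    move=> k1 k2 k3 k4; assign l hl; rewrite k3 lv in hl; apply: wp_seq.
    apply: (@wp_attach _ _ n (Tc + 8) _ _ e h h' l) => //=.
    + by rewrite /upd /= k1.
    + by rewrite /upd /= k1.
    move=> x y /=; assign_last v0 hv0; rewrite k3 in hv0.
    split=> //=.
    + by apply: scaled_ext hs1 => i hi; rewrite /= /upd;
        repeat (rewrite ifN; last lia); rewrite k1; lia.
    + by rewrite /upd /= k1.
    + rewrite m1 hl; apply: (low_attach n D (Tc + 8) X M F s) => //; try lia.
      by apply: FX; rewrite mem_head.
    + by rewrite m1 hl; apply: rep_attach => //; lia.
  branch hlt; rewrite r4 r5 !lv in hlt.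
    have {}hlt : lev s u < lev s v by lia.
    assign hv k1; assign_last tv k2; rewrite r4 in k1; rewrite r5 in k2.
    apply: H; rewrite /upd /= ?k1 ?k2 /h /h' ?hlt //.
    by move=> i hi; repeat (rewrite ifN; last lia).
  have {}hlt : (lev s u < lev s v) = false by lia.
  assign hv k1; assign_last tv k2; rewrite r5 in k1; rewrite r4 in k2.
  apply: H; rewrite /upd /= ?k1 ?k2 /h /h' ?hlt //.
  by move=> i hi; repeat (rewrite ifN; last lia).
have uF' : uniq (e :: F) by rewrite /= eF.
have [|j [t3 [st3 [s' [e3 c3 w3 p3 [l4 l5 l6 l7]]]]]] :=
  h3 n E Tc D X w (e :: F) _ h st2 D2 hfit _ uF' FX sF q1 q4 q5 hI' q3 q2.
  by lia.
have hwc := wc_up_leq n D cap _ _ h D2 hI'.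
exists j, (t1 + (t2 + t3)), (ram st3), s', h, h'; split=> //.
- by exists st3 => //; apply: ExecSeq e1 (ExecSeq e2 e3).
- move: c1 c2 c3; move: (cost_max _) (cost_max _) => y1 y2; rewrite /bits; nia.
- by rewrite /cap in hp w3 p3 hwc *; lia.
Qed.

Lemma call_delete : exists2 a, 0 < a & exists K, forall n E Tc X w F
    (s : conf n) M e, let D := scale n E in let cap := 4 * Tc in
  fits n E Tc D X -> 0 < E -> X ^ a < 2 ^ w ->
  uniq F -> e \in F -> (forall x, x \in F -> x <= X) -> size F <= X ->
  low X M -> rep n D (Tc + 8) M F s -> steady n D cap F s ->
  exists j t M' s', [/\
    call w (delete_cmd program) [:: n; E; Tc; e] M t M',
    t <= K * (bits n + j.+1),
    [/\ low X M', rep n D (Tc + 8) M' (rem e F) s',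
        steady n D cap (rem e F) s' & swapped s s'],
    j + pot n D cap (rem e F) s' + flev D cap (indeg F s (hd s e)).-1 <=
      (pot n D cap F s + 4 * D).+1 &
    j <= (flev D cap cap * (2 * D).+1 + 2 * D).+1].
Proof.
have [a1 a10 [K1 h1]] := run_scale.
have [a2 a20 h2] := wp_exec delete_edge_cmd.
have [a3 a30 h3] := run_down.
exists (a1 + a2 + a3); first lia.
exists (K1 + cost_max delete_edge_cmd + (cost_max down_body + 2)).
move=> n E Tc X w F s M e D cap hfit E0 hw uF eF FX sF hM hr hI.
have D2 : 1 < D := scale_gt1 n E E0.
have [X64 hX1 hX2 hX3 [hX4 hX5]] := hfit.
have le1 : X ^ a1 <= X ^ (a1 + a2 + a3) by apply: leq_expS => //; lia.
have le2 : X ^ a2 <= X ^ (a1 + a2 + a3) by apply: leq_expS => //; lia.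
have le3 : X ^ a3 <= X ^ (a1 + a2 + a3) by apply: leq_expS => //; lia.
set st := call_state [:: n; E; Tc; e] M.
have [|t1 [st1 [e1 c1 hs1 r14 [m1 o1 r3 r4 r5]]]] :=
  h1 n E Tc X w st hfit E0 _ hM erefl erefl erefl; first by lia.
rewrite /st /= in m1 r3.
set h := hd s e.
have [hI' hp] := delete_down n D cap D2 F s e eF hI.
have [[r0 r1 r2] [r8 r9 r10 r11 r12]] := hs1.
have eX : e <= X by apply: FX.
have [e9 _ _] := edge_rep _ _ _ _ _ _ _ hr eF.
have hdet := rep_detach n D (Tc + 8) M F s e uF eF hr.
have [||||t2 [st2 [e2 c2 [q1 q2 q3 q4 q5]]]] := h2 X [:: 3; 10; 11]
    w st1 (fun st' => [/\ scaled n E Tc D st', regs st' 14 = 1,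
      regs st' 13 = h, low X (ram st') &
      rep n D (Tc + 8) (ram st') (rem e F) s]) X64.
- split=> [i|m]; last by rewrite m1; apply: hM.
  by rewrite !inE => /or3P[] /eqP->; rewrite ?r3 ?r10 ?r11; lia.
- by [].
- by lia.
- rewrite /delete_edge_cmd; assign e0 he0; rewrite r3 in he0; apply: wp_seq.
  apply: (@wp_detach _ _ n (Tc + 8) _ _ e) => // x y /=.
  assign_last v hv; rewrite he0 m1 /detach bag_del_aget // in hv.
  rewrite bag_del_aget // e9 in hv.
  split=> //=; rewrite m1 //.
  exact: low_detach.
have [|||j [t3 [st3 [s' [e3 c3 w3 p3 [l4 l5 l6 l7]]]]]] :=
  h3 n E Tc D X w (rem e F) s h st2 D2 hfit _ (rem_uniq _ uF) _ _ q1 q4 q5 hI' q3 q2.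
- by lia.
- by move=> x /mem_rem; apply: FX.
- by rewrite size_rem //; apply: leq_trans (leq_pred _) sF.
have hwc := wc_down_leq n D cap _ _ h D2 hI'.
have hld := load_leq n Tc D D2 _ _ h hI'.
exists j, (t1 + (t2 + t3)), (ram st3), s'; split=> //.
- by exists st3 => //; apply: ExecSeq e1 (ExecSeq e2 e3).
- move: c1 c2 c3; move: (cost_max _) (cost_max _) => y1 y2; rewrite /bits; nia.
- by rewrite /cap in hp w3 p3 hwc hld *; rewrite -/h in hp *; lia.
- by rewrite /cap in w3 hwc *; lia.
Qed.

(** * Sequences of updates *)

Lemma evolves_names n (us : seq (update n)) G : evolves us G ->
  simple_names n G /\ (forall e, e \in names n G -> e < size us).
Proof.
elim=> [|us' G' u v _ [[uG hn] hs] uv|us' G' e _ [[uG hn] hs] _].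
- by split.
- split; last first.
    by move=> e; rewrite inE size_rcons => /predU1P[->//|/hs]; apply: leqW.
  split=> [|x].
    by rewrite /= uG andbT; apply/negP => /hs; rewrite ltnn.
  by rewrite inE => /predU1P[->|/hn].
split; last first.
  move=> x /mapP[y]; rewrite mem_filter size_rcons => /andP[_ yG] ->.
  by have := hs _ (map_f _ yG); lia.
split=> [|x]; last by rewrite mem_filter => /andP[_ /hn].
exact: subseq_uniq (map_subseq _ (filter_subseq _ _)) uG.
Qed.

Lemma filter_names n (G : multigraph n) x : simple_names n G -> x \in G ->
  [seq y <- G | y.1 != x.1] = rem x G /\
  names n (rem x G) = rem x.1 (names n G).
Proof.
move=> sG xG; have [uG _] := sG.
have uG' : uniq G by apply: map_uniq uG.
have e1 : [seq y <- G | y.1 != x.1] = rem x G.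
  rewrite rem_filter //; apply: eq_in_filter => y yG /=; congr (~~ _).
  by apply/eqP/eqP => [h|->//]; apply: name_inj sG yG xG h.
split=> //; rewrite -e1 rem_filter // /names filter_map.
by congr map; apply: eq_filter.
Qed.

Lemma size_names n (us : seq (update n)) G : evolves us G -> size G <= size us.
Proof.
elim=> [//|us' G' u v _ h _|us' G' e _ h _]; rewrite size_rcons //=.
by apply: leq_trans (leqW h); rewrite size_filter count_size.
Qed.

(** [i] counts the loop iterations so far. An update costs [4 * bits n + D + 9] for the difference
    of the two levels and at most [4 * D + 1] for slacks and the last iteration. The optimum [h]
    occurs in the analysis only and may change completely from one update to the next. *)
Lemma run_all : exists2 a, 0 < a & exists K, forall n E Tc X w,
  let D := scale n E in let cap := 4 * Tc in
  fits n E Tc D X -> 0 < E -> 0 < n -> X ^ a < 2 ^ w ->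
  forall (us : seq (update n)) G, evolves us G -> size us < X ->
  exists ts M (s : conf n) h i, [/\
    runs w program [:: n; E; Tc] us ts M,
    sumn ts <= K * (size us * (bits n).+1 + i) /\
      i + pot n D cap (names n G) s <=
      cost n D cap G h + (4 * bits n + 5 * D + 12) * size us,
    forall t, t \in ts -> t <= K * (bits n + flev D cap cap * (2 * D).+1 + 2 * D).+2,
    optimal n D cap G h &
    [/\ low X M, rep n D (Tc + 8) M (names n G) s,
        steady n D cap (names n G) s & oriented n G s]].
Proof.
have [a1 a10 [K1 h1]] := call_insert.
have [a2 a20 [K2 h2]] := call_delete.
exists (a1 + a2); first lia.
exists (K1 + K2) => n E Tc X w D cap hfit E0 n0 hw us G hG.
have D2 : 1 < D := scale_gt1 n E E0.
have [X64 hX1 hX2 hX3 [hX4 hX5]] := hfit.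
have le1 : X ^ a1 <= X ^ (a1 + a2) by apply: leq_expS => //; lia.
have le2 : X ^ a2 <= X ^ (a1 + a2) by apply: leq_expS => //; lia.
have hJ := bitsP n.
elim: hG => [_|us' G' u v ev IH uv|us' G' e ev IH eG].
- pose v0 : 'I_n := Ordinal n0.
  pose s0 := Conf (fun _ => v0) (fun _ => v0) (fun _ => 0) (fun _ : 'I_n => 0).
  have B0 f : bags f (n * (Tc + 8)) (fun _ => 0) (fun _ => None) by split.
  exists [::], (fun _ => 0), s0, (fun _ => v0), 0; split=> //.
  + exact: RunsNil.
  + split=> //; rewrite muln0 addn0 add0n /pot /phi /cost.
    rewrite [X in _ + X]big1 ?addn0 // => v _.
    rewrite /slack /indeg /= thrS; case: ifP => // _.
    by rewrite addn4 subSS sub0n muln0.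
  split=> //.
  + split.
      by split=> //; apply: B0.
    * split=> //; apply: bags_ext (B0 6) => // x.
      by rewrite /level_bag; case: insub.
    split=> //; last by left.
    by move=> i; rewrite /aget leqn0 => /eqP->.
  split=> // v; rewrite /vertex_ok; split=> //= _.
  by rewrite /indeg /=; lia.
- rewrite size_rcons => hN.
  have [ts [M [s [h0 [i [hr [ht hi] hts ho [hM hrep hst hor]]]]]]] := IH (ltnW hN).
  have [sG hs] := evolves_names _ _ _ ev; have [uG hn] := sG.
  have eG : size us' \notin names n G' by apply/negP => /hs; rewrite ltnn.
  pose x := (size us', (u, v)).
  have evx : evolves (rcons us' (Insert u v)) (x :: G') by apply: EvolvesInsert.
  have [sGx hsx] := evolves_names _ _ _ evx.
  have [|||j [t [M' [s' [h [h' [hc hct [hh hle] [q1 q2 q3 q4] [q5 q6]]]]]]]] :=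
    h1 n E Tc X w (names n G') s M (size us') u v hfit E0 _ uG eG _ _ hM hrep hst.
  + by lia.
  + move=> y; rewrite -[_ :: _]/(names n (x :: G')) => /hsx.
    by rewrite size_rcons; lia.
  + by rewrite size_map; have := size_names _ _ _ ev; lia.
  have hor' : oriented n (x :: G') s'.
    move=> y; rewrite inE => yx.
    have {}hh : (hd (set_edge s (size us') h h' (lev s h)) y.1 = y.2.1 /\
        tl (set_edge s (size us') h h' (lev s h)) y.1 = y.2.2) \/
      (hd (set_edge s (size us') h h' (lev s h)) y.1 = y.2.2 /\
        tl (set_edge s (size us') h h' (lev s h)) y.1 = y.2.1).
      case/predU1P: yx => [->|yG]; rewrite /= /fupd.
        by rewrite eqxx /=; case: hh => -[-> ->]; auto.
      case: eqP => [e|_]; last exact: hor.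
      by rewrite -e map_f in eG.
    by case: (q4 y.1) => -[-> ->]; case: hh => -[-> ->]; auto.
  have [h2' ho'] := optimal_exists n D cap _ _ (oriented_orientation _ _ _ hor').
  have k1 := optimal_insert n D cap G' x h0 h2' ho ho'.
  have hle' : lev s h <= lev s (h2' x.1).
    have [hx _] := ho'; case: (hx x (mem_head _ _)) => ->; rewrite /x /=;
    by case: hh => -[e1 e2]; rewrite e1 e2 in hle *.
  have k2 := insert_price n D cap D2 (bits n) hJ G' s x h2' h sGx hor hst ho' hle'.
  exists (rcons ts t), M', s', h2', (i + j); split=> //.
  + by apply: RunsRcons hr _; exact: hc.
  + rewrite sumn_rcons; split; first by rewrite /D in hct *; nia.
    rewrite -/x -[names n (x :: G')]/(size us' :: names n G').
    move: hi q5 k1 k2; rewrite -/D -/cap mulnS.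
    set p1 := pot _ _ _ _ s; set p2 := pot _ _ _ _ s'; set c1 := cost _ _ _ _ h0.
    set c2 := cost _ _ _ _ h2'; set f1 := flev _ _ (indeg _ _ _).
    set f2 := flev _ _ _.-1; move: p1 p2 c1 c2 f1 f2 => p1 p2 c1 c2 f1 f2.
    lia.
  + move=> t'; rewrite mem_rcons inE => /predU1P[->|/hts //].
    rewrite -/D -/cap in q6; apply: leq_trans hct _.
    by apply: leq_mul; [exact: leq_addr | lia].
- rewrite size_rcons => hN.
  have [ts [M [s [h0 [i [hr [ht hi] hts ho [hM hrep hst hor]]]]]]] := IH (ltnW hN).
  have [sG hs] := evolves_names _ _ _ ev; have [uG hn] := sG.
  have [x xG ex] := mapP eG.
  have [f1 f2] := filter_names _ _ _ sG xG.
  rewrite ex f1.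
  have [|||j [t [M' [s' [hc hct [q1 q2 q3 q4] q5 q6]]]]] :=
    h2 n E Tc X w (names n G') s M e hfit E0 _ uG eG _ _ hM hrep hst.
  + by lia.
  + by move=> y /hs; lia.
  + by rewrite size_map; have := size_names _ _ _ ev; lia.
  have hor' : oriented n (rem x G') s'.
    move=> y /mem_rem /hor.
    by case: (q4 y.1) => -[-> ->]; case=> -[-> ->]; auto.
  have [h2' ho'] := optimal_exists n D cap _ _ (oriented_orientation _ _ _ hor').
  have xv : x.2.1 = hd s x.1 \/ x.2.2 = hd s x.1.
    by case: (hor x xG) => -[-> _]; auto.
  have k1 := optimal_delete n D cap G' x h0 h2' _ sG xG ho ho' xv.
  have k2 := delete_price n D cap D2 (bits n) hJ G' s x h2' sG hor hst xG ho'.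
  rewrite ex -f2 in q2 q3 q5.
  exists (rcons ts t), M', s', h2', (i + j); split=> //.
  + by rewrite -ex; apply: RunsRcons hr _; exact: hc.
  + rewrite sumn_rcons; split; first by rewrite /D in hct *; nia.
    move: hi q5 k1 k2; rewrite -/D -/cap mulnS.
    set p1 := pot _ _ _ _ s; set p2 := pot _ _ _ _ s'; set c1 := cost _ _ _ _ h0.
    set c2 := cost _ _ _ _ h2'; set f0 := flev _ _ (indegree _ _ _).
    set f3 := flev _ _ _.-1; move: p1 p2 c1 c2 f0 f3 => p1 p2 c1 c2 f0 f3.
    lia.
  + move=> t'; rewrite mem_rcons inE => /predU1P[->|/hts //].
    rewrite -/D -/cap in q6; apply: leq_trans hct _.
    by apply: leq_mul; [exact: leq_addl | lia].
Qed.

(** * The list of the vertices of a dense subgraph *)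

Lemma wp_output (s : state) (Q : state -> Prop) e :
  Q (State (regs s) (ram s) (rcons (outs s) (evalN s e))) -> wp (Output e) s Q.
Proof. by []. Qed.

Definition above {n} (s : conf n) (l : nat) : {set 'I_n} := [set v | l < lev s v].

(** With [far_size], the two outcomes of the stopping test of [list_body], freed of the
    subtraction. *)
Lemma close_size m a b : b <= a -> (a - b) * m <= b -> a * m <= b * m.+1.
Proof. by move=> hba h; rewrite -{1}(subnK hba) mulnDl mulnS leq_add2r. Qed.

Lemma far_size m a b : b < (a - b) * m -> b < a /\ b * m.+1 <= a * m.
Proof.
move=> h; have hba : b < a by rewrite ltnNge -subn_eq0; case: (a - b) h.
split=> //; rewrite -[X in _ <= X * _](subnK (ltnW hba)) mulnDl mulnS leq_add2r.
exact: ltnW.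
Qed.

Section Query.
Variables n E Tc D X : nat.
Variables (M : memory) (F : seq nat) (s : conf n).
Notation Ls := (Tc + 8).
Notation NB := (n * Ls).
Notation m := (8 * E).
Hypotheses (X64 : 64 <= X) (E0 : 0 < E) (hNB : NB <= X) (hn : n < X) (hE : E <= X)
  (hTc : Tc + 8 <= X).
Hypotheses (hM : low X M) (hr : rep n D Ls M F s) (hT : forall v, lev s v <= Tc).
Hypothesis n0 : 0 < n.
Notation top := (aget M 14 0).

Definition ids (A : {set 'I_n}) : seq nat := [seq nat_of_ord v | v in A].

Lemma ids_uniq A : uniq (ids A).
Proof. by rewrite map_inj_uniq ?enum_uniq //; apply: val_inj. Qed.

Lemma mem_ids A v : (nat_of_ord v \in ids A) = (v \in A).
Proof. by rewrite mem_map ?mem_enum //; apply: val_inj. Qed.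

Lemma size_ids A : size (ids A) = #|A|.
Proof. by rewrite size_map -cardE. Qed.

Lemma ids_lt A x : x \in ids A -> x < n.
Proof. by case/mapP => v _ ->. Qed.

Lemma eq_ids (A : {set 'I_n}) (t : seq nat) : uniq t -> (forall x, x \in t -> x < n) ->
  (forall v : 'I_n, (nat_of_ord v \in t) = (v \in A)) -> perm_eq t (ids A).
Proof.
move=> ut ht hA; apply: uniq_perm => // [|x]; first exact: ids_uniq.
case: (ltnP x n) => hx; first by have := hA (Ordinal hx); rewrite -mem_ids.
by apply/idP/idP => [/ht|/ids_lt]; rewrite ltnNge hx.
Qed.

Notation elems l := (bag_elems 6 NB M l).

Lemma lt_NB l : l <= Tc -> l < NB.
Proof. by move=> h; nia. Qed.

Lemma top_leq : top <= Tc.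
Proof. by case: hr => _ _ [_ _ [->//|[v <-]]]. Qed.

Lemma mem_elems l (v : 'I_n) : 0 < l -> l <= Tc ->
  (nat_of_ord v \in elems l) = (lev s v == l).
Proof.
move=> l0 hl; have [_ [hb _] _] := hr.
rewrite (mem_bag_elems _ _ _ _ _ _ hb (lt_NB _ hl)) /level_bag valK.
by case: ifPn => // /negPn/eqP ->; rewrite [RHS]ltn_eqF.
Qed.

Lemma elems_lt l x : l <= Tc -> x \in elems l -> x < n.
Proof.
move=> hl; have [_ [hb _] _] := hr.
rewrite (mem_bag_elems _ _ _ _ _ _ hb (lt_NB _ hl)) /level_bag.
by case: insubP => // v hv _ _.
Qed.

Lemma elems_uniq l : l <= Tc -> uniq (elems l).
Proof.
by move=> hl; have [_ [hb _] _] := hr; apply: bag_elems_uniq hb (lt_NB _ hl).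
Qed.

Lemma above_elems l : 0 < l -> l <= Tc ->
  perm_eq (ids (above s l) ++ elems l) (ids (above s l.-1)).
Proof.
move=> l0 hl; apply: eq_ids => [|x|v].
- rewrite cat_uniq ids_uniq elems_uniq // andbT /=; apply/hasPn => x hx.
  have hxn := elems_lt _ _ hl hx; pose v := Ordinal hxn.
  have : nat_of_ord v \in elems l by [].
  rewrite mem_elems // => /eqP hv; apply/negP => /=.
  by rewrite -[x]/(nat_of_ord v) mem_ids inE hv ltnn.
- by rewrite mem_cat => /orP[/ids_lt//|/elems_lt]; apply.
- by rewrite mem_cat mem_ids mem_elems // !inE; case: ltngtP => h; lia.
Qed.

(* Only the levels with an index of the form [i] below have been compared with
   the second next one; each of the [g] comparisons found a set larger by a
   factor more than [1 + 1 / m]. *)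
Definition groups (i old : nat) : Prop :=
  exists g, [/\ top = i + 2 * g, g < old & m.+1 ^ g <= old * m ^ g].

(** As [above] is strict, the sets compared consist of the levels from [i] on and from [i - 2] on.
    For [i <= 2] the list reaches level 0 and contains all vertices. *)
Definition result (A : {set 'I_n}) : Prop :=
  exists i g, [/\ top = i + 2 * g, m.+1 ^ g <= n * m ^ g &
    (i <= 2 /\ A = setT) \/
    [/\ 2 < i, A = above s i.-2.-1 & #|A| * m <= #|above s i.-1| * m.+1]].

(** The index [k] counts vertices listed, levels passed and, at level 0, positions scanned. Levels
    may be empty, but every comparison that lets the list go on has found a new vertex ([g < old] in
    [groups]), so the levels passed are paid for by the vertices listed. *)
Definition list_inv (k : nat) (st : state) : Prop :=
  [/\ ram st = M, [/\ regs st 0 = n, regs st 1 = E & regs st 11 = NB] &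
   (regs st 14 = 1 /\ exists l p c, [/\
      [/\ regs st 4 = l, regs st 5 = p & regs st 6 <= n],
      regs st 8 = c /\ c <= 1, l <= top,
      regs st 7 = #|above s (l + c)| /\
      ((l = top /\ c = 1) \/ groups (l + c).+1 (regs st 7)) &
      if 0 < l then
        [/\ perm_eq (outs st) (ids (above s l) ++ take p (elems l)),
            p <= size (elems l), regs st 6 = size (outs st) &
            k = size (outs st) + (top - l)]
      else [/\ perm_eq (outs st)
              (ids (above s 0) ++ [seq x <- iota 0 p | aget M 12 x == 0]),
            p <= n & k = #|above s 0| + top + p]]) \/
   (regs st 14 = 0 /\ exists A, [/\ perm_eq (outs st) (ids A), A != set0,
      k <= 4 * #|A| + 2 & result A])].

Lemma above_leq l l' : l' <= l -> #|above s l| <= #|above s l'|.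
Proof.
by move=> h; apply: subset_leq_card; apply/subsetP => v; rewrite !inE; lia.
Qed.

Lemma above_n l : #|above s l| <= n.
Proof. by apply: leq_trans (max_card _) _; rewrite card_ord. Qed.

Lemma above_top : 0 < top -> 0 < #|above s top.-1|.
Proof.
move=> h; have [_ _ [_ _ [ht|[v hv]]]] := hr; first by lia.
by apply/card_gt0P; exists v; rewrite inE; lia.
Qed.

Lemma list_body_ok k st : list_inv k st -> regs st 14 = 1 ->
  wp list_body st (list_inv k.+1).
Proof.
case=> hram [r0 r1 r11] [[r14 [l [p [c [[r4 r5 r6] [r8 c1] hl [r7 hg] hI]]]]]|].
  2: by move=> [-> //].
move=> _.
have hlT := leq_trans hl top_leq; rewrite /list_body.
branch hl0; rewrite r4 in hl0; last first.
  rewrite {}hl0 {hl hlT} in r4 r7 hg hI; rewrite ltnn in hI; have [h1 h2 h3] := hI.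
  branch hp; rewrite r5 r0 in hp.
    have {}hp : p < n by lia.
    have ei : iota 0 p.+1 = iota 0 p ++ [:: p] by rewrite -(addn1 p) iotaD.
    apply: wp_seq; branch h0; rewrite r5 hram in h0.
      refine (wp_skip _ _ _) => /=; assign_last p' hp'; rewrite r5 addn1 in hp'.
      split=> //; left; split; first by rewrite /upd.
      exists 0, p', c; rewrite ltnn /upd /=; split=> //.
      split=> //; rewrite hp' //; last by rewrite h3 addnS.
      by rewrite ei filter_cat /=; case: eqP => // _; rewrite cats0.
    apply: wp_output; rewrite evalE r5 /=; assign_last p' hp'; rewrite r5 addn1 in hp'.
    split=> //; left; split; first by rewrite /upd.
    exists 0, p', c; rewrite ltnn /upd /=; split=> //.
    split=> //; rewrite hp' //; last by rewrite h3 addnS.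
    by rewrite ei filter_cat /= h0 eqxx catA -cats1 perm_cat2r.
  have ep : p = n by lia.
  assign_last v hv; split=> //; right; split; first by rewrite /upd /= hv.
  exists setT; split=> /=.
  - apply: perm_trans h1 _; apply: eq_ids => [|x|v'].
    + rewrite cat_uniq ids_uniq filter_uniq ?iota_uniq // andbT.
      apply/hasPn => x; rewrite mem_filter mem_iota add0n ep => /and3P[/eqP h4 _ h5].
      apply/negP; rewrite /= -[x]/(nat_of_ord (Ordinal h5)) mem_ids inE.
      by rewrite -(lev_rep _ _ _ _ _ _ _ hr) /= h4.
    + rewrite mem_cat mem_filter mem_iota add0n ep => /orP[/ids_lt//|].
      by case/and3P.
    + rewrite mem_cat mem_ids !inE mem_filter mem_iota add0n ep ltn_ord.
      by rewrite (lev_rep _ _ _ _ _ _ _ hr) andbT /=; case: posnP.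
  - by apply/set0Pn; exists (Ordinal n0); rewrite inE.
  - rewrite h3 cardsT card_ord ep; have h4 := above_n 0.
    case: hg => [[e1 e2]|[g [e1 e2 e3]]]; first by lia.
    by have := above_n (0 + c); rewrite -r7; lia.
  case: hg => [[e1 e2]|[g [e1 e2 e3]]].
    by exists 0, 0; split; [lia | lia | left].
  exists (0 + c).+1, g; split=> //.
    by apply: leq_trans e3 _; rewrite leq_mul2r r7 above_n orbT.
  by left; split=> //; lia.
have l0 : 0 < l by lia.
rewrite l0 in hI; have [h1 h2 h3 h4] := hI.
have esz : size (elems l) = aget M 6 l by rewrite size_map size_iota.
branch hp; rewrite r4 r5 hram -esz in hp.
  have {}hp : p < size (elems l) by lia.
  apply: wp_seq; apply: wp_output; rewrite !evalE /= r4 r5 r11 hram.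
  assign p' hp'; rewrite r5 addn1 in hp'; assign_last c' hc'; rewrite h3 addn1 in hc'.
  split=> //; left; split; first by rewrite /upd.
  exists l, p', c; rewrite /upd /=; split=> //.
    split=> //; rewrite hc' -h3 (leq_trans _ (above_n l.-1)) //.
    rewrite -size_ids -(perm_size (above_elems _ l0 hlT)) h3 (perm_size h1).
    by rewrite !size_cat ltn_add2l size_take hp.
  rewrite l0 hc' size_rcons hp' h4; split=> //.
  rewrite (take_nth 0) // -rcons_cat.
  have -> : nth 0 (elems l) p = aget M 7 (p * NB + l).
    by rewrite (nth_map 0) ?size_iota -?esz // nth_iota -?esz.
  by rewrite -!cats1 perm_cat2r.
have ep : take p (elems l) = elems l by rewrite take_oversize //; lia.
have houts : perm_eq (outs st) (ids (above s l.-1)).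
  by apply: perm_trans h1 _; rewrite ep; apply: above_elems.
have ecnt : regs st 6 = #|above s l.-1| by rewrite h3 (perm_size houts) size_ids.
assign p0 hp0; branch hc; rewrite r8 in hc; last first.
  assign l' hl'; rewrite r4 subn1 in hl'; assign_last c' hc'.
  split=> //; left; split; first by rewrite /upd.
  exists l', 0, 1; rewrite /upd /= hp0 hc'; split=> //; try lia.
    have e1 : l + c = l' + 1 by lia.
    rewrite -e1 r7; split=> //; right; rewrite -r7; case: hg => [[]|//]; lia.
  case: ifP => hl1; rewrite ?take0 /= ?cats0.
    by split=> //; [rewrite hl' | rewrite hl'; lia].
  have e1 : l.-1 = 0 by lia.
  have e2 : #|above s 0| = size (outs st) by rewrite -h3 ecnt e1.
  by rewrite e1 in houts; split=> //; rewrite e2; lia.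
have ec : c = 1 by lia.
branch hchk; rewrite r1 r7 ecnt addn1 ltnS in hchk.
  move/eqP: hchk; rewrite eqb0 negbK => hchk.
  assign_last v hv; split=> //; right; split; first by rewrite /upd /= hv.
  have hA : 0 < #|above s l.-1|.
    case: hg => [[e1 _]|[g [_ h _]]]; first by rewrite e1 above_top -?e1.
    apply: leq_trans (above_leq (l + c) l.-1 _); last by lia.
    by rewrite -r7; lia.
  exists (above s l.-1); split=> //=.
  - by rewrite -card_gt0.
  - have : regs st 7 <= #|above s l.-1| by rewrite r7; apply: above_leq; lia.
    rewrite h4 -h3 ecnt; move: #|_| hA => z hA hz.
    by case: hg => [[e1 _]|[g [e1 e2 e3]]]; lia.
  case: hg => [[e1 _]|[g [e1 e2 e3]]].
    (* The first comparison is with the empty set and never stops the list, since the largest level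
       is inhabited. *)
    exfalso; have : #|above s (l + c)| = 0.
      apply/eqP; rewrite cards_eq0; apply/eqP/setP => v'; rewrite !inE.
      by have [_ _ [_ ht _]] := hr; have := ht v'; lia.
    move=> e2; move: hchk hA; rewrite e2 subn0 leqn0 muln_eq0 => /orP[/eqP->//|].
    by rewrite muln_eq0 /= => /eqP e3; have := E0; rewrite e3.
  exists (l + c).+1, g; split=> //.
    by apply: leq_trans e3 _; rewrite leq_mul2r r7 above_n orbT.
  right; split; first by lia.
    by congr above; lia.
  by apply: close_size hchk; apply: above_leq; lia.
move/eqP: hchk; rewrite eqb0 -ltnNge => /far_size[hck1 hck2].
assign l' hl'; rewrite r4 subn1 in hl'.
assign o' ho'; assign_last c' hc'.
split=> //; left; split; first by rewrite /upd.
exists l', 0, 0; rewrite /upd /= hp0 hc' ho' addn0; split=> //; try lia.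
  rewrite ecnt hl'; split=> //; right.
  case: hg => [[e1 _]|[g [e1 e2 e3]]].
    have h0 : 0 < #|above s l.-1| by rewrite e1 above_top -?e1.
    by exists 0; split; rewrite ?expn0 ?muln1 //; lia.
  exists g.+1; split; first by lia.
    by rewrite -r7 in hck1; apply: leq_ltn_trans e2 hck1.
  rewrite !expnS; have h5 : regs st 7 * m.+1 <= #|above s l.-1| * m by rewrite r7.
  have : regs st 7 * m.+1 * m ^ g <= #|above s l.-1| * m * m ^ g.
    by rewrite leq_mul2r h5 orbT.
  have : m.+1 * m.+1 ^ g <= m.+1 * (regs st 7 * m ^ g) by rewrite leq_mul2l e3 orbT.
  move=> h6 h7; apply: leq_trans h6 _; rewrite (mulnA #|_|).
  by apply: leq_trans h7; rewrite mulnA (mulnC m.+1).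
case: ifP => hl1; rewrite ?take0 /= ?cats0.
  by split=> //; [rewrite hl' | rewrite hl'; lia].
have e1 : l.-1 = 0 by lia.
have e2 : #|above s 0| = size (outs st) by rewrite -h3 ecnt e1.
by rewrite e1 in houts; split=> //; rewrite e2; lia.
Qed.

Lemma list_bounded k st : list_inv k st -> regs st 14 = 1 ->
  bounded [:: 0; 1; 4; 5; 6; 7; 8; 11; 14] X st.
Proof.
case=> hram [r0 r1 r11] [[r14 [l [p [c [[r4 r5 r6] [r8 c1] hl [r7 hg] hI]]]]]|].
  2: by move=> [-> //].
move=> _.
split=> [i|a]; last by rewrite hram; apply: hM.
have hlT := leq_trans hl top_leq; have h7 := above_n (l + c).
have hp : p <= X.
  case: ifP hI => _ [_ h]; last by lia.
  by rewrite size_map size_iota in h => _ _; apply: leq_trans h (low_aget _ _ _ _ hM).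
rewrite !inE; do 8 (case/orP => [/eqP->|]; first by lia).
by move/eqP->; lia.
Qed.

Lemma list_steps k st : list_inv k st -> k <= 4 * n + 2.
Proof.
move=> [_ _ [[_ [l [p [c [_ [_ c1] hl [r7 hg] hI]]]]]|[_ [A [_ _ h _]]]]]; last first.
  have : #|A| <= n by apply: leq_trans (max_card _) _; rewrite card_ord.
  by lia.
have h1 : top <= l + 2 * n.
  case: hg => [[-> _]|[g [e1 e2 _]]]; first by lia.
  by have := above_n (l + c); rewrite -r7; lia.
case: ifP hI => l0 [q1 q2 q3]; last by have := above_n 0; lia.
move=> ->; have h2 : size (outs st) <= n; last by lia.
rewrite (perm_size q1) (leq_trans _ (above_n l.-1)) //.
rewrite -size_ids -(perm_size (above_elems _ l0 (leq_trans hl top_leq))).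
by rewrite !size_cat leq_add2l size_take_min geq_minr.
Qed.

End Query.

Lemma run_list : exists2 a, 0 < a & exists K, forall n E Tc D X w M F (s : conf n),
  fits n E Tc D X -> 0 < E -> 0 < n -> X ^ a < 2 ^ w -> low X M ->
  rep n D (Tc + 8) M F s -> (forall v, lev s v <= Tc) ->
  exists t o (A : {set 'I_n}), [/\ query w list_program [:: n; E; Tc] M t o,
    t <= K * #|A|,
    perm_eq o (ids n A), A != set0 & result n E M s A].
Proof.
have [a1 a10 h1] := wp_exec list_init_cmd.
have [a2 a20 h2] := wp_exec list_body.
exists (a1 + a2); first lia.
exists (cost_max list_init_cmd + 8 * (cost_max list_body + 2)).
move=> n E Tc D X w M F s [X64 hX1 hX2 hX3 [hX4 hX5]] E0 n0 hw hM hr hT.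
have le1 : X ^ a1 <= X ^ (a1 + a2) by apply: leq_expS => //; lia.
have le2 : X ^ a2 <= X ^ (a1 + a2) by apply: leq_expS => //; lia.
have hTc : Tc + 8 <= X by lia.
set st := call_state [:: n; E; Tc] M.
have [||||t1 [st1 [e1 c1 [q1 q2 q3]]]] := h1 X [:: 0; 2] w st
  (fun st' => [/\ list_inv n E Tc M s 0 st', outs st' = [::] & regs st' 14 = 1]) X64.
- by split=> // i; rewrite !inE => /orP[] /eqP->; rewrite /st /=; lia.
- by [].
- by lia.
- rewrite /list_init_cmd /st /call_state; assign x11 h11; assign x4 h4.
  assign x8 h8; assign_last x14 h14; split; [|by []|by rewrite /upd /= h14].
  split=> //; left; split; first by rewrite /upd /= h14.
  exists (aget M 14 0), 0, 1; rewrite /upd /= h4 h8.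
  have hab l : aget M 14 0 <= l -> above s l = set0.
    have [_ _ [_ ht _]] := hr; move=> hl; apply/setP => v; rewrite !inE.
    by have := ht v; lia.
  split=> //.
    by rewrite hab ?cards0 //; [split=> //; left | lia].
  have i0 : ids n set0 = [::] by rewrite /ids /image_mem enum_set0.
  case: ifP => h0; rewrite ?take0 /= hab ?cards0 ?i0 //.
    by split=> //; rewrite ?subnn.
  - by split=> //; lia.
  - by lia.
have [|j st2 hI h0||j [t2 [st2 [e2 hI hg c2]]]] := while_exec
  (list_inv n E Tc M s) (4 * n + 2) (cost_max list_body) w ($14) list_body st1.
- by move=> j st' hI; apply: (list_steps _ _ _ _ X _ _ _ _ _ _ _ _ _ hr) hI.
- have r14 : regs st2 14 = 1 by case: (hI) h0 => _ _ [[-> _]|[/= -> _]].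
  have [||||t2 [st3 [e2 c2 q4]]] := h2 X [:: 0; 1; 4; 5; 6; 7; 8; 11; 14] w st2
    (list_inv n E Tc M s j.+1) X64.
  + by apply: (list_bounded _ _ _ _ X _ _ _ _ _ _ _ _ _ _ hr) r14; last exact: hI.
  + by [].
  + by lia.
  + by apply: (list_body_ok _ _ _ _ X _ _ _ _ _ _ _ _ _ hr) r14.
  by exists t2, st3.
- by [].
case: hI => hram _ [[h14 _]|[_ [A [p1 p2 p3 p4]]]]; first by rewrite /= h14 in hg.
exists (t1 + t2), (outs st2), A; split=> //.
  by exists st2; split=> //; apply: ExecSeq e1 e2.
have A0 : 0 < #|A| by rewrite card_gt0.
apply: leq_trans (leq_add c1 c2) _; rewrite mulnDl.
apply: leq_add; first by rewrite leq_pmulr.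
rewrite mulnAC leq_mul2r; apply/orP; right.
by move: #|A| A0 p3 => z z0 p3; lia.
Qed.

(** * Densities *)

(** Bernoulli's inequality $(1 + 1/m)^m \ge 2$ with its denominators cleared; [H] keeps two terms of
    the binomial expansion. *)
Lemma bernoulli_pow m : 0 < m -> 2 * m ^ m <= m.+1 ^ m.
Proof.
case: m => [//|m] _.
suff H k x : x ^ k.+1 + k.+1 * x ^ k <= x.+1 ^ k.+1.
  by have := H m m.+1; rewrite -expnS addnn -mul2n.
elim: k => [|k IH]; first by rewrite expn0 !expn1; lia.
rewrite [x.+1 ^ _]expnS; have : x.+1 * (x ^ k.+1 + k.+1 * x ^ k) <=
    x.+1 * x.+1 ^ k.+1 by rewrite leq_mul2l IH orbT.
by apply: leq_trans; rewrite !expnS; nia.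
Qed.

(** Every [m] growths by the factor [1 + 1 / m] double the set, which never exceeds [n]. *)
Lemma groups_lt n m g : 0 < m -> m.+1 ^ g <= n * m ^ g -> g < m * bits n.
Proof.
move=> m0 h; rewrite ltnNge; apply/negP => hg; move: h; apply/negP.
rewrite -ltnNge -(subnK hg) !expnD !expnM; set r := g - _.
have h1 : 2 ^ bits n * (m ^ m) ^ bits n <= (m.+1 ^ m) ^ bits n.
  by rewrite -expnMn leq_exp2r ?bernoulli_pow // /bits.
have h2 : m ^ r <= m.+1 ^ r by case: (posnP r) => [->//|r0]; rewrite leq_exp2r.
have h3 : 0 < m ^ r by rewrite expn_gt0 m0.
have h4 : 0 < (m ^ m) ^ bits n by rewrite !expn_gt0 m0.
have h5 := bitsP n.
rewrite mulnCA; apply: (@leq_trans (m ^ r * (2 ^ bits n * (m ^ m) ^ bits n))).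
  by rewrite ltn_mul2l h3 ltn_mul2r h4.
exact: leq_mul.
Qed.

Lemma count_leq_in (T : eqType) (P Q : pred T) (t : seq T) :
  (forall x, x \in t -> P x -> Q x) -> count P t <= count Q t.
Proof.
elim: t => //= x t IH h; apply: leq_add.
  by case: (boolP (P x)) => // hx; rewrite h ?mem_head.
by apply: IH => y yt; apply: h; rewrite inE yt orbT.
Qed.

Lemma sum_indeg n E (s : conf n) (A : {set 'I_n}) :
  \sum_(v in A) indeg E s v = count (fun e => hd s e \in A) E.
Proof. exact: sum_count_head. Qed.

Section Density.
Variables n E Tc : nat.
Notation D := (scale n E).
Notation cap := (4 * Tc).
Notation b := (thr D).
Notation m := (8 * E).
Variables (G : multigraph n) (s : conf n) (M : memory) (A : {set 'I_n}).
Hypotheses (E0 : 0 < E) (hr : rep n D (Tc + 8) M (names n G) s).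
Hypotheses (hst : steady n D cap (names n G) s) (hor : oriented n G s).
Notation top := (aget M 14 0).

(** An edge into a vertex of level at least [i] has its tail at level at least [i - 2], by [eok]. *)
Lemma edges_above i : 2 < i ->
  #|above s i.-1| * b i.-1 <= num_edges_in G (above s i.-2.-1).
Proof.
move=> i3; apply: (@leq_trans (\sum_(v in above s i.-1) indeg (names n G) s v)).
  rewrite -sum_nat_const; apply: leq_sum => v; rewrite inE => hv.
  by have [h _ _ _] := hst.2 v; apply: leq_trans h; rewrite thr_mono; lia.
rewrite sum_indeg /names count_map /num_edges_in; apply: count_leq_in => x xG /=.
rewrite !inE => hx; have [h1 h2 h3] := hst.1 x.1 (map_f _ xG).
case: (hor x xG) => -[e1 e2]; rewrite e1 in h1 hx; rewrite e2 in h3;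
  move: h1 h3 hx; move: (lev _ _) (lev _ _) (lab _ _) => p q l; lia.
Qed.

(* [t] is the number of levels between the largest one and that of the vertex
   set [A], plus 3. *)
Lemma result_density : A != set0 -> result n E M s A -> exists beta t,
  [/\ b top.+2 * (D - t) <= D * (beta + 4 * t), t * (10 * E) <= D,
      0 < t, t <= 19 * (E * bits n) &
      #|A| * m * beta <= m.+1 * num_edges_in G A + 4 * m * #|A|].
Proof.
(* [b i.-1] is the in-degree guaranteed at level [i], and [2 * g + 3] steps lead from its index to
   [top.+2], the index in [max_indegree_leq]. *)
move=> hA [i [g [htop hg hi]]]; exists (b i.-1), (2 * g + 3).
have gJ : g < m * bits n by apply: groups_lt hg; lia.
have J0 : 0 < E * bits n by rewrite muln_gt0 E0.
have ht : 2 * g + 3 <= 19 * (E * bits n) by lia.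
split=> //; last 2 first.
- by lia.
- case: hi => [[i2 _]|[i3 -> hsz]].
    (* For [A] the whole vertex set nothing is known about its density, but the threshold is at most
       4 and the additive term covers it. *)
    have b1 : b 1 = 4 by rewrite thrS (_ : b 0 = 0) // div0n.
    have h4 : b i.-1 <= 4 by rewrite -b1 thr_mono; lia.
    apply: leq_trans (leq_addl _ _).
    move: #|A| (8 * E) (b i.-1) h4 => z y x h4.
    have -> : 4 * y * z = z * y * 4 by rewrite mulnC (mulnC 4) mulnA.
    by rewrite leq_mul2l h4 orbT.
  apply: leq_trans (leq_addr _ _); apply: leq_trans (leq_mul hsz (leqnn _)) _.
  by rewrite (mulnC _ m.+1) -mulnA leq_mul2l edges_above ?orbT.
- apply: leq_trans (thr_growth D i.-1 (2 * g + 3) _); last first.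
    by have := scale_gt1 n E E0; lia.
  by rewrite leq_mul2r; apply/orP; right; rewrite thr_mono; lia.
rewrite /scale; have : (2 * g + 3) * (10 * E) <= 19 * (E * bits n) * (10 * E).
  by rewrite leq_mul2r ht orbT.
by nia.
Qed.

Lemma max_indegree_leq : b top.+1 <= cap -> max_indegree G (hd s) <= b top.+2.
Proof.
move=> hc; apply/bigmax_leqP => v _; rewrite indegree_names.
have [_ _ [_ ht _]] := hr; have hv := ht v.
have D2 := scale_gt1 n E E0.
apply: leq_trans (vok_ub D cap D2 _ _ _ (hst.2 v) (hot_leq _ _ _ _) _) _.
  by apply: leq_trans hc; rewrite thr_mono.
by rewrite thr_mono !ltnS.
Qed.

End Density.

Lemma num_edges_indegree n (G : multigraph n) head (A : {set 'I_n}) :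
  is_orientation G head -> num_edges_in G A <= #|A| * max_indegree G head.
Proof.
move=> ho; apply: (@leq_trans (\sum_(v in A) indegree G head v)); last first.
  rewrite -sum_nat_const; apply: leq_sum => v _.
  exact: (leq_bigmax v).
rewrite (eq_bigr (fun v => count (fun e => head e == v) (names n G))); last first.
  by move=> v _; rewrite indegree_names.
rewrite sum_count_head /names count_map; apply: count_leq_in => x xG /=.
by move=> /andP[h1 h2]; case: (ho x xG) => ->.
Qed.

Lemma cost_leq_pot n D cap (G : multigraph n) s h : oriented n G s ->
  optimal n D cap G h -> cost n D cap G h <= pot n D cap (names n G) s.
Proof.
move=> ho [_ hopt]; apply: leq_trans (hopt _ (oriented_orientation _ _ _ ho)) _.
rewrite /pot; apply: leq_trans (leq_addr _ _); apply: eq_leq.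
by apply: eq_bigr => v _; rewrite indegree_names.
Qed.

Lemma leq_mul_div_pred d l : 0 < d -> l <= d * (l.-1 %/ d + 2).
Proof.
move=> d0; rewrite mulnDr mulnC; have := divn_eq l.-1 d.
by have := ltn_pmod l.-1 d0; lia.
Qed.

(** The thresholds double every [D] levels, starting from [thr D 1 = 4], and are capped at
    [4 * Tc]. *)
Lemma levels_log n E Tc : 0 < E -> exists k, 2 ^ k <= Tc.+1 /\
  flev (scale n E) (4 * Tc) (4 * Tc) <= scale n E * (k + 2).
Proof.
move=> E0; set D := scale n E; have D2 : 1 < D := scale_gt1 n E E0.
set L := flev _ _ _; exists ((L.-1) %/ D); split; last first.
  exact: leq_mul_div_pred (ltnW D2).
have hL : thr D L <= 4 * Tc by apply: flev_cap.
case: (posnP L) => [->|L0]; first by rewrite div0n.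
have H k : 4 * 2 ^ k <= thr D (1 + k * D).
  elim: k => [|k IH]; first by rewrite mul0n thrS leq_addl.
  rewrite (_ : 1 + k.+1 * D = 1 + k * D + D); last by rewrite mulSn; lia.
  apply: leq_trans (thr_double D _ (ltnW D2)).
  by rewrite expnS mulnCA leq_mul2l IH.
have := H (L.-1 %/ D).
have : thr D (1 + L.-1 %/ D * D) <= thr D L.
  by rewrite thr_mono; have := divn_eq L.-1 D; lia.
by lia.
Qed.

(** Loops are excluded. This settles the case in which [ln n] is 0 and the time bounds leave no
    room. *)
Lemma evolves_one (us : seq (update 1)) G : evolves us G -> us = [::] /\ G = [::].
Proof.
by elim=> [//|us' G' u v _ _|us' G' e _ [_ ->] //]; rewrite !ord1 eqxx.
Qed.

Lemma runs_size w A params n (us : seq (update n)) ts M :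
  runs w A params us ts M -> size ts = size us.
Proof. by elim=> [//|us' ts' M' u t M'' _ IH _]; rewrite !size_rcons IH. Qed.

Lemma run_head : exists2 a, 0 < a & exists K, forall n E Tc D X w M F
    (s : conf n) e,
  fits n E Tc D X -> X ^ a < 2 ^ w -> low X M -> e <= X ->
  rep n D (Tc + 8) M F s -> e \in F ->
  exists2 t, t <= K &
    query w (head_cmd program) [:: n; E; Tc; e] M t [:: nat_of_ord (hd s e)].
Proof.
have [a a0 h] := wp_exec (head_cmd program).
exists a => //; exists (cost_max (head_cmd program)).
move=> n E Tc D X w M F s e [X64 _ _ _ _] hw hM eX hr eF.
have [e9 _ _] := edge_rep _ _ _ _ _ _ _ hr eF.
set st := call_state [:: n; E; Tc; e] M.
have [||||t [st1 [e1 c1 [q1 q2]]]] := h X [:: 3] w st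
  (fun st' => ram st' = M /\ outs st' = [:: nat_of_ord (hd s e)]) X64.
- by split=> // i; rewrite inE => /eqP->.
- by [].
- by [].
- by apply: wp_output; rewrite !evalE /= e9.
by exists t => //; exists st1.
Qed.

(** Three powers of [N] cover the products of parameters; the other thirteen, worth at least
    [2 ^ 13], cover constants such as 800. *)
Lemma scale_fits n E Tc N k : 0 < n -> 0 < E -> N = n + E + Tc + k ->
  fits n E Tc (scale n E) (N ^ 16) /\ k < N ^ 16.
Proof.
move=> n0 E0 hN; have N2 : 2 <= N by lia.
have hp j : 2 ^ j <= N ^ j by case: j => // j; rewrite leq_exp2r.
have h1 : 2 ^ 13 * N ^ 3 <= N ^ 16 by rewrite (expnD N 13 3) leq_mul2r hp orbT.
have h2 : N <= N ^ 3 by rewrite -{1}(expn1 N) leq_exp2l.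
have h3 : N * N <= N ^ 3 by rewrite -{1 2}(expn1 N) -expnD leq_exp2l.
have h4 : (2 ^ 13 = 8192) by [].
have hD : 2 * scale n E <= 800 * N ^ 3.
  have := bits_leq n; rewrite /scale => hb.
  have k1 : bits n * E <= 2 * N * N by apply: leq_mul; lia.
  have k2 : bits n * E * E <= 2 * N * N * N by apply: leq_mul; lia.
  by rewrite !expnS expn0 muln1; lia.
have hNB : n * (Tc + 8) <= 9 * N ^ 3.
  by apply: (@leq_trans (N * (9 * N))); [apply: leq_mul; lia | lia].
rewrite h4 in h1; split; [split|]; lia.
Qed.

Local Close Scope cmd_scope.
Import Order.TTheory GRing.Theory Num.Theory.
Local Open Scope ring_scope.

(** * Real bounds *)

Section Reals.
Variable R : realType.
Implicit Types (eps x y : R).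

Lemma ln2_gt0 : 0 < ln 2%:R :> R.
Proof. by rewrite ln_gt0 // ltr1n. Qed.

Lemma ceil_nat_bounds x : 0 <= x -> x <= (ceil_nat x)%:R < x + 1.
Proof.
move=> x0; rewrite /ceil_nat natr_absz ger0_norm; last first.
  by rewrite -(ler_int R) (le_trans x0) // ceil_ge.
by rewrite ceil_ge /= -ltrBlDr -[1]/(1%:~R) -intrB; have := gt_pred_ceil x.
Qed.

Lemma ln_pow2 k x : (2 ^ k)%:R <= x -> k%:R * ln 2%:R <= ln x.
Proof.
move=> h; have p0 : (0 : R) < (2 ^ k)%:R by rewrite ltr0n expn_gt0.
rewrite mulr_natl -lnXn ?ltr0n // -natrX ler_ln ?posrE //.
exact: lt_le_trans p0 h.
Qed.

Lemma bits_ln n : (1 < n)%N -> (bits n)%:R <= 3 / ln 2%:R * ln n%:R :> R.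
Proof.
move=> n1; have l2 := ln2_gt0.
have h : (2 ^ (up_log 2 n).-1 <= n)%N by apply: ltnW; apply: up_log_gtn.
have h1 : (up_log 2 n).-1%:R * ln 2%:R <= ln n%:R :> R.
  by apply: ln_pow2; rewrite ler_nat.
have h2 : ln 2%:R <= ln n%:R :> R by rewrite ler_ln ?posrE ?ltr0n ?ler_nat //; lia.
have h3 : (bits n)%:R <= (up_log 2 n).-1%:R + 2 :> R.
  by rewrite -natrD ler_nat /bits; lia.
rewrite mulrAC ler_pdivlMr //.
apply: le_trans (_ : ((up_log 2 n).-1%:R + 2) * ln 2%:R <= _).
  by rewrite ler_wpM2r // ltW.
by lra.
Qed.

(* With [1 / E <= eps], the losses [1 / (10 * E)] from the growth of the
   thresholds and [1 / (8 * E)] from the stopping rule fit within [eps]. *)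
Lemma approximation eps (M2 D beta t E rho : R) :
  0 < eps -> eps <= 1 -> 1 <= E -> 1 <= eps * E -> 1 <= t -> 0 <= rho ->
  0 <= M2 -> t * (10 * E) <= D -> M2 * (D - t) <= D * (beta + 4 * t) ->
  8 * E * beta <= (8 * E + 1) * rho + 4 * (8 * E) ->
  M2 <= (1 + eps) * rho + 10 * t.
Proof.
move=> e0 e1 E1 eE t1 r0 M0 htD hM hb.
have D0 : 0 < D by nra.
have h1 : M2 * (10 * E - 1) <= 10 * E * (beta + 4 * t).
  have k1 : D * (10 * E - 1) <= (D - t) * (10 * E) by nra.
  have k2 : M2 * (D * (10 * E - 1)) <= M2 * ((D - t) * (10 * E)).
    by rewrite ler_wpM2l.
  have k3 : M2 * (D - t) * (10 * E) <= D * (beta + 4 * t) * (10 * E).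
    by rewrite ler_wpM2r //; lra.
  rewrite -(ler_pM2l D0); lra.
have h2 : (10 * E - 1) * M2 <= (10 * E - 1) * ((1 + eps) * rho + 10 * t).
  have k1 : 40 * E * t >= 40 * E by nra.
  have k2 : 20 * E * t >= 10 * t by nra.
  have k3 : 10 * E + 8 <= (10 * E - 1) * (1 + eps) by nra.
  have k4 : (10 * E + 8) * rho <= (10 * E - 1) * (1 + eps) * rho.
    by rewrite ler_wpM2r.
  nra.
by rewrite ler_pM2l in h2 => //; lra.
Qed.

End Reals.

Section OptLP.
Variables (R : realType) (n : nat) (G : multigraph n).

Lemma density_ge0 A : 0 <= density R G A.
Proof. by rewrite /density divr_ge0. Qed.

Lemma density_opt A : A != set0 -> density R G A <= opt_lp R G.
Proof. by move=> hA; rewrite /opt_lp (bigD1 A) //= le_max lexx. Qed.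

Lemma opt_indegree head : is_orientation G head ->
  opt_lp R G <= (max_indegree G head)%:R.
Proof.
move=> ho; rewrite /opt_lp; apply: (big_ind (fun x => x <= _)) => //.
  by move=> x y hx hy; rewrite ge_max hx hy.
move=> A hA; rewrite /density ler_pdivrMr ?ltr0n ?card_gt0 //.
by rewrite -natrM ler_nat mulnC num_edges_indegree.
Qed.

End OptLP.

Section Bounds.
Variables (R : realType) (eps : R) (n : nat).
Notation c := (3 / ln 2%:R : R).
Notation E := (ceil_nat eps^-1).
Notation lg := (ln n%:R : R).
Hypotheses (e0 : 0 < eps) (e1 : eps <= 1) (n1 : (1 < n)%N).

Lemma ceil_inv : [/\ (0 < E)%N, 1 <= eps * E%:R & E%:R <= 2 / eps].
Proof.
have i0 : 0 < eps^-1 by rewrite invr_gt0.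
have /andP[h1 h2] := ceil_nat_bounds _ _ (ltW i0).
have i1 : 1 <= eps^-1 by rewrite invf_ge1.
split; first by rewrite -(ltr_nat R) (lt_le_trans i0).
  by rewrite mulrC -ler_pdivrMr // mul1r.
by rewrite (le_trans (ltW h2)) //; lra.
Qed.

Lemma lg_gt0 : ln 2%:R <= lg /\ 0 < lg.
Proof.
have h : ln 2%:R <= lg by rewrite ler_ln ?posrE ?ltr0n ?ler_nat //; lia.
by split=> //; apply: lt_le_trans h; apply: ln2_gt0.
Qed.

Lemma bits_bound : (E * bits n)%:R <= 2 * c * (lg / eps).
Proof.
have [_ _ h1] := ceil_inv; have h2 := bits_ln R n n1.
rewrite natrM; apply: le_trans (ler_pM _ _ h1 h2) _ => //.
by rewrite le_eqVlt; apply/orP; left; apply/eqP; field; rewrite !gt_eqF // ln2_gt0.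
Qed.

Lemma scale_bound : (scale n E)%:R <= 800 * c * (lg / eps ^+ 2).
Proof.
have [_ _ h1] := ceil_inv; have h2 := bits_bound.
have -> : (scale n E)%:R = 200 * ((E * bits n)%:R * E%:R) :> R.
  by rewrite -!natrM; congr (_%:R); rewrite /scale; lia.
apply: (@le_trans _ _ (200 * (2 * c * (lg / eps) * (2 / eps)))).
  by rewrite ler_wpM2l // ler_pM.
by rewrite le_eqVlt; apply/orP; left; apply/eqP; field; rewrite !gt_eqF // ln2_gt0.
Qed.

Variable T : R.
Hypothesis hT : (190 * c + 2 / ln 2%:R) * lg / eps ^+ 2 <= T.

(** This is the origin of [C]: the part [190 * c] bounds half of the additive error by [T], and
    [2 / ln 2] gives [T >= 2], which keeps [ln T] away from 0. *)
Lemma T_bounds : 2 <= T /\ 190 * c * (lg / eps) <= T.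
Proof.
have [l1 l2] := lg_gt0; have p2 := ln2_gt0 R; have c0 : 0 < c by rewrite divr_gt0.
have i1 : 1 <= eps^-1 by rewrite invf_ge1.
have hx : lg / eps <= lg / eps ^+ 2.
  rewrite ler_pM2l // expr2 invfM; have i0 : 0 < eps^-1 by rewrite invr_gt0.
  by rewrite ler_peMl // ltW.
have hy : lg <= lg / eps by rewrite ler_peMr // ltW.
have hz : 2 <= 2 / ln 2%:R * (lg / eps ^+ 2).
  rewrite mulrAC ler_pdivlMr // ler_pM2l //; lra.
have h0 : 0 <= lg / eps by lra.
move: hT; rewrite -mulrA mulrDl => h.
have hc : 190 * c * (lg / eps) <= 190 * c * (lg / eps ^+ 2).
  by rewrite ler_wpM2l //; lra.
have hc0 : 0 <= 190 * c * (lg / eps) by rewrite mulr_ge0 //; lra.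
by split; lra.
Qed.

(** The 5 is 2 from [2 ^ k <= T + 2 <= T ^ 2] and 3 from [ln 2 <= ln T]. *)
Lemma log_bound k : (2 ^ k <= (ceil_nat T).+1)%N -> k%:R + 3 <= 5 / ln 2%:R * ln T.
Proof.
move=> hk; have [T2 _] := T_bounds; have p2 := ln2_gt0 R.
have T0 : 0 <= T by lra.
have /andP[_ h2] := ceil_nat_bounds _ _ T0.
have h3 : (2 ^ k)%:R <= T ^+ 2.
  have : (2 ^ k)%:R <= ((ceil_nat T).+1)%:R :> R by rewrite ler_nat.
  rewrite -natr1 expr2; nra.
have := ln_pow2 _ _ _ h3; rewrite lnXn; last lra.
have : ln 2%:R <= ln T by rewrite ler_ln ?posrE ?ltr0n //; lra.
rewrite mulrAC ler_pdivlMr // => h4 h5; lra.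
Qed.

End Bounds.

Lemma leq_of_mul (t e d : nat) : (0 < e)%N -> (t * (10 * e) <= d)%N -> (t <= d)%N.
Proof. by move=> e0; apply: leq_trans; rewrite leq_pmulr // muln_gt0. Qed.

Lemma bits_scale n E : (0 < E)%N ->
  (5 * bits n + 13 <= 18 * scale n E)%N /\ (bits n + 2 <= scale n E)%N.
Proof. by move=> E0; rewrite /scale /bits; split; nia. Qed.

(** [c <= p] cancels the optimum against the potential; 23 is the coefficient 5 of [D] plus the 18
    that absorb [5 * J + 13]. *)
Lemma total_arith (K S m J D i p c : nat) :
  (S <= K * (m * J.+1 + i))%N -> (i + p <= c + (4 * J + 5 * D + 12) * m)%N ->
  (c <= p)%N -> (5 * J + 13 <= 18 * D)%N -> (S <= K * (23 * D * m))%N.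
Proof.
move=> h1 h2 h3 h4; apply: leq_trans h1 _; rewrite leq_mul2l; apply/orP; right.
have h5 : (i <= (4 * J + 5 * D + 12) * m)%N by lia.
apply: leq_trans (leq_add (leqnn _) h5) _; rewrite mulnC -mulnDl leq_mul2r.
by apply/orP; right; lia.
Qed.

Lemma worst_arith (K t J D L k : nat) :
  (t <= K * (J + L * (2 * D).+1 + 2 * D).+2)%N -> (L <= D * (k + 2))%N ->
  (J + 2 <= D)%N -> (t <= K * (3 * D * D * (k + 3)))%N.
Proof.
move=> h1 h2 h3; apply: leq_trans h1 _; rewrite leq_mul2l; apply/orP; right.
have h4 : (L * (2 * D).+1 <= D * (k + 2) * (2 * D).+1)%N by rewrite leq_mul2r h2 orbT.
have h5 : (D * (k + 2) * (2 * D).+1 <= D * (k + 2) * (3 * D))%N.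
  by rewrite leq_mul2l; apply/orP; right; lia.
have h6 : (D <= D * D)%N by rewrite leq_pmulr //; lia.
by nia.
Qed.

Lemma fits_level n E Tc k : (0 < n)%N -> (0 < E)%N -> (1 < n + E + Tc + k)%N.
Proof. by lia. Qed.

Lemma pow16_lt N b a w : (1 < N)%N -> (b <= a)%N -> (N ^ (16 * a).+1 <= 2 ^ w)%N ->
  ((N ^ 16) ^ b < 2 ^ w)%N.
Proof.
by move=> N2 hb hw; apply: leq_trans hw; rewrite -expnM ltn_exp2l //; lia.
Qed.

Lemma density_result (R : realType) (eps T : R) n (G : multigraph n)
    (s : conf n) M (A : {set 'I_n}) :
  0 < eps -> eps <= 1 -> (1 < n)%N ->
  (190 * (3 / ln 2%:R) + 2 / ln 2%:R) * ln n%:R / eps ^+ 2 <= T ->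
  let E := ceil_nat eps^-1 in let Tc := ceil_nat T in
  rep n (scale n E) (Tc + 8) M (names n G) s ->
  steady n (scale n E) (4 * Tc) (names n G) s -> oriented n G s ->
  A != set0 -> result n E M s A -> opt_lp R G <= T ->
  (max_indegree G (hd s))%:R <=
    (1 + eps) * density R G A + 380 * (3 / ln 2%:R) * (ln n%:R / eps).
Proof.
move=> e0 e1 n1 hT E Tc hr hst hor hA hres hopt.
have [E0 eE _] := ceil_inv R eps e0 e1.
have [T2 hT'] := T_bounds R eps n e0 e1 n1 T hT.
have T0 : 0 <= T by lra.
have /andP[hTc _] := ceil_nat_bounds R _ T0.
have [beta [t [h1 h2 h3 h4 h5]]] :=
  result_density n E Tc G s M A E0 hst hor hA hres.
have hEJ := bits_bound R eps n e0 e1 n1.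
have r0 : 0 <= density R G A by apply: density_ge0.
have hrT := le_trans (density_opt R n G A hA) hopt.
set top := aget M 14 0 in h1.
have cA : 0 < #|A|%:R :> R by rewrite ltr0n card_gt0.
have ht : t%:R <= 19 * (2 * (3 / ln 2%:R) * (ln n%:R / eps)) :> R.
  apply: le_trans (_ : 19 * (E * bits n)%:R <= _); last by rewrite ler_wpM2l.
  by rewrite -natrM ler_nat.
have htD : (t <= scale n E)%N := leq_of_mul _ _ _ E0 h2.
have hM2 : (thr (scale n E) top.+2)%:R <= (1 + eps) * density R G A + 10 * t%:R.
  apply: (@approximation R eps _ (scale n E)%:R beta%:R t%:R E%:R) => //.
  - by rewrite ler1n.
  - by rewrite ler1n.
  - by rewrite -!natrM ler_nat.
  - by rewrite -natrB // -!natrM -natrD -natrM ler_nat.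
  have hden : density R G A * #|A|%:R = (num_edges_in G A)%:R.
    by rewrite /density divfK ?gt_eqF.
  have : (#|A| * (8 * E) * beta)%:R <=
      ((8 * E).+1 * num_edges_in G A + 4 * (8 * E) * #|A|)%:R :> R.
    by rewrite ler_nat.
  have e8 : ((8 * E).+1)%:R = 8 * E%:R + 1 :> R by rewrite -[LHS]natr1 natrM.
  rewrite natrD !natrM e8 -hden => h6.
  rewrite -(ler_pM2r cA); move: h6.
  move: (density R G A) (#|A|%:R : R) (E%:R : R) (beta%:R : R) => x1 x2 x3 x4 h6.
  by lra.
(* If the cap interfered, [thr top.+2] would exceed [4 * T]; but the density contributes at most
   [2 * T] to it and the additive error at most [2 * T]. Hence the factor 4 in the cap. *)
have hcap : (thr (scale n E) top.+1 <= 4 * Tc)%N.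
  rewrite leqNgt; apply/negP => hc.
  have : (thr (scale n E) top.+1 <= thr (scale n E) top.+2)%N by rewrite thr_mono.
  move=> h6; have h7 : (4 * Tc)%:R < (thr (scale n E) top.+2)%:R :> R.
    by rewrite ltr_nat; apply: leq_trans hc h6.
  rewrite natrM in h7; rewrite -/Tc in hTc.
  have h8 : eps * density R G A <= 1 * T by apply: ler_pM => //; lra.
  lra.
apply: le_trans (_ : (thr (scale n E) top.+2)%:R <= _).
  by rewrite ler_nat; apply: (max_indegree_leq n E Tc G s M E0 hr hst hcap).
by lra.
Qed.

Theorem theorem5p1 (R : realType) :
  exists C : R, 0 < C /\
  exists (eps0 K : R) (k a : nat) (A : algorithm), 0 < eps0 /\
  forall (eps : R) (n : nat) (T : R),
    0 < eps -> eps <= eps0 -> (0 < n)%N -> C * ln n%:R / eps ^+ 2 <= T ->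
  forall (us : seq (update n)) (G : multigraph n) (w : nat),
    evolves us G ->
    ((n + ceil_nat eps^-1 + ceil_nat T + size us) ^ a <= 2 ^ w)%N ->
  let params := [:: n; ceil_nat eps^-1; ceil_nat T] in
  exists (ts : seq nat) (M : memory) (head : nat -> 'I_n) (S : {set 'I_n}),
    [/\ runs w A params us ts M,
        (sumn ts)%:R <= K * (ln n%:R / eps ^+ 2) * (size us)%:R,
        forall t, t \in ts ->
          t%:R <= K * (ln n%:R ^+ 2 * ln T / eps ^+ 4),
        holds_orientation k w A params M G head /\
        holds_vertices k w A params M S &
        opt_lp R G <= T ->
          (max_indegree G head)%:R
            <= (1 + eps) * opt_lp R G + K * (ln n%:R / eps) /\
          (1 - eps) * opt_lp R G - K * (ln n%:R / eps) <= density R G S].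
Proof.
have [a1 a10 [K1 run1]] := run_all.
have [a2 a20 [K2 run2]] := run_list.
have [a3 a30 [K3 run3]] := run_head.
have p2 := ln2_gt0 R; pose c : R := 3 / ln 2%:R.
have c0 : 0 < c by rewrite divr_gt0.
have d0 : 0 < 5 / ln 2%:R :> R by rewrite divr_gt0.
exists (190 * c + 2 / ln 2%:R); split.
  by apply: addr_gt0; [apply: mulr_gt0 | apply: divr_gt0].
pose Ka : R := 23 * K1%:R * (800 * c).
pose Kw : R := 3 * K1%:R * (800 * c) ^+ 2 * (5 / ln 2%:R).
pose Kd : R := 380 * c.
have c800 : 0 <= 800 * c by rewrite mulr_ge0 // ltW.
have Ka0 : 0 <= Ka by rewrite mulr_ge0 // mulr_ge0.
have Kw0 : 0 <= Kw.
  by apply: mulr_ge0 (ltW d0); rewrite mulr_ge0 ?exprn_ge0 // mulr_ge0.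
have Kd0 : 0 <= Kd by rewrite mulr_ge0 // ltW.
(* The 16 is the exponent of [scale_fits]; the successor turns the bound on the word size into the
   strict one that [wp_exec] needs. *)
exists 1, (Ka + Kw + Kd), (K2 + K3)%N, (16 * (a1 + a2 + a3)).+1, program.
split=> // eps n T e0 e1 n0 hT us G w hev hw params.
have one : n = 1%N -> us = [::] /\ G = [::].
  by move=> en; move: us G hev {hw}; rewrite en; apply: evolves_one.
have cases : n = 1%N \/ (1 < n)%N.
  by move: n0; rewrite leq_eqVlt => /predU1P[<-|]; [left | right].
have [E0 eE E2] := ceil_inv R eps e0 e1.
set E := ceil_nat eps^-1 in hw params E0 eE E2 *.
set Tc := ceil_nat T in hw params *.
have lg0 : 0 <= ln n%:R :> R by rewrite ln_ge0 // ler1n.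
have T0 : 0 <= T.
  apply: le_trans hT; rewrite divr_ge0 ?exprn_ge0 ?mulr_ge0 //; last exact: ltW.
  by apply: addr_ge0; [rewrite mulr_ge0 // ltW | rewrite divr_ge0 // ltW].
have [hfit hsz] := scale_fits n E Tc _ (size us) n0 E0 erefl.
have hexp b hb := pow16_lt _ b _ _ (fits_level n E Tc (size us) n0 E0) hb hw.
have le1 : (a1 <= a1 + a2 + a3)%N by rewrite -addnA leq_addr.
have le2 : (a2 <= a1 + a2 + a3)%N by rewrite addnAC leq_addl.
have le3 : (a3 <= a1 + a2 + a3)%N by rewrite leq_addl.
have [ts [M [s [h [i [hr [ht hi] hts ho [hM hrep hst hor]]]]]]] :=
  run1 n E Tc _ w hfit E0 n0 (hexp _ le1) us G hev hsz.
have hlev v : (lev s v <= Tc)%N.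
  have [_ _ q _] := hst.2 v; have := leq_trans (thr_ge _ _) q.
  by rewrite leq_mul2l.
have [t [o [A [hq htA hoA hA hres]]]] :=
  run2 n E Tc _ _ w M _ s hfit E0 n0 (hexp _ le2) hM hrep hlev.
have [sG hs] := evolves_names _ _ _ hev.
have hori := oriented_orientation _ _ _ hor.
have hsize := runs_size _ _ _ _ _ _ _ hr.
have [bs1 bs2] := bits_scale n E E0.
exists ts, M, (hd s), A; split=> //.
- case: cases => n1.
    have [eus _] := one n1; rewrite eus mulr0.
    by move: hsize; rewrite eus => /size0nil ->.
  have hD := scale_bound R eps n e0 e1 n1; rewrite -/E in hD.
  have hcost := cost_leq_pot n _ _ G s h hor ho.
  have h1 := total_arith _ _ _ _ _ _ _ _ ht hi hcost bs1.
  have h4 : (sumn ts)%:R <= K1%:R * (23 * (scale n E)%:R * (size us)%:R) :> R.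
    by rewrite -!natrM ler_nat.
  have lx0 : 0 <= ln n%:R / eps ^+ 2 by rewrite divr_ge0 // exprn_ge0 // ltW.
  apply: le_trans h4 _; rewrite mulrA; apply: ler_wpM2r => //.
  apply: (@le_trans _ _ (Ka * (ln n%:R / eps ^+ 2))); last first.
    by apply: ler_wpM2r => //; rewrite -addrA lerDl addr_ge0.
  have hx : 23 * K1%:R * (scale n E)%:R <=
      23 * K1%:R * (800 * c * (ln n%:R / eps ^+ 2)) :> R.
    by apply: ler_wpM2l => //; rewrite mulr_ge0.
  by rewrite /Ka mulrA (mulrC K1%:R); apply: le_trans hx _; rewrite !mulrA.
- move=> t' ht'; case: cases => n1.
    have [eus _] := one n1.
    by move: hsize ht'; rewrite eus => /size0nil ->.
  have hD := scale_bound R eps n e0 e1 n1; rewrite -/E in hD.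
  have [k [hk1 hk2]] := levels_log n E Tc E0.
  have h1 := worst_arith _ _ _ _ _ _ (hts _ ht') hk2 bs2.
  have hk := log_bound R eps n e0 e1 n1 T hT k hk1.
  have h4 : t'%:R <= K1%:R * (3 * (scale n E)%:R * (scale n E)%:R * (k%:R + 3)) :> R.
    by rewrite -natrD -!natrM ler_nat.
  apply: le_trans h4 _.
  set x := ln n%:R / eps ^+ 2 in hD.
  have x0 : 0 <= x by rewrite divr_ge0 ?exprn_ge0 // ltW.
  have lT0 : 0 <= ln T.
    by rewrite ln_ge0 //; have [] := T_bounds R eps n e0 e1 n1 T hT; lra.
  apply: (@le_trans _ _ (Kw * (x ^+ 2 * ln T))).
    have h5 : (scale n E)%:R * (scale n E)%:R <= (800 * c * x) ^+ 2.
      by rewrite expr2; apply: ler_pM.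
    have h6 : (scale n E)%:R * (scale n E)%:R * (k%:R + 3) <=
        (800 * c * x) ^+ 2 * (5 / ln 2%:R * ln T).
      by apply: ler_pM => //; rewrite ?mulr_ge0 ?addr_ge0.
    rewrite (_ : Kw * _ = 3 * K1%:R * ((800 * c * x) ^+ 2 * (5 / ln 2%:R * ln T))).
      rewrite (_ : K1%:R * _ = 3 * K1%:R *
        ((scale n E)%:R * (scale n E)%:R * (k%:R + 3))); last by ring.
      by rewrite ler_wpM2l // mulr_ge0.
    by rewrite /Kw; ring.
  rewrite (_ : x ^+ 2 * ln T = ln n%:R ^+ 2 * ln T / eps ^+ 4); last first.
    by rewrite /x; field; rewrite gt_eqF.
  apply: ler_wpM2r; last by rewrite addrAC lerDr addr_ge0.
  by rewrite divr_ge0 ?mulr_ge0 ?exprn_ge0 // ltW.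
- split.
    split=> // x xG; have xs := ltn_trans (hs x.1 (map_f _ xG)) hsz.
    have [t' ht' hq'] := run3 n E Tc _ _ w M (names n G) s x.1 hfit (hexp _ le3)
      hM (ltnW xs) hrep (map_f _ xG).
    by exists t' => //; apply: leq_trans ht' (leq_addl _ _).
  split=> //; exists t, o; split=> //.
  by apply: leq_trans htA _; rewrite leq_mul2r leq_addr orbT.
(* The optimum lies between the density of [A] and the largest in-degree, so the single bound [hm]
   on the latter by the former gives both approximations. *)
move=> hopt; have hd1 := density_opt R n G A hA.
have hd2 := opt_indegree R n G _ hori.
have hd0 := density_ge0 R n G A.
have lge : 0 <= ln n%:R / eps by rewrite divr_ge0 // ltW.
have hm : (max_indegree G (hd s))%:R <=
    (1 + eps) * density R G A + Kd * (ln n%:R / eps).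
  case: cases => n1; last first.
    exact: (density_result R eps T n G s M A e0 e1 n1 hT hrep hst hor hA hres hopt).
  have [_ eG] := one n1; rewrite (_ : max_indegree _ _ = 0%N); last first.
    by rewrite /max_indegree big1 // => v _; rewrite eG.
  have e1' : 0 <= 1 + eps by apply: addr_ge0; [exact: ler01 | exact: ltW].
  exact: addr_ge0 (mulr_ge0 e1' hd0) (mulr_ge0 Kd0 lge).
have hK : Kd * (ln n%:R / eps) <= (Ka + Kw + Kd) * (ln n%:R / eps).
  by rewrite ler_wpM2r // lerDr addr_ge0.
move: hm hK; set y := Kd * _; set z := (Ka + Kw + Kd) * _ => hm hK.
have y0 : 0 <= y by rewrite mulr_ge0.
move: hd1 hd2 hd0 hm hK y0 e0 e1; clear.
move: (density R G A) (opt_lp R G) ((max_indegree _ _)%:R : R) y z => p q d y z.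
by move=> *; split; nra.
Qed.
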